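(* Let $d\ge 1$ be an integer and $\beta\in(0,1]$. Let $Z=(Z_n)_{n\ge 1}$ be the sequence of points in $[0,1)^d$ produced by the Haar $(1+\beta)$-thinning strategy. Then for all integers $n\ge 2$ and all $\Delta>0$, $$\mathbb P\Big(\mathrm{Dis}(Z^n)\ge\beta^{-1}\log^{2d}(n)\,\big(\Delta+1000+100d^2\log n\big)\Big)\le\beta^{-2}e^{-\Delta/50}.$$ Moreover, this strategy can be applied using $O(n\log^dn)$ memory and $O(n\log^dn)$ computations to produce the first $n$ samples $Z_1,\dots,Z_n$ (with $d$ fixed).
   Context: Throughout, $\log$ is the logarithm to base $2$, $\log^a(n)=(\log n)^a$, $|A|$ is the Lebesgue measure of $A$, $\mathbb N=\{1,2,\dots\}$, and $\mathrm{sgn}(0)=0$. Discrepancy. For a sequence $Z=(Z_i)$ in $[0,1)^d$ write $Z^n=(Z_1,\dots,Z_n)$ and $$\mathrm{Dis}(Z^n)=\sup_{R}\Big|\#\{i\le n: Z_i\in R\}-n|R|\Big|,$$ the supremum being over all axis-parallel rectangles $R=\prod_{i=1}^d[a_i,b_i)$ with $0\le a_i<b_i\le 1$. Haar functions. A dyadic interval is $I=[a2^{-\ell},(a+1)2^{-\ell})$ with $a,\ell\in\mathbb Z$; its order is $\mathcal O(I)=\ell$, and $I_{\mathrm{even}}$, $I_{\mathrm{odd}}$ denote its left and right halves (dyadic intervals of order $\ell+1$). Each dyadic interval $I$ with $I_{\mathrm{even}}\subset[0,1)$ gives a Haar function $H_I:[0,1)\to\{-1,0,1\}$ equal to $1$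 on $I_{\mathrm{even}}$, $-1$ on $I_{\mathrm{odd}}\cap[0,1)$ and $0$ elsewhere, of order $\mathcal O(H_I)=\mathcal O(I)+1$ (so $I=[0,2)$ gives the constant function $1$, of order $0$). For a product $R=I_1\times\dots\times I_d$ of such intervals put $H_R(x)=\prod_{i=1}^dH_{I_i}(x_i)$, with order $\mathcal O(H_R)=\sum_{i=1}^d\mathcal O(H_{I_i})$. Let $\mathcal H_{h_0}^{h_1}$ be the set of Haar functions $H_R$ on $[0,1)^d$ with $h_0\le\mathcal O(H_R)\le h_1$. For a finite counting measure $\nu$, $\langle\nu,H\rangle=\int H\,d\nu$. Conditional density. Let $h(n)=\lfloor\log n\rfloor$ and $W(s)=\sum_{i=1}^s\binom{i+d-1}{d-1}$. For a counting measure $\nu$ and $n\in\mathbb N$ put $$\lambda_n(\nu)(x)=1+\frac{\beta}{2W(h(n))}\sum_{H\in\mathcal H_1^{h(n)}}\mathrm{sgn}\big(\langle\nu,-H\rangle\big)H(x),$$ with $\lambda_1\equiv1$ (empty sum). Thinning. A two-thinning strategy is a sequence of measurable functions $f_n:([0,1)^d)^{n-1}\times[0,1)^d\to[0,1]$; it is a $(1+\beta)$-thinning strategy if for all $z_1,\dots,z_{n-1}$ one has $f_n((z_1,\dots,z_{n-1}),x)\ge1-\beta$ for almost every $x$. Let $(X_m)_{m\ge1}$ be i.i.d. uniform on $[0,1)^d$ and $(U_n)_{n\ge1}$ i.i.d. uniform on $[0,1]$, independent of $(X_m)$. The strategy produces $Z$ inductively: $$\chi_n=\mathbf 1\Big\{U_n>f_n\big((Z_1,\dots,Z_{n-1}),X_{n+\sum_{i=1}^{n-1}\chi_i}\big)\Big\},\qquad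 Z_n=X_{n+\sum_{i=1}^n\chi_i}.$$ The Haar $(1+\beta)$-thinning strategy is the one given by $f_n((z_1,\dots,z_{n-1}),x)=\lambda_n\big(\sum_{i=1}^{n-1}\delta_{z_i}\big)(x)-\frac{\beta}{2}$. Equivalently, the law of $Z_n$ given $Z_1,\dots,Z_{n-1}$ has density $\lambda_n(\nu_{n-1})$, where $\nu_{n-1}=\sum_{i=1}^{n-1}\delta_{Z_i}$. Complexity model. The overseer sees the points $X_m$ one by one and must make the decisions $\chi_n$ online. Costs are counted at unit cost: each memory cell holds one number, and each elementary arithmetic operation, comparison, or memory reference costs one unit; the growth of storage, reference and arithmetic costs for large numbers is ignored. *)

(* Defs.v *)
From mathcomp Require Import all_boot all_order all_algebra.
From mathcomp Require Import all_classical all_reals all_analysis.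

Set Implicit Arguments.
Unset Strict Implicit.
Unset Printing Implicit Defensive.

Import Order.TTheory GRing.Theory Num.Theory.
Import numFieldNormedType.Exports.

Local Open Scope classical_set_scope.
Local Open Scope ring_scope.

(** Conventions.  Points of the space are [d.-tuple R], with the product
    sigma-algebra.  Every sequence that is indexed by 1, 2, 3, ... in the
    mathematics is indexed here by 0, 1, 2, ...: [x m] is the point X_(m+1),
    [u n] is U_(n+1), and so on.  A finite counting measure is given by the
    sequence of its atoms, repeated according to multiplicity. *)

Section Haar.
Context {R : realType}.

Definition log2 (x : R) : R := ln x / ln 2.

Definition in_cube d (x : d.-tuple R) : Prop :=
  forall i, 0 <= tnth x i < 1.

(** [(a, l)] stands for [a 2^-l, (a + 1) 2^-l), of order [l]. *)
Definition dyadic_interval (J : int * int) : set R :=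
  `[J.1%:~R * 2 ^ (- J.2), (J.1 + 1)%:~R * 2 ^ (- J.2)[.

Definition even_half (J : int * int) : int * int := (J.1 * 2, J.2 + 1).

Definition odd_half (J : int * int) : int * int := (J.1 * 2 + 1, J.2 + 1).

Definition haar1 (J : int * int) (x : R) : R :=
  \1_(dyadic_interval (even_half J)) x
  - \1_(dyadic_interval (odd_half J) `&` `[0, 1[) x.

Definition haar d (K : d.-tuple (int * int)) (x : d.-tuple R) : R :=
  \prod_(i < d) haar1 (tnth K i) (tnth x i).

Definition haar_order d (K : d.-tuple (int * int)) : int :=
  \sum_(i < d) ((tnth K i).2 + 1).

(** The Haar functions of order between [h0] and [h1].  On the products of
    admissible intervals the map [K |-> haar K] is injective, so that a sum over
    Haar functions is a sum over these [K]. *)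
Definition haar_set d (h0 h1 : int) : set (d.-tuple (int * int)) :=
  [set K | (forall i, dyadic_interval (even_half (tnth K i)) `<=` `[0, 1[)
           /\ h0 <= haar_order K <= h1].

Definition pairing d (nu : seq (d.-tuple R)) (H : d.-tuple R -> R) : R :=
  \sum_(z <- nu) H z.

Definition haar_weight (d s : nat) : nat :=
  \sum_(1 <= i < s.+1) 'C(i + d.-1, d.-1).

Definition haar_density d (beta : R) (n : nat) (nu : seq (d.-tuple R))
    (x : d.-tuple R) : R :=
  let h := trunc_log 2 n in
  1 + beta / (2 * (haar_weight d h)%:R)
      * \sum_(K \in haar_set 1 h%:Z)
          Num.sg (pairing nu (fun y => - haar K y)) * haar K x.

(** Largest discrepancy over the axis-parallel boxes [prod_i [a_i, b_i)], whose
    Lebesgue measure is the product of the lengths of the sides.  The set of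
    values is bounded by [size zs]. *)
Definition discrepancy d (zs : seq (d.-tuple R)) : R :=
  sup [set r | exists a b : d.-tuple R,
    (forall i, [/\ 0 <= tnth a i, tnth a i < tnth b i & tnth b i <= 1]) /\
    r = `| (count (fun z => [forall i, tnth a i <= tnth z i < tnth b i]) zs)%:R
           - (size zs)%:R * \prod_(i < d) (tnth b i - tnth a i) | ].

End Haar.

Arguments haar_set R {d} h0 h1 : rename.

Section Thinning.
Context {R : realType} {d : nat}.

(** [f zs x] is f_n((z_1, ..., z_(n-1)), x), where [n = (size zs).+1]. *)
Definition strategy := seq (d.-tuple R) -> d.-tuple R -> R.

Definition haar_strategy (beta : R) : strategy :=
  fun zs x => haar_density beta (size zs).+1 zs x - beta / 2.

(** The points Z_1, ..., Z_n selected by the decisions chi_1, ..., chi_n: Z_i is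
    X_(i + chi_1 + ... + chi_i). *)
Definition selected (x : nat -> d.-tuple R) (chi : seq bool) :
    seq (d.-tuple R) :=
  [seq x (i + count id (take i.+1 chi))%N | i <- iota 0 (size chi)].

Fixpoint decisions (f : strategy) (x : nat -> d.-tuple R) (u : nat -> R)
    (n : nat) : seq bool :=
  if n is m.+1 then
    let chi := decisions f x u m in
    rcons chi (f (selected x chi) (x (m + count id chi)%N) < u m)
  else [::].

Definition samples (f : strategy) (x : nat -> d.-tuple R) (u : nat -> R)
    (n : nat) : seq (d.-tuple R) :=
  selected x (decisions f x u n).

End Thinning.

Section Randomness.
Context {disp : measure_display} {T : measurableType disp} {R : realType}.
Variable P : probability T R.

Definition mutually_independent (I : eqType) (F : I -> set (set T)) : Prop :=
  forall (s : seq I) (E : I -> set T), uniq s ->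
    (forall j, j \in s -> F j (E j)) ->
    P (\bigcap_(j in [set` s]) E j) = (\prod_(j <- s) P (E j))%E.

(** The events of the sigma-algebra generated by a random variable. *)
Definition events_of disp' (T' : measurableType disp') (X : T -> T') :
    set (set T) :=
  preimage_set_system setT X measurable.

(** The law of [X] is the [d]-fold product of the uniform law on [0, 1]. *)
Definition uniform_on_cube d (X : {RV P >-> d.-tuple R}) : Prop :=
  forall A : 'I_d -> set R, (forall i, measurable (A i)) ->
    distribution P X [set x | forall i, A i (tnth x i)]
    = (\prod_(i < d) uniform_prob (@ltr01 R) (A i))%E.

Definition thinning_randomness d (X : nat -> {RV P >-> d.-tuple R})
    (U : nat -> {RV P >-> R}) : Prop :=
  [/\ forall m w, in_cube (X m w),
      forall m, uniform_on_cube (X m),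
      forall n (A : set R), measurable A ->
        distribution P (U n) A = uniform_prob (@ltr01 R) A &
      mutually_independent (fun j : nat + nat =>
        match j with
        | inl m => events_of (X m)
        | inr n => events_of (U n)
        end)].

End Randomness.

(** A unit-cost random access machine.  Every memory cell holds a real number,
    the programs are finite pieces of code with natural constants, and the
    address of a memory reference is computed by an expression, the value of
    which must be a natural number: otherwise the execution is stuck.  There is
    no rounding instruction. *)
Inductive arith_op := Add | Sub | Mul | Div.

Inductive expr :=
  | Const of nat
  | Cell of expr
  | Op of arith_op & expr & expr.

Inductive cmd :=
  | Skip
  | Store of expr & expr
  | Seq of cmd & cmd
  | IfLt of expr & expr & cmd & cmd
  | WhileLt of expr & expr & cmd.

(** Constants are charged as well. *)
Fixpoint expr_cost (e : expr) : nat :=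
  match e with
  | Const _ => 1
  | Cell a => (expr_cost a).+1
  | Op _ e1 e2 => (expr_cost e1 + expr_cost e2).+1
  end.

(** An online overseer in dimension [d].  At each round, the current point and
    the current U_n are put into the input cells, [decide] is run, and the
    decision chi_n is 1 if and only if the decision cell is then nonzero.  Next,
    Z_n (the same point if chi_n = 0, and the following one if chi_n = 1) is put
    into the input cells and [update] is run.  The code does not depend on
    [beta], which is in a memory cell at the start. *)
Record overseer := Overseer { decide : cmd; update : cmd }.

Definition beta_cell : nat := 0.
Definition u_cell : nat := 1.
Definition decision_cell : nat := 2.
Definition point_cell : nat := 3.

Section Machine.
Context {R : realType}.

Definition memory := nat -> R.

Definition set_cell (m : memory) (k : nat) (v : R) : memory :=
  fun j => if j == k then v else m j.

Definition set_point d (m : memory) (x : d.-tuple R) : memory :=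
  fun j => if (point_cell <= j < point_cell + d)%N
           then nth 0 x (j - point_cell) else m j.

Definition apply_op (o : arith_op) (v w : R) : R :=
  match o with
  | Add => v + w
  | Sub => v - w
  | Mul => v * w
  | Div => v / w
  end.

(** [eval_expr m e v s]: in the memory [m], the expression [e] has the value
    [v], and all the addresses that are referenced are less than [s]. *)
Inductive eval_expr (m : memory) : expr -> R -> nat -> Prop :=
  | eval_const k : eval_expr m (Const k) k%:R 0
  | eval_cell e k s :
      eval_expr m e k%:R s -> eval_expr m (Cell e) (m k) (maxn s k.+1)
  | eval_op o e1 e2 v1 v2 s1 s2 :
      eval_expr m e1 v1 s1 -> eval_expr m e2 v2 s2 ->
      eval_expr m (Op o e1 e2) (apply_op o v1 v2) (maxn s1 s2).

(** [exec c m m' t s]: from the memory [m], the command [c] terminates with the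
    memory [m'], after [t] unit operations, all the addresses that are
    referenced being less than [s]. *)
Inductive exec : cmd -> memory -> memory -> nat -> nat -> Prop :=
  | exec_skip m : exec Skip m m 0 0
  | exec_store a e m k v sa se :
      eval_expr m a k%:R sa -> eval_expr m e v se ->
      exec (Store a e) m (set_cell m k v) (expr_cost a + expr_cost e).+1
        (maxn (maxn sa se) k.+1)
  | exec_seq c1 c2 m m1 m2 t1 t2 s1 s2 :
      exec c1 m m1 t1 s1 -> exec c2 m1 m2 t2 s2 ->
      exec (Seq c1 c2) m m2 (t1 + t2) (maxn s1 s2)
  | exec_if e1 e2 c1 c2 m m' v1 v2 s1 s2 t s :
      eval_expr m e1 v1 s1 -> eval_expr m e2 v2 s2 ->
      exec (if v1 < v2 then c1 else c2) m m' t s ->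
      exec (IfLt e1 e2 c1 c2) m m' (expr_cost e1 + expr_cost e2 + t).+1
        (maxn (maxn s1 s2) s)
  | exec_while_stop e1 e2 c m v1 v2 s1 s2 :
      eval_expr m e1 v1 s1 -> eval_expr m e2 v2 s2 -> (v1 < v2) = false ->
      exec (WhileLt e1 e2 c) m m (expr_cost e1 + expr_cost e2).+1 (maxn s1 s2)
  | exec_while_loop e1 e2 c m m1 m2 v1 v2 s1 s2 t s t' s' :
      eval_expr m e1 v1 s1 -> eval_expr m e2 v2 s2 -> v1 < v2 ->
      exec c m m1 t s -> exec (WhileLt e1 e2 c) m1 m2 t' s' ->
      exec (WhileLt e1 e2 c) m m2 (expr_cost e1 + expr_cost e2 + t + t').+1
        (maxn (maxn s1 s2) (maxn s s')).

Definition initial_memory (beta : R) : memory :=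
  fun j => if j == beta_cell then beta else 0.

(** [oversee p beta x u n chi m t s]: after [n] rounds of [p] on the points [x]
    and the numbers [u], the decisions are [chi], the memory is [m], the number
    of unit operations is [t], and only cells of address less than [s] have been
    used.  A unit is charged for each input number and each decision. *)
Inductive oversee d (p : overseer) (beta : R) (x : nat -> d.-tuple R)
    (u : nat -> R) : nat -> seq bool -> memory -> nat -> nat -> Prop :=
  | oversee_start :
      oversee p beta x u 0 [::] (initial_memory beta) 0 (point_cell + d)
  | oversee_round n chi m m1 m2 t t1 t2 s s1 s2 :
      oversee p beta x u n chi m t s ->
      exec (decide p) (set_cell (set_point m (x (n + count id chi)%N))
                                u_cell (u n)) m1 t1 s1 ->
      let c := m1 decision_cell != 0 in
      exec (update p) (set_point m1 (x (n + count id chi + c)%N)) m2 t2 s2 ->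
      oversee p beta x u n.+1 (rcons chi c) m2 (t + t1 + t2 + 2 * d.+1)
        (maxn s (maxn s1 s2)).

End Machine.

(* Main.v *)
(* Let Y be the sum over the samples of a Haar function H of positive order.  By
   orthogonality of the Haar functions, the density pushes Y towards 0 at speed
   (beta / 2W) |supp H| once the order of H is at most h(n), and the increments
   of Y are -1, 0 or 1.  With theta = beta / 4W the moment of
   e^(theta Y) + e^(-theta Y) therefore stays at most 4: it contracts once H is
   active, and before that (fewer than 2^o steps, with o the order of H) it
   grows by a factor 1 + O(theta^2 |supp H|) at a time, where
   |supp H| <= 2^(d - o).  A union bound over the Haar functions controls all
   the pairings at once.  They control the discrepancy: the indicator of a half
   of a dyadic interval is half the sum of the indicator of the interval and of
   plus or minus its Haar function, so a dyadic box of order at most h is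
   estimated as well as the Haar functions, and a rectangle is a combination of
   at most 2^(d+1) C(h+d, d) such boxes and of leftovers which are contained in
   boxes of order h.

   The overseer stores, for each vector of orders and each position, the sum of
   the Haar functions of this support.  A point meets at most (h+1)^d of them,
   and the table is computed again when n reaches a power of 2. *)

Require Import Defs.
From mathcomp Require Import all_boot all_order all_algebra.
From mathcomp Require Import all_classical all_reals all_analysis.
From mathcomp Require Import ring lra zify.

Set Implicit Arguments.
Unset Strict Implicit.
Unset Printing Implicit Defensive.

Import Order.TTheory GRing.Theory Num.Theory.
Import numFieldNormedType.Exports.

Local Open Scope classical_set_scope.
Local Open Scope ring_scope.

(** * Haar functions and dyadic cells *)

Section HaarBasics.
Context {R : realType}.
Implicit Types (x : R) (a s : nat).

(** No conditional expectation is taken on the cube. With [h = trunc_log 2 n], every Haar function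
    involved is constant on the cells of side 2^-h, so the cells of the samples form a finite
    process. Its law is a sum of probabilities of histories (decisions and cells), which
    independence computes exactly, and orthogonality is a statement about sums over a grid of 2^(hd)
    corners. The bound 4 on the moment is the fixed point of the contraction, and 2^d <= W^2 keeps
    the earlier growth, which starts from 2, below it. This and W >= 2 hold as soon as 2d <= h; for
    h < 2d the threshold of the tail bound exceeds n and the event is empty. The machine cannot
    round, so dyadic positions are found digit by digit, by doubling a fraction and comparing it
    with 1. A table for a new h needs cells containing 0; they are found by moving an offset
    upwards, which costs only a constant factor since the tables grow geometrically. *)

Definition dfloor s x : nat := Num.truncn (2 ^+ s * x).

Lemma dfloor_eq s x a : 0 <= x ->
  (dfloor s x == a) = (a%:R <= 2 ^+ s * x < a.+1%:R).
Proof.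
move=> x0; have y0 : 0 <= 2 ^+ s * x by rewrite mulr_ge0 // exprn_ge0.
by rewrite eqn_leq andbC truncn_ge_nat // -[X in _ && X]ltnS truncn_lt_nat.
Qed.

Lemma dfloor_itv s x : 0 <= x ->
  (dfloor s x)%:R <= 2 ^+ s * x < (dfloor s x).+1%:R.
Proof. by move=> x0; rewrite -dfloor_eq. Qed.

Lemma dfloorS s x : 0 <= x -> (dfloor s.+1 x)./2 = dfloor s x.
Proof.
move=> x0; apply/eqP; rewrite eq_sym dfloor_eq //.
have /andP[] := dfloor_itv s.+1 x0; rewrite exprS.
set t := dfloor _ _; rewrite -{1 2}(odd_double_half t).
rewrite -muln2 -addSn !natrD !natrM; case: (odd t) => /= h1 h2; apply/andP; split; lra.
Qed.

Lemma dfloor_lt s x : 0 <= x < 1 -> (dfloor s x < 2 ^ s)%N.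
Proof.
move=> /andP[x0 x1]; rewrite /dfloor truncn_lt_nat ?mulr_ge0 ?exprn_ge0 //.
by rewrite natrX gtr_pMr // exprn_gt0.
Qed.

Lemma dfloor0 x : 0 <= x < 1 -> dfloor 0 x = 0%N.
Proof. by move=> /(dfloor_lt 0); case: dfloor. Qed.

Lemma dyadic_intervalE a s x :
  dyadic_interval (a%:Z, s%:Z) x = (a%:R <= 2 ^+ s * x < a.+1%:R) :> Prop.
Proof.
rewrite /dyadic_interval /= in_itv /=; congr (is_true _).
have p : 0 < 2 ^+ s :> R by rewrite exprn_gt0.
rewrite -exprnN.
rewrite ler_pdivrMr // ltr_pdivlMr // [x * _]mulrC.
by rewrite -[a.+1%:R]natr1 intrD.
Qed.

(** Indexed by the order [s] of the Haar function, one more than the order of the interval: [s = 0]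
    and [a = 0] give [0, 2), whose Haar function is the constant 1 on [0, 1). *)
Definition haar_itv a s : int * int := (a%:Z, s%:Z - 1).

(** The two halves have order [s] and indices [2a] and [2a + 1]: halving [dfloor s x] finds the
    interval, and its parity finds the half. *)
Lemma haar1E a s x : 0 <= x < 1 ->
  haar1 (haar_itv a s) x = (a == (dfloor s x)./2)%:R * (-1) ^+ odd (dfloor s x).
Proof.
move=> /andP[x0 x1]; rewrite /haar1 /even_half /odd_half /haar_itv /= !indicE.
rewrite subrK.
have -> : (a%:Z * 2 = (a * 2)%N%:Z)%R by [].
have -> : ((a * 2)%N%:Z + 1 = (a * 2).+1%:Z)%R by rewrite intS addrC.
have hx : x \in [set` `[0 : R, 1[] by apply/mem_set; rewrite /= in_itv /= x0.
rewrite in_setI hx andbT.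
have E b : (x \in dyadic_interval (b%:Z, s%:Z)) = (dfloor s x == b).
  by rewrite dfloor_eq //; apply/idP/idP; rewrite inE dyadic_intervalE.
rewrite !E; set t := dfloor s x.
rewrite -{1 2}(odd_double_half t) -muln2.
case: (odd t) => /=; rewrite ?add0n ?add1n.
- rewrite (_ : (_ == (a * 2)%N) = false); last by apply/negP => /eqP; lia.
  by rewrite eqSS eqn_pmul2r // eq_sym expr1 sub0r mulrN1.
- rewrite (_ : (_ == (a * 2).+1) = false); last by apply/negP => /eqP; lia.
  by rewrite eqn_pmul2r // eq_sym subr0 mulr1.
Qed.

Lemma admissibleP (J : int * int) :
  (@dyadic_interval R (even_half J) `<=` `[0, 1[) <->
  exists a s, (a.*2 < 2 ^ s)%N /\ J = haar_itv a s.
Proof.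
split; last first.
  move=> [a [s [h ->]]] x; rewrite /haar_itv /even_half /= subrK.
  rewrite dyadic_intervalE /= in_itv /= => /andP[h1 h2].
  have p : 0 < 2 ^+ s :> R by rewrite exprn_gt0.
  apply/andP; split.
    by rewrite -(pmulr_rge0 _ p); apply: le_trans h1.
  rewrite -(ltr_pM2l p) mulr1; apply: (lt_le_trans h2).
  by rewrite -natrX ler_nat -muln2 in h *.
case: J => a l; rewrite /even_half /= => h.
have p z : 0 < (2 : R) ^ z by rewrite exprz_gt0.
(* The point at the fraction [1 - e] of the even half: [e = 1] is the left end, which bounds the
   position on both sides, and [e = 1/2] the midpoint, which excludes halves of length at least
   2. *)
have lt e : 0 < e <= 1 -> 0 <= ((a * 2)%:~R + (1 - e)) * (2 : R) ^ (- (l + 1)) < 1.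
  move=> /andP[e0 e1].
  have := h (((a * 2)%:~R + (1 - e)) * (2 : R) ^ (- (l + 1))).
  rewrite /dyadic_interval /= !in_itv /=; apply.
  by rewrite ler_pM2r // ltr_pM2r // intrD; apply/andP; split; lra.
have a0 : 0 <= a.
  have /lt/andP[] : 0 < (1 : R) <= 1 by rewrite ltr01 lexx.
  rewrite subrr addr0 pmulr_lge0 // => + _.
  by rewrite ler0z; lia.
have p2 z : (2 : R) ^ z = 2 ^ (z - 1) * 2.
  by rewrite -[in LHS](subrK 1 z) expfzDr ?pnatr_eq0 // expr1z.
have l0 : 0 <= l + 1.
  rewrite leNgt; apply/negP => l0.
  have /lt/andP[_] : 0 < (2^-1 : R) <= 1 by apply/andP; split; lra.
  have : 2 <= (2 : R) ^ (- (l + 1)).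
    rewrite -[X in X <= _](expr1z 2) ler_eXz2l ?ltr1n //; lia.
  have : 0 <= (a * 2)%:~R :> R by rewrite ler0z; lia.
  nra.
case: a a0 h lt => // n _ _ lt.
have [s hs] : exists s : nat, l + 1 = s%:Z by exists (absz (l + 1)); rewrite gez0_abs.
exists n, s; split; last by rewrite /haar_itv -hs addrK.
rewrite ltnNge; apply/negP => le2.
have := lt 1; rewrite hs subrr addr0 ltr01 lexx => /(_ isT)/andP[_].
rewrite -exprnN ltr_pdivrMr ?exprn_gt0 // mul1r -natrX.
rewrite (_ : (n%:Z * 2)%:~R = (n.*2)%:R) ?ltr_nat; last by rewrite -muln2.
by rewrite ltnNge le2.
Qed.

Lemma haar_orderE d (a s : 'I_d -> nat) :
  haar_order [tuple haar_itv (a i) (s i) | i < d] = (\sum_(i < d) s i)%N%:Z.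
Proof.
rewrite /haar_order (big_morph Posz PoszD (erefl _)).
by apply: eq_bigr => i _; rewrite tnth_mktuple /= subrK.
Qed.

Fixpoint orders (d b : nat) : seq (seq nat) :=
  if d is d'.+1 then [seq s :: v | s <- iota 0 b.+1, v <- orders d' (b - s)%N]
  else [:: [::]].

Lemma mem_orders d b v : (v \in orders d b) = (size v == d) && (sumn v <= b)%N.
Proof.
elim: d b v => [|d IH] b v; first by case: v => [|? ?].
rewrite /orders -/orders; case: v => [|s v].
  by apply/negP => /allpairsPdep[? [? []]].
apply/allpairsPdep/idP => [[s' [v' [hs hv [-> ->]]]]|/andP[hd hb]].
  by move: hs hv; rewrite mem_iota IH eqSS => hs /andP[-> hv] /=; lia.
have hb' : (s + sumn v <= b)%N by [].
exists s, v; split=> //; first by rewrite mem_iota; lia.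
by rewrite IH; apply/andP; split; [|lia].
Qed.

Lemma orders_uniq d b : uniq (orders d b).
Proof.
elim: d b => [|d IH] b //; rewrite /orders -/orders.
apply: (allpairs_uniq_dep (f := fun (s : nat) (v : seq nat) => s :: v)) => //.
  exact: iota_uniq.
by move=> [s v] [s' v'] _ _ /= [-> ->].
Qed.

Lemma size_orders d b : size (orders d b) = 'C(b + d, d)%N.
Proof.
elim: d b => [|d IH] b; first by rewrite bin0.
rewrite /orders -/orders size_allpairs_dep.
under eq_map do rewrite IH.
elim: b => [|b IHb]; first by rewrite /= subn0 addn0 !add0n !binn.
rewrite (_ : iota 0 b.+2 = 0%N :: map S (iota 0 b.+1)); last first.
  by rewrite -(iotaDl 1 0).
rewrite map_cons -map_comp (_ : sumn (_ :: _) = ('C(b.+1 - 0 + d, d) +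
   sumn [seq 'C(b - s + d, d) | s <- iota 0 b.+1])%N) //.
by rewrite IHb subn0 !addSn addnS binS addnC.
Qed.

(** Hockey-stick summation. By [size_orders], W(h) thus counts the order vectors of total between 1
    and h, that is, the Haar functions that do not vanish at a given point. *)
Lemma haar_weightE d h : (0 < d)%N -> haar_weight d h = ('C(h + d, d) - 1)%N.
Proof.
case: d => // d _; elim: h => [|h IH].
  by rewrite /haar_weight big_geq // add0n binn.
rewrite /haar_weight big_nat_recr //= -/(haar_weight d.+1 h) IH !addSn !addnS [in RHS]binS.
have : (0 < 'C((h + d).+1, d.+1))%N by rewrite bin_gt0; lia.
by lia.
Qed.

Lemma size_orders_pos d h : (0 < d)%N ->
  size [seq v <- orders d h | 0 < sumn v]%N = haar_weight d h.
Proof.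
move=> d0; rewrite haar_weightE // -size_orders size_filter.
rewrite -(count_predC (fun v => 0 < sumn v)%N (orders d h)).
suff -> : count (predC (fun v => 0 < sumn v)%N) (orders d h) = 1%N by rewrite addnK.
rewrite -[RHS](_ : count_mem (nseq d 0%N) (orders d h) = 1%N).
  apply: eq_in_count => v; rewrite mem_orders => /andP[/eqP <- _] /=.
  rewrite -eqn0Ngt; elim: v => //= s v IH.
  by rewrite addn_eq0 eqseq_cons IH.
rewrite count_uniq_mem ?orders_uniq // mem_orders size_nseq eqxx.
by rewrite sumn_nseq mul0n.
Qed.

Lemma haar_setP d h (K : d.-tuple (int * int)) : haar_set R 1 h%:Z K <->
  exists a s : 'I_d -> nat, [/\ forall i, ((a i).*2 < 2 ^ s i)%N,
    K = [tuple haar_itv (a i) (s i) | i < d] & (0 < \sum_(i < d) s i <= h)%N].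
Proof.
rewrite /haar_set /=; split=> [[adm ord]|[a [s [h1 -> h2]]]]; last first.
  split=> [i|]; last by rewrite haar_orderE; move: (\sum_(i < d) _)%N h2 => m; lia.
  by apply/admissibleP; exists (a i), (s i); rewrite tnth_mktuple.
have /boolp.choice[f hf] : forall i, exists p : nat * nat,
    (p.1.*2 < 2 ^ p.2)%N /\ tnth K i = haar_itv p.1 p.2.
  by move=> i; have /admissibleP[a [s [? ?]]] := adm i; exists (a, s).
have KE : K = [tuple haar_itv (f i).1 (f i).2 | i < d].
  by apply: eq_from_tnth => i; rewrite tnth_mktuple; case: (hf i).
exists (fun i => (f i).1), (fun i => (f i).2); split=> //.
  by move=> i; case: (hf i).
by move: ord; rewrite KE haar_orderE; move: (\sum_(i < d) _)%N => m; lia.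
Qed.

(** Each coordinate picks a position below 2^h and an order at most h. The count is crude, but it
    enters the tail bound only through its logarithm. *)
Lemma haar_set_seq d h : exists r : seq (d.-tuple (int * int)),
  [/\ uniq r, haar_set R 1 h%:Z = [set` r] &
      (size r <= (2 ^ h * h.+1) ^ d)%N].
Proof.
pose T := {ffun 'I_d -> 'I_(2 ^ h) * 'I_h.+1}.
pose r0 := [seq [tuple haar_itv (f i).1 (f i).2 | i < d] | f : T].
exists (undup [seq K <- r0 | `[< haar_set R 1 h%:Z K >]]); split.
- exact: undup_uniq.
- apply/seteqP; split => K; last first.
    by rewrite /= mem_undup mem_filter => /andP[/asboolP].
  move=> hK; rewrite /= mem_undup mem_filter; apply/andP; split; first exact/asboolP.
  have /haar_setP[a [s [h1 -> /andP[_ h2]]]] := hK.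
  have sh i : (s i <= h)%N.
    by apply: leq_trans h2; rewrite (bigD1 i) //= leq_addr.
  have ah i : (a i < 2 ^ h)%N.
    apply: (@leq_ltn_trans (a i).*2); first by rewrite -addnn leq_addr.
    by apply: leq_trans (h1 i) _; rewrite leq_pexp2l.
  apply/mapP; exists [ffun i => (Ordinal (ah i), Ordinal (sh i : (s i < h.+1)%N))].
    by rewrite mem_enum.
  by apply: eq_mktuple => i; rewrite ffunE.
- apply: leq_trans (size_undup _) _; rewrite size_filter.
  apply: leq_trans (count_size _ _) _.
  by rewrite size_map -cardE card_ffun card_prod !card_ord.
Qed.

Definition haar_at d (v : seq nat) (x : d.-tuple R) : d.-tuple (int * int) :=
  [tuple haar_itv (dfloor (nth 0%N v i) (tnth x i))./2 (nth 0%N v i) | i < d].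

Definition haar_sgn d (v : seq nat) (x : d.-tuple R) : R :=
  \prod_(i < d) (-1) ^+ odd (dfloor (nth 0%N v i) (tnth x i)).

Lemma haarE d (a s : 'I_d -> nat) (x : d.-tuple R) : in_cube x ->
  haar [tuple haar_itv (a i) (s i) | i < d] x =
  [forall i, a i == (dfloor (s i) (tnth x i))./2]%:R
  * \prod_(i < d) (-1) ^+ odd (dfloor (s i) (tnth x i)).
Proof.
move=> hx; rewrite /haar; under eq_bigr do rewrite tnth_mktuple haar1E //.
rewrite big_split /=; congr (_ * _).
case: (boolP [forall i, a i == _]) => [/forallP h|].
  by rewrite big1 // => i _; rewrite h.
by rewrite negb_forall => /existsP[i /negbTE hi]; rewrite (bigD1 i) //= hi mul0r.
Qed.

Lemma haar_at_sgn d v (x z : d.-tuple R) : in_cube z ->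
  haar (haar_at v x) z = (haar_at v x == haar_at v z)%:R * haar_sgn v z.
Proof.
move=> hz; rewrite /haar_at haarE //; congr ((nat_of_bool _)%:R * _).
apply/idP/eqP => [/forallP h|h].
  by apply: eq_mktuple => i; rewrite (eqP (h i)).
apply/forallP => i; have := congr1 (fun t => tnth t i) h.
by rewrite !tnth_mktuple => -[/eqP].
Qed.

Lemma sum_nth_sumn d (v : seq nat) : size v = d ->
  (\sum_(i < d) nth 0%N v i)%N = sumn v.
Proof. by move=> <-; rewrite sumnE (big_nth 0%N) big_mkord. Qed.

Lemma haar_at_set d h v (x : d.-tuple R) : in_cube x -> size v = d ->
  (0 < sumn v <= h)%N -> haar_set R 1 h%:Z (haar_at v x).
Proof.
move=> hx sv hv; apply/haar_setP.
exists (fun i : 'I_d => (dfloor (nth 0%N v i) (tnth x i))./2), (fun i : 'I_d => nth 0%N v i); split=> //.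
  move=> i; apply: leq_ltn_trans (dfloor_lt (nth 0%N v i) (hx i)).
  by rewrite -[X in (_ <= X)%N]odd_double_half leq_addl.
by rewrite sum_nth_sumn.
Qed.

(* At a point [x] of the cube, exactly one Haar function of each vector of
   orders does not vanish. *)
Lemma haar_sum d h (x : d.-tuple R) (G : d.-tuple (int * int) -> R) :
  in_cube x ->
  \sum_(K \in haar_set R 1 h%:Z) G K * haar K x =
  \sum_(v <- orders d h | (0 < sumn v)%N) G (haar_at v x) * haar_sgn v x.
Proof.
move=> hx; pose vs := [seq v <- orders d h | (0 < sumn v)%N].
have hvs v : v \in vs -> size v = d /\ (0 < sumn v <= h)%N.
  by rewrite mem_filter mem_orders => /andP[-> /andP[/eqP -> ->]].
have inj : {in vs &, injective (fun v => haar_at v x)}.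
  move=> v w /hvs[sv _] /hvs[sw _] e.
  apply: (@eq_from_nth _ 0%N); first by rewrite sv sw.
  move=> i; rewrite sv => hi; have := congr1 (fun t => tnth t (Ordinal hi)) e.
  by rewrite !tnth_mktuple /haar_itv => -[_] /=; lia.
rewrite (fsbigE [seq haar_at v x | v <- vs]).
- rewrite big_map /vs big_filter_cond big_seq_cond [RHS]big_seq_cond.
  apply: eq_big => v; last by rewrite haar_at_sgn // eqxx mul1r.
  rewrite mem_orders; case: eqP => //= sv; case: (boolP (sumn v <= h)%N) => //= hb.
  rewrite andb_idr // => h0; apply/mem_set/haar_at_set => //.
  by rewrite h0.
- by rewrite map_inj_in_uniq // filter_uniq // orders_uniq.
- by move=> K /= /mapP[v /hvs[sv hv] ->]; apply: haar_at_set.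
- move=> K hK hnK; have /haar_setP[a [s [h1 KE h2]]] := hK.
  rewrite KE haarE //; case: (boolP [forall i, a i == _]) => [/forallP hf|]; last by rewrite mul0r mulr0.
  case/negP: hnK; pose v := [seq s i | i : 'I_d].
  have nv (i : 'I_d) : nth 0%N v i = s i.
    by rewrite (nth_map i) ?size_enum_ord // nth_ord_enum.
  have sv : size v = d by rewrite size_map size_enum_ord.
  apply/mapP; exists v.
    rewrite mem_filter mem_orders sv eqxx -(sum_nth_sumn sv).
    by under eq_bigr do rewrite nv; rewrite andTb.
  by rewrite KE; apply: eq_mktuple => i; rewrite nv (eqP (hf i)).
Qed.

End HaarBasics.

(** * Discrepancy and Haar pairings *)

Section Discrepancy.
Context {R : realType} {d : nat}.
Implicit Types (e : 'I_d -> (R -> R) * R).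

(* A product function [prod_i (e i).1 (x_i)] is recorded together with the
   integrals [(e i).2] of its factors. *)
Definition prod_disc (zs : seq (d.-tuple R)) e : R :=
  \sum_(z <- zs) \prod_(i < d) (e i).1 (tnth z i)
  - (size zs)%:R * \prod_(i < d) (e i).2.

Definition upd T (e : 'I_d -> T) (i : 'I_d) (p : T) : 'I_d -> T :=
  fun j => if j == i then p else e j.

Lemma upd_id T (e : 'I_d -> T) i : upd e i (e i) = e.
Proof. by apply: boolp.funext => j; rewrite /upd; case: eqP => // ->. Qed.

Lemma comp_upd T U (f : T -> U) (e : 'I_d -> T) i p :
  f \o upd e i p = upd (f \o e) i (f p).
Proof. by apply: boolp.funext => j; rewrite /upd /=; case: eqP. Qed.

Lemma prod_upd (F : (R -> R) * R -> 'I_d -> R) e i (p : (R -> R) * R) :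
  \prod_(j < d) F (upd e i p j) j = F p i * \prod_(j < d | j != i) F (e j) j.
Proof.
rewrite (bigD1 i) //= {1}/upd eqxx; congr (_ * _).
by apply: eq_bigr => j /negbTE ji; rewrite /upd ji.
Qed.

(** Recording the integrals makes the volume term multilinear along with the counting term, so that
    a discrepancy can be expanded one factor at a time. *)
Lemma prod_disc_lin zs e i (p p1 p2 : (R -> R) * R) (c1 c2 : R) :
  (forall z, z \in zs -> in_cube z) ->
  (forall x, 0 <= x < 1 -> p.1 x = c1 * p1.1 x + c2 * p2.1 x) ->
  p.2 = c1 * p1.2 + c2 * p2.2 ->
  prod_disc zs (upd e i p)
  = c1 * prod_disc zs (upd e i p1) + c2 * prod_disc zs (upd e i p2).
Proof.
move=> hz h1 h2; rewrite /prod_disc !(prod_upd (fun p _ => p.2)) h2.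
under eq_bigr do rewrite (prod_upd (fun p j => p.1 (tnth _ j))).
under [in RHS]eq_bigr do rewrite (prod_upd (fun p j => p.1 (tnth _ j))).
under [X in _ = _ + c2 * (X - _)]eq_bigr do
  rewrite (prod_upd (fun p j => p.1 (tnth _ j))).
rewrite big_seq; under eq_bigr => z zz do rewrite (h1 _ (hz z zz i)) mulrDl -!mulrA.
rewrite -big_seq big_split /= -!mulr_sumr; ring.
Qed.

Definition dyadic_factor (t : nat * nat) : (R -> R) * R :=
  (fun x => (dfloor t.2 x == t.1)%:R, 2 ^- t.2).

(** The recorded integral 0 is the true one for positive orders only; [mixed_disc] asks for them. *)
Definition haar_factor (t : nat * nat) : (R -> R) * R := (haar1 (haar_itv t.1 t.2), 0).

Definition itv_factor (a b : R) : (R -> R) * R :=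
  (fun x => ((a <= x < b)%R : bool)%:R, b - a).

Definition mixed_factor (t : bool * (nat * nat)) :=
  if t.1 then haar_factor t.2 else dyadic_factor t.2.

Lemma dyadic_factor_half (a k : nat) (x : R) : 0 <= x < 1 ->
  (dyadic_factor (a, k.+1)).1 x =
  2^-1 * (dyadic_factor (a./2, k)).1 x
  + (-1) ^+ odd a / 2 * (haar_factor (a./2, k.+1)).1 x.
Proof.
move=> hx; have x0 : 0 <= x by case/andP: hx.
rewrite /= haar1E // -(dfloorS k x0); set t := dfloor _ _.
rewrite -{1}(odd_double_half t) -{1}(odd_double_half a).
rewrite [a./2 == _]eq_sym; case: (eqVneq t./2 a./2) => [->|ne].
  by rewrite eqn_add2r; case: (odd t); case: (odd a) => /=; lra.
rewrite (_ : (_ == _) = false) ?mul0r ?mulr0 ?addr0 //.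
apply/negP => /eqP /(congr1 half); rewrite !halfD !doubleK !odd_double !andbF.
by case: (odd t); case: (odd a) => /=; rewrite !add0n => h; rewrite h eqxx in ne.
Qed.

Variables (zs : seq (d.-tuple R)) (h : nat) (M : R).
Hypothesis zs_cube : forall z, z \in zs -> in_cube z.
Hypothesis M0 : 0 <= M.
Hypothesis haar_le : forall K, haar_set R 1 h%:Z K -> `|pairing zs (haar K)| <= M.

Lemma sum_upd T (mu : T -> nat) (f : 'I_d -> T) i p :
  (\sum_(j < d) mu (upd f i p j) + mu (f i) = \sum_(j < d) mu (f j) + mu p)%N.
Proof.
rewrite (bigD1 i) //= [in RHS](bigD1 i) //= {1}/upd eqxx.
rewrite (eq_bigr (fun j => mu (f j))); last by move=> j /negbTE ji; rewrite /upd ji.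
lia.
Qed.

Let shift_le s s' k l n : (s' + k = s + l -> l <= k -> s <= n -> s' <= n)%N.
Proof. lia. Qed.

Let shift_lt s s' k l n : (s' + k = s + l -> l < k -> s < n.+1 -> s' < n)%N.
Proof. lia. Qed.

(** Induction on the total order left in the dyadic factors. Splitting a factor of order k + 1
    yields a dyadic factor of order k and a Haar factor of order k + 1, with coefficients of
    absolute value 1/2: the bound [M] is averaged and the total order does not increase. *)
Lemma mixed_disc (f : 'I_d -> bool * (nat * nat)) :
  (forall i, if (f i).1 then (0 < (f i).2.2)%N && ((f i).2.1.*2 < 2 ^ (f i).2.2)%N
             else ((f i).2.1 < 2 ^ (f i).2.2)%N) ->
  (\sum_(i < d) (f i).2.2 <= h)%N ->
  `|prod_disc zs (mixed_factor \o f)| <= M.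
Proof.
have [n] := ubnP (\sum_(i < d) (if (f i).1 then 0 else (f i).2.2)%N)%N.
elim: n f => // n IH f fn hf hs.
have [i /andP[/negbTE fi ki]|nex] := pickP (fun i => ~~ (f i).1 && (0 < (f i).2.2)%N).
  case E : (f i) (hf i) fi ki => [[] [a k]] //= ha _ k0.
  case: k E ha k0 => // k E ha _.
  have ha2 : (a./2 < 2 ^ k)%N by rewrite ltn_half_double -muln2 -expnSr.
  rewrite -(upd_id f i) E comp_upd.
  rewrite (@prod_disc_lin _ _ _ _ (mixed_factor (false, (a./2, k)))
    (mixed_factor (true, (a./2, k.+1))) 2^-1 ((-1) ^+ odd a / 2)) //; last 2 first.
  - by move=> x hx; apply: dyadic_factor_half.
  - by rewrite /= mulr0 addr0 exprS invfM.
  rewrite -!comp_upd.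
  have S p := sum_upd (fun t => t.2.2) f i p.
  have S' p := sum_upd (fun t => if t.1 then 0%N else t.2.2) f i p.
  have h1 : `|prod_disc zs (mixed_factor \o upd f i (false, (a./2, k)))| <= M.
    apply: IH.
    - by have := S' (false, (a./2, k)); rewrite E /= => e; apply: shift_lt e _ fn.
    - by move=> j; rewrite /upd; case: eqP => // _; apply: hf.
    - by have := S (false, (a./2, k)); rewrite E /= => e; apply: shift_le e _ hs.
  have h2 : `|prod_disc zs (mixed_factor \o upd f i (true, (a./2, k.+1)))| <= M.
    apply: IH.
    - by have := S' (true, (a./2, k.+1)); rewrite E /= => e; apply: shift_lt e _ fn.
    - move=> j; rewrite /upd; case: eqP => [_|_]; last exact: hf.
      by rewrite /= expnS mul2n ltn_double.
    - by have := S (true, (a./2, k.+1)); rewrite E /= => e; apply: shift_le e _ hs.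
  apply: le_trans (ler_normD _ _) _; rewrite !normrM normr_sign normfV mul1r normr_nat; lra.
(* A dyadic factor that cannot be split any more is [0, 1), whose indicator is the Haar function of
   order 0. *)
have fe i : ~~ (f i).1 -> f i = (false, (0, 0)%N).
  move=> fi; have := nex i; rewrite fi /= => k0.
  case E : (f i) (hf i) fi k0 => [[] [a k]] //= + _; case: k E => // E.
  by case: a E.
have E z : z \in zs -> \prod_(i < d) ((mixed_factor \o f) i).1 (tnth z i)
    = haar [tuple haar_itv (f i).2.1 (f i).2.2 | i < d] z.
  move=> hz; rewrite /haar; apply: eq_bigr => i _; rewrite tnth_mktuple /= /mixed_factor.
  case: ifP => // /negbT /fe ->; rewrite /= haar1E ?(zs_cube hz) //.
  by rewrite dfloor0 ?(zs_cube hz) //= mulr1.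
rewrite /prod_disc big_seq (eq_bigr _ E) -big_seq.
have [i hi|nohaar] := pickP (fun i => (f i).1).
  rewrite [X in _ - _ * X](bigD1 i) //= /mixed_factor hi mul0r mulr0 subr0.
  apply: haar_le; apply/haar_setP.
  exists (fun i => (f i).2.1), (fun i => (f i).2.2); split=> //.
    move=> j; have := hf j; case: ifP => [_ /andP[]//|/negbT /fe ->//].
  rewrite hs andbT (bigD1 i) //=; have := hf i; rewrite hi => /andP[]; lia.
(* Without a Haar factor the box is the whole cube, of discrepancy 0. *)
rewrite [X in _ - _ * X]big1 ?mulr1; last first.
  by move=> i _; rewrite /= fe ?nohaar //= /mixed_factor /= expr0 invr1.
rewrite big_seq (eq_bigr (fun=> 1)); last first.
  by move=> z hz; rewrite -E // big1 // => i _; rewrite /= fe ?nohaar //= dfloor0 ?zs_cube.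
by rewrite -big_seq big_const_seq count_predT iter_addr_0 subrr normr0.
Qed.

Lemma dyadic_disc (f : 'I_d -> nat * nat) :
  (forall i, ((f i).1 < 2 ^ (f i).2)%N) -> (\sum_(i < d) (f i).2 <= h)%N ->
  `|prod_disc zs (dyadic_factor \o f)| <= M.
Proof. by move=> hf; apply: (mixed_disc (f := fun i => (false, f i))) => i; apply: hf. Qed.

(* By [a, b) = [0, b) \ [0, a), each coordinate gives two families of dyadic
   intervals, one per order, and two leftovers. *)
Fixpoint box_count (j m : nat) : nat :=
  if j is j'.+1 then ((\sum_(i < m) box_count j' i).+1).*2 else 1.

Hypothesis size_zs : (size zs < 2 ^ h.+1)%N.
Variables a b : 'I_d -> R.
Hypothesis ab : forall i, [/\ 0 <= a i, a i < b i & b i <= 1].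

Definition partial_factor (r : nat) (f : 'I_d -> nat * nat) (i : 'I_d) :=
  if (i < r)%N then dyadic_factor (f i) else itv_factor (a i) (b i).

(* The leftover of an interval after its dyadic pieces down to the budget:
   its points lie in a dyadic box of order [h]. *)
Lemma remainder_disc (r : 'I_d) (f : 'I_d -> nat * nat) (c k : nat) (y : R) :
  (forall i : 'I_d, (i < r)%N -> ((f i).1 < 2 ^ (f i).2)%N) -> (c < 2 ^ k)%N ->
  (\sum_(i < d | (i < r)%N) (f i).2 + k = h)%N ->
  c%:R / 2 ^+ k < y <= c.+1%:R / 2 ^+ k ->
  `|prod_disc zs (upd (partial_factor r f) r (itv_factor (c%:R / 2 ^+ k) y))|
    <= M + 2.
Proof.
move=> hf ck hs /andP[y1 y2].
(* The enclosing dyadic box of order h: the whole dyadic interval in coordinate [r], and [0, 1) in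
   the later ones. *)
pose f' := upd (fun i : 'I_d => if (i < r)%N then f i else (0, 0)%N) r (c, k).
have hf' i : ((f' i).1 < 2 ^ (f' i).2)%N.
  by rewrite /f' /upd; case: eqP => // _; case: ifP => // /hf.
have sf' : (\sum_(i < d) (f' i).2 = h)%N.
  rewrite -hs (bigD1 r) //= {1}/f' /upd eqxx addnC; congr (_ + _)%N.
  rewrite [LHS]big_mkcond [RHS]big_mkcond; apply: eq_bigr => i _ /=.
  rewrite /f' /upd; case: eqP => [->|_] /=; first by rewrite ltnn.
  by case: ifP.
have := dyadic_disc hf'; rewrite sf' leqnn => /(_ isT).
set e := upd _ _ _; rewrite /prod_disc.
have p2 k' : 0 < 2 ^+ k' :> R by rewrite exprn_gt0.
have fac i z : in_cube z ->
    0 <= (e i).1 (tnth z i) <= ((dyadic_factor \o f') i).1 (tnth z i).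
  move=> hz; have z0 : 0 <= tnth z i by case/andP: (hz i).
  rewrite /e /f' /upd /=; case: eqP => [->|_] /=.
    rewrite ler0n ler_nat; case: (boolP (_ <= _ < _)) => //= /andP[h1 h2].
    rewrite lt0b dfloor_eq ?(proj1 (andP (hz r))) ?z0 //.
    rewrite -ler_pdivrMl // [_^-1 * _]mulrC h1 mulrC -ltr_pdivlMr //.
    exact: lt_le_trans y2.
  rewrite /partial_factor; case: ifP => _ /=; first by rewrite ler0n lexx.
  by rewrite dfloor0 ?hz // eqxx ler0n lern1 leq_b1.
have mass i : 0 <= (e i).2 <= ((dyadic_factor \o f') i).2.
  rewrite /e /f' /upd /=; case: eqP => [_|_] /=.
    rewrite subr_ge0 (ltW y1) /= lerBlDr; apply: le_trans y2 _.
    by rewrite -natr1 mulrDl mul1r addrC.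
  rewrite /partial_factor; case: ifP => _ /=; first by rewrite lexx andbT invr_ge0 ltW.
  by rewrite invr1; have [h1 h2 h3] := ab i; apply/andP; split; lra.
have Emass : \prod_(i < d) ((dyadic_factor \o f') i).2 = 2 ^- h.
  under eq_bigr do rewrite /= -exprVn.
  by rewrite prodrXr sf' exprVn.
set S' := \sum_(z <- zs) _; rewrite Emass.
set S := \sum_(z <- zs) _.
have S0 : 0 <= S.
  rewrite /S big_seq; apply: sumr_ge0 => z hz; apply: prodr_ge0 => i _.
  by have /andP[] := fac i z (zs_cube hz).
have SS' : S <= S'.
  rewrite /S /S' !big_seq; apply: ler_sum => z hz; apply: ler_prod => i _.
  exact: fac (zs_cube hz).
(* The expected count in a box of volume 2^-h is at most 2: this is the 2 in [M + 2]. *)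
have n2 : (size zs)%:R * 2 ^- h <= 2 :> R.
  by rewrite ler_pdivrMr // -exprS -natrX ler_nat ltnW.
have m0 : 0 <= \prod_(i < d) (e i).2.
  by apply: prodr_ge0 => i _; have /andP[] := mass i.
have m1 : \prod_(i < d) (e i).2 <= 2 ^- h.
  by rewrite -Emass; apply: ler_prod => i _; apply: mass.
have m2 : (size zs)%:R * \prod_(i < d) (e i).2 <= (size zs)%:R * 2 ^- h.
  by rewrite ler_wpM2l.
have m3 : 0 <= (size zs)%:R * \prod_(i < d) (e i).2 by rewrite mulr_ge0.
rewrite !ler_norml => /andP[h1 h2]; apply/andP; split; lra.
Qed.

Lemma partial_factorS (r : 'I_d) f t :
  upd (partial_factor r f) r (dyadic_factor t) = partial_factor r.+1 (upd f r t).
Proof.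
apply: boolp.funext => i; rewrite /partial_factor /upd ltnS.
case: (eqVneq i r) => [->|ne]; first by rewrite leqnn.
have nv : (nat_of_ord i == r) = false.
  by apply/negP => /eqP/val_inj e; rewrite e eqxx in ne.
by rewrite [in RHS]leq_eqVlt nv.
Qed.

(** Bisection of the dyadic interval that contains the end [y]. If [y] is beyond the midpoint, the
    left half is split off as a dyadic piece, which the later coordinates treat with the budget
    left, and the right half is bisected; otherwise the left half is. Each order gives at most one
    piece, and the leftover remains when the budget is spent. *)
Lemma half_interval_disc (r : 'I_d) (f : 'I_d -> nat * nat) (c k m : nat) (y : R) :
  (forall (f' : 'I_d -> nat * nat) (l : nat),
    (forall i : 'I_d, (i < r.+1)%N -> ((f' i).1 < 2 ^ (f' i).2)%N) ->
    (\sum_(i < d | (i < r.+1)%N) (f' i).2 + l = h)%N ->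
    `|prod_disc zs (partial_factor r.+1 f')|
      <= (box_count (d - r.+1) l)%:R * (M + 2)) ->
  (forall i : 'I_d, (i < r)%N -> ((f i).1 < 2 ^ (f i).2)%N) -> (c < 2 ^ k)%N ->
  (\sum_(i < d | (i < r)%N) (f i).2 + (k + m) = h)%N ->
  c%:R / 2 ^+ k < y <= c.+1%:R / 2 ^+ k ->
  `|prod_disc zs (upd (partial_factor r f) r (itv_factor (c%:R / 2 ^+ k) y))|
    <= (\sum_(i < m) box_count (d - r.+1) i).+1%:R * (M + 2).
Proof.
move=> IH hf; elim: m c k => [|m IHm] c k ck hs hy.
  by rewrite big_ord0 mul1r; apply: remainder_disc => //; rewrite -hs addn0.
have /andP[y1 y2] := hy.
have p2 k' : 0 < 2 ^+ k' :> R by rewrite exprn_gt0.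
have Ec : c%:R / 2 ^+ k = c.*2%:R / 2 ^+ k.+1 :> R.
  by rewrite exprS -mul2n natrM invfM mulrACA divff ?mul1r // pnatr_eq0.
have Ec1 : c.+1%:R / 2 ^+ k = c.*2.+2%:R / 2 ^+ k.+1 :> R.
  by rewrite -doubleS exprS -mul2n natrM invfM mulrACA divff ?mul1r // pnatr_eq0.
have c2 : (c.*2.+1 < 2 ^ k.+1)%N by rewrite expnS mul2n -doubleS leq_double in ck *.
have hs' : (\sum_(i < d | (i < r)%N) (f i).2 + (k.+1 + m) = h)%N by rewrite -hs addnS addSn.
rewrite big_ord_recr /=; set S := (\sum_(i < m) _)%N.
have M2 : 0 <= M + 2 by rewrite addr_ge0.
have [ymid|ymid] := leP y (c.*2.+1%:R / 2 ^+ k.+1).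
  apply: (@le_trans _ _ (S.+1%:R * (M + 2))).
    by rewrite Ec; apply: IHm => //; [exact: ltnW|rewrite -Ec y1].
  by rewrite ler_wpM2r // ler_nat ltnS leq_addr.
rewrite (@prod_disc_lin _ _ _ _ (dyadic_factor (c.*2, k.+1))
  (itv_factor (c.*2.+1%:R / 2 ^+ k.+1) y) 1 1) //; last 2 first.
- move=> x /andP[x0 _] /=; rewrite !mul1r dfloor_eq //.
  rewrite Ec -ler_pdivrMl // -ltr_pdivlMl // ![_^-1 * _]mulrC.
  have AB : c.*2%:R / 2 ^+ k.+1 < c.*2.+1%:R / 2 ^+ k.+1 :> R.
    by rewrite ltr_pM2r ?invr_gt0 // ltr_nat.
  move: AB ymid; move: (c.*2%:R / _) (c.*2.+1%:R / _) => A B AB ymid.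
  case: (leP A x) => /= h1; case: (ltP x y) => /= h2;
  case: (ltP x B) => //= h3; lra.
- by rewrite /= !mul1r Ec -[c.*2.+1%:R]natr1 mulrDl; ring.
rewrite !mul1r -addSn natrD mulrDl [leRHS]addrC; apply: le_trans (ler_normD _ _) _.
apply: lerD; last first.
  by apply: IHm => //; rewrite ymid -Ec1.
rewrite partial_factorS; apply: IH => [i|].
  rewrite ltnS leq_eqVlt /upd => /orP[/eqP/val_inj ->|ir].
    by rewrite eqxx; apply: ltnW.
  by case: eqP => [e|_]; [rewrite e ltnn in ir|apply: hf].
rewrite -hs' (bigD1 r) //= {1}/upd eqxx /= -addnA addnCA; congr (_ + _)%N.
apply: eq_big => [i|i /andP[_ /negbTE ir]]; last by rewrite /upd ir.
by rewrite ltnS [RHS]ltn_neqAle andbC.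
Qed.

Lemma partial_disc (j r m : nat) (f : 'I_d -> nat * nat) : (r + j = d)%N ->
  (forall i : 'I_d, (i < r)%N -> ((f i).1 < 2 ^ (f i).2)%N) ->
  (\sum_(i < d | (i < r)%N) (f i).2 + m = h)%N ->
  `|prod_disc zs (partial_factor r f)| <= (box_count j m)%:R * (M + 2).
Proof.
elim: j r m f => [|j IH] r m f rd hf hs.
  rewrite addn0 in rd; rewrite mul1r.
  have -> : partial_factor r f = dyadic_factor \o f.
    by apply: boolp.funext => i; rewrite /partial_factor rd ltn_ord.
  apply: le_trans (dyadic_disc _ _) _; last by lra.
  - by move=> i; apply: hf; rewrite rd.
  - rewrite -hs [X in (_ <= X + _)%N](eq_bigl xpredT); last by move=> i; rewrite rd ltn_ord.
    exact: leq_addr.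
have rd' : (r < d)%N by rewrite -rd -addSnnS leq_addr.
pose r' := Ordinal rd'.
have -> : partial_factor r f = upd (partial_factor r f) r' (itv_factor (a r') (b r')).
  by rewrite -[LHS](upd_id _ r') {2}/partial_factor ltnn.
have dr : (d - r'.+1 = j)%N by rewrite /=; lia.
have halfd y : 0 < y <= 1 ->
    `|prod_disc zs (upd (partial_factor r f) r' (itv_factor 0 y))| <=
    (\sum_(i < m) box_count j i).+1%:R * (M + 2).
  move=> hy; have := @half_interval_disc r' f 0 0 m y.
  rewrite expr0 invr1 !mulr1 mulr0n dr add0n; apply=> //.
  by move=> f' l; apply: IH; rewrite /= addSnnS.
have [a0 ab' b1] := ab r'.
rewrite (@prod_disc_lin _ _ _ _ (itv_factor 0 (b r')) (itv_factor 0 (a r')) 1 (-1)) //; last 2 first.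
- move=> x /andP[x0 _] /=; rewrite mul1r x0 /=.
  case: (leP (a r') x) => h1 /=; case: (ltP x (b r')) => h2 /=; lra.
- by rewrite /=; ring.
rewrite mul1r mulN1r; apply: le_trans (ler_normB _ _) _.
rewrite -[box_count j.+1 m]/(((\sum_(i < m) box_count j i).+1).*2)%N -muln2 natrM mulrAC mulr_natr mulr2n; apply: lerD.
  by apply: halfd; rewrite b1 (le_lt_trans a0).
(* The bisection needs [0 < y], so [a = 0] is treated apart: the indicator of [0, 0) is 0 times
   itself. *)
have [e|ne] := eqVneq (a r') 0; last first.
  by apply: halfd; rewrite lt_def ne a0 (le_trans (ltW ab')).
rewrite e (@prod_disc_lin _ _ _ _ (itv_factor 0 0) (itv_factor 0 0) 0 0) //.
- by rewrite !mul0r addr0 normr0 mulr_ge0 // addr_ge0.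
- by move=> x _ /=; case: (leP 0 x) => h1; case: (ltP x 0) => h2 /=; lra.
- by rewrite /=; ring.
Qed.

End Discrepancy.

(** Hockey-stick summation; the 1 taken off the binomial coefficient pays for the leftover. *)
Lemma box_count_le (j m : nat) : (box_count j m <= 2 ^ j.+1 * 'C(m + j, j))%N.
Proof.
elim: j m => [|j IH] m; first by rewrite bin0.
rewrite /= expnS -mulnA mul2n leq_double.
have -> : (2 ^ j.+1 * 'C(m + j.+1, j.+1) =
  2 ^ j.+1 * 'C(j, j) + 2 ^ j.+1 * ('C(m + j.+1, j.+1) - 1))%N.
  by rewrite -mulnDr binn subnKC // bin_gt0 leq_addl.
suff h : (\sum_(i < m) box_count j i <= 2 ^ j.+1 * ('C(m + j.+1, j.+1) - 1))%N.
  rewrite -addn1 addnC; apply: leq_add => //.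
  by rewrite binn muln1 expn_gt0.
elim: m => [|m IHm]; first by rewrite big_ord0.
rewrite big_ord_recr /=; apply: leq_trans (leq_add IHm (IH m)) _.
rewrite -mulnDr leq_mul2l; apply/orP; right.
rewrite addSn addnS [in leqRHS]binS.
have : (0 < 'C((m + j).+1, j.+1))%N by rewrite bin_gt0; lia.
have : ('C(m + j, j) <= 'C((m + j).+1, j))%N by apply: leq_bin2l.
by lia.
Qed.

Lemma discrepancy_le (R : realType) d (zs : seq (d.-tuple R)) h (M : R) :
  (forall z, z \in zs -> in_cube z) -> 0 <= M ->
  (forall K, haar_set R 1 h%:Z K -> `|pairing zs (haar K)| <= M) ->
  (size zs < 2 ^ h.+1)%N ->
  discrepancy zs <= (box_count d h)%:R * (M + 2).
Proof.
move=> hz M0 hM hsz; apply: ge_sup.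
  exists `|(count (fun z : d.-tuple R => [forall i, tnth [tuple 0 | i < d] i <= tnth z i < tnth [tuple 1 | i < d] i]) zs)%:R
           - (size zs)%:R * \prod_(i < d) (tnth [tuple 1 | i < d] i - tnth [tuple 0 | i < d] i)|.
  exists [tuple 0 | i < d], [tuple 1 | i < d]; split=> // i.
  by rewrite !tnth_mktuple; split; rewrite ?lexx ?ltr01.
move=> r [a [b [hab ->]]].
have : `|prod_disc zs (partial_factor (tnth a) (tnth b) 0 (fun=> (0, 0)%N))|
    <= (box_count d h)%:R * (M + 2).
  by apply: (partial_disc hz M0 hM hsz hab) => //; rewrite big_pred0.
apply: le_trans; rewrite /prod_disc.
rewrite le_eqVlt; apply/orP; left; apply/eqP; congr (`|_ - _|).
rewrite -sum1_count natr_sum big_mkcond /=; apply: eq_bigr => z _.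
case: (boolP [forall i, _]) => [/forallP hh|].
  by rewrite big1 // => i _; rewrite /partial_factor /= hh.
rewrite negb_forall => /existsP[i hi].
by rewrite (bigD1 i) //= /partial_factor /= (negbTE hi) mul0r.
Qed.

(** * Orthogonality of the Haar functions on a finite grid *)

Section Grid.
Context {R : realType}.

Lemma sum_blocks (A B : nat) (F : nat -> R) :
  \sum_(n < A * B) F n = \sum_(i < A) \sum_(j < B) F (i * B + j)%N.
Proof.
rewrite -(big_mkord xpredT F) big_nat_mul big_mkord; apply: eq_bigr => i _.
rewrite mulSn -{1}(add0n (i * B)%N) big_addn addnK big_mkord.
by apply: eq_bigr => j _; rewrite addnC.
Qed.

(** The sign flips in the middle of each block of length 2^(m+1), on which the factor [phi] is
    constant, so every block sums to 0. *)
Lemma sum_sign_blocks (h m : nat) (phi : nat -> R) : (m < h)%N ->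
  \sum_(n < 2 ^ h) phi (n %/ 2 ^ m.+1)%N * (-1) ^+ odd (n %/ 2 ^ m) = 0.
Proof.
move=> mh; have -> : (2 ^ h = 2 ^ (h - m.+1) * 2 ^ m.+1)%N by rewrite -expnD subnK.
rewrite (sum_blocks _ _ (fun n => phi (n %/ 2 ^ m.+1)%N * (-1) ^+ odd (n %/ 2 ^ m))).
rewrite big1 // => i _.
have p m' : (0 < 2 ^ m')%N by rewrite expn_gt0.
have E (j : nat) : odd ((i * 2 ^ m.+1 + j) %/ 2 ^ m) = odd (j %/ 2 ^ m).
  by rewrite expnS mulnA divnMDl // oddD oddM andbF addFb.
under eq_bigr => j _ do rewrite divnMDl // (divn_small (ltn_ord j)) addn0 E.
rewrite -mulr_sumr.
have -> : \sum_(j < 2 ^ m.+1) ((-1) ^+ odd (j %/ 2 ^ m) : R) = 0; last by rewrite mulr0.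
rewrite expnS (sum_blocks 2 (2 ^ m) (fun j => (-1) ^+ odd (j %/ 2 ^ m))).
rewrite !big_ord_recl big_ord0 addr0 /= /bump /= mul0n mul1n.
under eq_bigr => j _ do rewrite add0n (divn_small (ltn_ord j)).
under [X in _ + X]eq_bigr => j _ do
  rewrite -[X in (X + _)%N]mul1n divnMDl // (divn_small (ltn_ord j)).
by rewrite /= !sumr_const !card_ord -mulrnDl subrr mul0rn.
Qed.

Definition grid_haar (h a s n : nat) : R :=
  (a == (n %/ 2 ^ (h - s))./2)%:R * (-1) ^+ odd (n %/ 2 ^ (h - s)).

(** For equal orders the supports are disjoint. Otherwise the coarser function is constant on each
    block where the finer one changes sign, and [sum_sign_blocks] applies. *)
Lemma grid_haar_orth h a s a' s' : (s <= h)%N -> (s' <= h)%N -> (a, s) != (a', s') ->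
  \sum_(n < 2 ^ h) grid_haar h a s n * grid_haar h a' s' n = 0.
Proof.
move=> sh s'h.
wlog ss : a s a' s' sh s'h / (s <= s')%N => [W ne|].
  have [/W|/ltnW/W] := leqP s s'; first exact.
  under eq_bigr do rewrite mulrC.
  by apply=> //; rewrite eq_sym.
move=> ne; have [e|ne_s] := eqVneq s s'.
  rewrite big1 // => n _; rewrite /grid_haar e; case: eqP => [e1|_]; last by rewrite !mul0r.
  case: eqP => [e2|_]; last by rewrite mul0r mulr0.
  by rewrite e e1 e2 eqxx in ne.
have lt : (s < s')%N by rewrite ltn_neqAle ne_s.
have hm : (h - s' < h)%N by lia.
(* [phi] collects the coarser function and the indicator of the support of the finer one, both
   determined by the number of the block. *)
rewrite -[RHS](@sum_sign_blocks h (h - s')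
  (fun c => (a == (c %/ 2 ^ (s' - s.+1))./2)%:R * (-1) ^+ odd (c %/ 2 ^ (s' - s.+1))
    * (a' == c)%:R) hm).
apply: eq_bigr => n _; rewrite /grid_haar mulrA; congr (_ * _ * _).
  by rewrite -!divnMA -!expnD; congr (_ * _); do ?congr ((_ == _)%:R); do ?congr (_ ^+ odd _);
    do ?congr (half _); congr (_ %/ 2 ^ _)%N; lia.
by rewrite -divn2 -divnMA -expnSr.
Qed.

(** The support consists of two cells of order [s], whence the factor 2; for [s = 0] there is only
    one, hence an inequality. *)
Lemma grid_haar_mass h a s : (s <= h)%N ->
  \sum_(n < 2 ^ h) grid_haar h a s n ^+ 2 * 2 ^+ s <= 2 * 2 ^+ h.
Proof.
move=> sh; rewrite -mulr_suml.
have E n : grid_haar h a s n ^+ 2 = (a == (n %/ 2 ^ (h - s))./2)%:R.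
  by rewrite /grid_haar exprMn sqrr_sign mulr1; case: (_ == _); rewrite ?expr1n ?expr0n.
under eq_bigr do rewrite E.
have -> : (2 ^ h = 2 ^ s * 2 ^ (h - s))%N by rewrite -expnD subnKC.
rewrite (sum_blocks _ _ (fun n => (a == (n %/ 2 ^ (h - s))./2)%:R)).
have p m' : (0 < 2 ^ m')%N by rewrite expn_gt0.
under eq_bigr do under eq_bigr => j _ do rewrite divnMDl // (divn_small (ltn_ord j)) addn0.
under eq_bigr do rewrite sumr_const card_ord.
rewrite sumrMnl -[X in X * _]mulr_natl natrX.
suff H : \sum_(i < 2 ^ s) ((a == i./2)%:R : R) <= 2.
  rewrite -{2}(subnKC sh) exprD.
  have h1 : 0 < 2 ^+ (h - s) :> R by rewrite exprn_gt0.
  have h2 : 0 < 2 ^+ s :> R by rewrite exprn_gt0.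
  by rewrite [leRHS]mulrCA mulrC ler_wpM2l ?(ltW h2) // mulrC ler_wpM2r // ltW.
case: s {sh E} => [|s].
  by rewrite expn0 big_ord_recl big_ord0 addr0; apply: le_trans (_ : 1 <= 2); rewrite ?ler1n // lern1 leq_b1.
rewrite expnSr (sum_blocks _ _ (fun n => (a == n./2)%:R)).
have E (i : 'I_(2 ^ s)) (j : 'I_2) : ((i * 2 + j)./2 = i)%N.
  by rewrite -divn2 divnMDl // (divn_small (ltn_ord j)) addn0.
under eq_bigr do under eq_bigr do rewrite E.
under eq_bigr do rewrite sumr_const card_ord.
rewrite sumrMnl -[leLHS]mulr_natl -[leRHS]mulr1 ler_wpM2l //.
have [lt|ge] := ltnP a (2 ^ s).
  rewrite (bigD1 (Ordinal lt)) //= eqxx big1 ?addr0 // => i.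
  by rewrite -(inj_eq val_inj) /= eq_sym => /negbTE ->.
rewrite big1 // => i _; case: eqP => // e.
by have := ltn_ord i; rewrite -e ltnNge ge.
Qed.

Variables (d h : nat).

Definition gridT := {ffun 'I_d -> 'I_(2 ^ h)}.

Definition gpt (q : gridT) : d.-tuple R := [tuple (q i)%:R / 2 ^+ h | i < d].

(** The default of [insubd] is reached only by points off the cube. *)
Definition cell (x : d.-tuple R) : gridT :=
  [ffun i => insubd (Ordinal (expn_gt0 2 h : 0 < 2 ^ h)%N) (dfloor h (tnth x i))].

Lemma gpt_cube q : in_cube (gpt q).
Proof.
move=> i; rewrite tnth_mktuple divr_ge0 ?exprn_ge0 //=.
by rewrite ltr_pdivrMr ?exprn_gt0 // mul1r -natrX ltr_nat.
Qed.

Lemma dfloor_div s (x : R) : 0 <= x -> (s <= h)%N ->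
  dfloor s x = (dfloor h x %/ 2 ^ (h - s))%N.
Proof.
move=> x0 sh; rewrite -{1}(subKn sh); move: (h - s)%N (leq_subr s h) => k.
elim: k => [|k IH] kh; first by rewrite subn0 divn1.
rewrite expnSr divnMA -IH ?(ltnW kh) // divn2.
by rewrite -(dfloorS _ x0); congr (half (dfloor _ _)); lia.
Qed.

Lemma dfloor_grid s n : (s <= h)%N ->
  dfloor s (n%:R / 2 ^+ h : R) = (n %/ 2 ^ (h - s))%N.
Proof.
move=> sh; rewrite dfloor_div ?divr_ge0 ?exprn_ge0 //; congr (_ %/ _)%N.
by rewrite /dfloor mulrC divfK ?expf_neq0 // natrK.
Qed.

Lemma cellE (x : d.-tuple R) i : in_cube x -> cell x i = dfloor h (tnth x i) :> nat.
Proof. by move=> hx; rewrite ffunE val_insubd dfloor_lt. Qed.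

Lemma dfloor_cell s (x : d.-tuple R) i : in_cube x -> (s <= h)%N ->
  dfloor s (tnth (gpt (cell x)) i) = dfloor s (tnth x i).
Proof.
move=> hx sh; rewrite tnth_mktuple dfloor_grid // cellE // -dfloor_div //.
by case/andP: (hx i).
Qed.

(** A total order at most [h] bounds every coordinate order by [h], so the Haar function is constant
    on the cells of side 2^-h. *)
Lemma haar_gpt_cell K (x : d.-tuple R) : in_cube x -> haar_set R 1 h%:Z K ->
  haar K (gpt (cell x)) = haar K x.
Proof.
move=> hx /haar_setP[a [s [_ -> /andP[_ hs]]]].
have sh i : (s i <= h)%N by apply: leq_trans hs; rewrite (bigD1 i) //= leq_addr.
rewrite !haarE //; last exact: gpt_cube.
congr ((nat_of_bool _)%:R * _).
  by apply: eq_forallb => i; rewrite dfloor_cell.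
by apply: eq_bigr => i _; rewrite dfloor_cell.
Qed.

Lemma haar_gpt (a s : 'I_d -> nat) q : (forall i, s i <= h)%N ->
  haar [tuple haar_itv (a i) (s i) | i < d] (gpt q)
  = \prod_(i < d) grid_haar h (a i) (s i) (q i).
Proof.
move=> sh; rewrite haarE; last exact: gpt_cube.
under eq_bigr do rewrite tnth_mktuple dfloor_grid //.
under eq_forallb do rewrite tnth_mktuple dfloor_grid //.
rewrite /grid_haar big_split /=; congr (_ * _).
case: (boolP [forall i, a i == _]) => [/forallP hf|].
  by rewrite big1 // => i _; rewrite hf.
by rewrite negb_forall => /existsP[i /negbTE hi]; rewrite (bigD1 i) //= hi mul0r.
Qed.

Lemma sum_gridT (F : 'I_d -> nat -> R) :
  \sum_(q : gridT) \prod_(i < d) F i (q i) = \prod_(i < d) \sum_(n < 2 ^ h) F i n.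
Proof. by rewrite (bigA_distr_bigA (fun i (n : 'I_(2 ^ h)) => F i n)). Qed.

Lemma haar_orth K K' : haar_set R 1 h%:Z K -> haar_set R 1 h%:Z K' -> K != K' ->
  \sum_(q : gridT) haar K (gpt q) * haar K' (gpt q) = 0.
Proof.
move=> /haar_setP[a [s [_ KE /andP[_ hs]]]] /haar_setP[a' [s' [_ KE' /andP[_ hs']]]] ne.
have sh i : (s i <= h)%N by apply: leq_trans hs; rewrite (bigD1 i) //= leq_addr.
have sh' i : (s' i <= h)%N by apply: leq_trans hs'; rewrite (bigD1 i) //= leq_addr.
rewrite KE KE'; under eq_bigr do rewrite !haar_gpt // -big_split /=.
rewrite (sum_gridT (fun i n => grid_haar h (a i) (s i) n * grid_haar h (a' i) (s' i) n)).
have [i hi|none] := pickP (fun i => (a i, s i) != (a' i, s' i)).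
  by rewrite (bigD1 i) //= grid_haar_orth ?mul0r.
case/eqP: ne; rewrite KE KE'; apply: eq_mktuple => i.
by have /negbFE/eqP[-> ->] := none i.
Qed.

Lemma haar_mean0 K : haar_set R 1 h%:Z K -> \sum_(q : gridT) haar K (gpt q) = 0.
Proof.
move=> /haar_setP[a [s [_ KE /andP[h0 hs]]]].
have sh i : (s i <= h)%N by apply: leq_trans hs; rewrite (bigD1 i) //= leq_addr.
rewrite KE; under eq_bigr do rewrite haar_gpt //.
rewrite (sum_gridT (fun i n => grid_haar h (a i) (s i) n)).
have [i si|none] := pickP (fun i => (0 < s i)%N); last first.
  by move: h0; rewrite big1 // => i _; have := none i; case: (s i).
rewrite (bigD1 i) //=.
under eq_bigr do rewrite -[grid_haar _ _ _ _]mul1r.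
(* The mean is the inner product with the constant 1, itself the function of order 0. *)
have E n : (n < 2 ^ h)%N -> grid_haar h 0 0 n = 1.
  by move=> nh; rewrite /grid_haar subn0 divn_small //= mulr1.
rewrite (eq_bigr (fun n : 'I_(2 ^ h) => grid_haar h 0 0 n * grid_haar h (a i) (s i) n)); last first.
  by move=> n _; rewrite E.
by rewrite grid_haar_orth ?mul0r //; apply/eqP => -[_ e]; rewrite -e in si.
Qed.

(** The squared norm, which for orders at most [h] is also the measure of the support. *)
Definition haar_norm K : R := (\sum_(q : gridT) haar K (gpt q) ^+ 2) / #|{: gridT}|%:R.

Lemma card_gridT : #|{: gridT}|%:R = (2 ^+ h) ^+ d :> R.
Proof. by rewrite card_ffun !card_ord !natrX. Qed.

Lemma haar_norm_ge0 K : 0 <= haar_norm K.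
Proof. by rewrite divr_ge0 // sumr_ge0 // => q _; rewrite sqr_ge0. Qed.

(** In a coordinate of order s the support has length at most 2^(1-s), whence the product
    2^(d-o). *)
Lemma haar_norm_le K o : haar_set R 1 h%:Z K -> haar_order K = o%:Z ->
  haar_norm K * 2 ^+ o <= 2 ^+ d.
Proof.
move=> /haar_setP[a [s [_ -> /andP[h0 hs]]]]; rewrite haar_orderE => -[<-].
have sh i : (s i <= h)%N by apply: leq_trans hs; rewrite (bigD1 i) //= leq_addr.
have p : 0 < (2 ^+ h) ^+ d :> R by rewrite !exprn_gt0.
rewrite /haar_norm card_gridT mulrAC ler_pdivrMr //.
rewrite (eq_bigr (fun q : gridT => \prod_(i < d) grid_haar h (a i) (s i) (q i) ^+ 2)); last first.
  by move=> q _; rewrite haar_gpt // -prodrXl.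
rewrite (sum_gridT (fun i n => grid_haar h (a i) (s i) n ^+ 2)).
rewrite expr_sum -big_split /= -exprMn -[d in leRHS]card_ord -prodr_const.
apply: ler_prod => i _; rewrite mulr_suml; apply/andP; split; last exact: grid_haar_mass.
by apply: sumr_ge0 => n _; rewrite mulr_ge0 ?sqr_ge0 ?exprn_ge0.
Qed.

Lemma haar_norm1 K (x : d.-tuple R) : haar_set R 1 h%:Z K -> in_cube x ->
  haar K x ^+ 2 <= 1 /\ haar K x ^+ 3 = haar K x.
Proof.
move=> /haar_setP[a [s [_ -> _]]] hx; rewrite haarE //.
under eq_bigr do idtac.
rewrite prodrXr; case: [forall i, _]; rewrite ?mul0r ?expr0n //= mul1r.
by rewrite [_ ^+ 3]exprS !sqrr_sign mulr1.
Qed.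

End Grid.

(** * Exponential moments of the pairings *)

Section Density.
Context {R : realType}.
Variables (d : nat) (beta : R).
Hypothesis (d0 : (0 < d)%N) (beta01 : 0 < beta <= 1).

Lemma haar_set_sub h h' : (h' <= h)%N ->
  haar_set R 1 h'%:Z `<=` (haar_set R 1 h%:Z : set (d.-tuple _)).
Proof.
move=> hh K /haar_setP[a [s [h1 h2 /andP[h3 h4]]]]; apply/haar_setP.
by exists a, s; split; rewrite // h3 (leq_trans h4).
Qed.

Lemma pairing_opp (nu : seq (d.-tuple R)) H :
  pairing nu (fun y => - H y) = - pairing nu H.
Proof. by rewrite /pairing sumrN. Qed.

(** Exactly [W] Haar functions do not vanish at [x], and each contributes at most beta / 2W in
    absolute value. *)
Lemma haar_density_bound n nu (x : d.-tuple R) : in_cube x ->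
  `|haar_density beta n nu x - 1| <= beta / 2.
Proof.
move=> hx; rewrite /haar_density haar_sum // addrC addKr.
set W := haar_weight _ _; have /andP[b0 _] := beta01.
have hS : `|\sum_(v <- orders d (trunc_log 2 n) | (0 < sumn v)%N)
    Num.sg (pairing nu (fun y => - haar (haar_at v x) y)) * haar_sgn v x| <= W%:R.
  apply: le_trans (ler_norm_sum _ _ _) _.
  rewrite /W -size_orders_pos // -big_filter -sum1_size natr_sum.
  apply: ler_sum => v _.
  rewrite normrM /haar_sgn prodrXr normr_sign mulr1 normr_sg.
  by case: (_ == 0); rewrite ?ler01.
rewrite normrM ger0_norm; last first.
  by rewrite divr_ge0 ?mulr_ge0 ?(ltW b0).
apply: le_trans (ler_wpM2l _ hS) _; first by rewrite divr_ge0 ?mulr_ge0 ?(ltW b0).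
(* For [W = 0] the quotient is 0, by the convention on the inverse of 0. *)
have [->|W0] := eqVneq W 0%N; first by rewrite !mulr0 divr_ge0 // ltW.
by rewrite invfM mulrA divfK // pnatr_eq0.
Qed.

Variable h : nat.

Local Notation Q := (gridT d h).
Local Notation gpt := (@gpt R d h).
Local Notation cell := (@cell R d h).

Lemma pairing_cell nu K : (forall z, z \in nu -> in_cube z) ->
  haar_set R 1 h%:Z K ->
  pairing (map gpt (map cell nu)) (haar K) = pairing nu (haar K).
Proof.
move=> hnu hK; rewrite /pairing !big_map big_seq [RHS]big_seq.
by apply: eq_bigr => z hz; rewrite haar_gpt_cell //; apply: hnu.
Qed.

(** This makes the cells of the samples an autonomous process: the density sees the past and the new
    point only through their cells. *)
Lemma density_cell n nu (x : d.-tuple R) : (trunc_log 2 n <= h)%N ->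
  (forall z, z \in nu -> in_cube z) -> in_cube x ->
  haar_density beta n (map gpt (map cell nu)) (gpt (cell x))
  = haar_density beta n nu x.
Proof.
move=> nh hnu hx; rewrite /haar_density; congr (1 + _ * _).
apply: eq_fsbigr => K /set_mem /(haar_set_sub nh) hK.
by rewrite !pairing_opp pairing_cell // haar_gpt_cell.
Qed.

Lemma density_mean n nu : (trunc_log 2 n <= h)%N ->
  \sum_(q : Q) haar_density beta n nu (gpt q) = #|{: Q}|%:R.
Proof.
move=> nh; have [r [ru hr _]] := @haar_set_seq R d (trunc_log 2 n).
rewrite /haar_density big_split /= sumr_const -mulr_sumr.
rewrite hr; under eq_bigr do rewrite -fsbig_seq //.
rewrite exchange_big /= big_seq big1 ?mulr0 ?addr0 // => K Kr.
rewrite -mulr_sumr haar_mean0 ?mulr0 //.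
by apply: (haar_set_sub nh); rewrite hr.
Qed.

(** Orthogonality keeps only the term of [K], if it is present at time [n]: this is the drift,
    directed against the sign of the pairing. *)
Lemma density_haar n nu K : (trunc_log 2 n <= h)%N -> haar_set R 1 h%:Z K ->
  \sum_(q : Q) haar_density beta n nu (gpt q) * haar K (gpt q) =
  if `[< haar_set R 1 (trunc_log 2 n)%:Z K >] then
    beta / (2 * (haar_weight d (trunc_log 2 n))%:R)
    * Num.sg (- pairing nu (haar K)) * \sum_(q : Q) haar K (gpt q) ^+ 2
  else 0.
Proof.
move=> nh hK; have [r [ru hr _]] := @haar_set_seq R d (trunc_log 2 n).
have rK K' : K' \in r -> haar_set R 1 h%:Z K'.
  by move=> h'; apply: (haar_set_sub nh); rewrite hr.
rewrite /haar_density hr; under eq_bigr do rewrite -fsbig_seq // mulrDl mul1r -mulrA mulr_suml.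
rewrite big_split /= haar_mean0 // add0r -mulr_sumr exchange_big /=.
have E K' : K' \in r -> K' != K ->
    \sum_(q : Q) Num.sg (pairing nu (fun y => - haar K' y)) * haar K' (gpt q) * haar K (gpt q) = 0.
  move=> K'r ne; under eq_bigr do rewrite -mulrA.
  by rewrite -mulr_sumr haar_orth ?mulr0 //; apply: rK.
case: asboolP => [Kr|Kr].
  rewrite (bigD1_seq K) //= [X in _ + X]big_seq_cond [X in _ + X]big1 ?addr0; last first.
    by move=> K' /andP[K'r ne]; apply: E.
  rewrite pairing_opp -[RHS]mulrA; congr (_ * _).
  by rewrite [RHS]mulr_sumr; apply: eq_bigr => q _; rewrite -mulrA -expr2.
rewrite big_seq big1 ?mulr0 // => K' K'r; apply: E => //.
by apply/eqP => e; rewrite e in K'r.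
Qed.

End Density.

Section ExponentialMoment.
Context {R : realType}.
Variables (d : nat) (beta : R) (h : nat).
Hypothesis (d0 : (0 < d)%N) (beta01 : 0 < beta <= 1).

Local Notation Q := (gridT d h).
Local Notation gpt := (@gpt R d h).
Local Notation W := (haar_weight d h).

(* The transition operator of the chain of the cells of the samples. *)
Definition step (F : seq Q -> R) (z : seq Q) : R :=
  (\sum_(q : Q) haar_density beta (size z).+1 (map gpt z) (gpt q) * F (rcons z q))
  / #|{: Q}|%:R.

Definition cosh2 (theta : R) K (z : seq Q) : R :=
  expR (theta * pairing (map gpt z) (haar K)) + expR (- (theta * pairing (map gpt z) (haar K))).

Lemma card_gridT_gt0 : 0 < #|{: Q}|%:R :> R.
Proof. by rewrite card_gridT !exprn_gt0. Qed.

(** The hypothesis says that e is -1, 0 or 1, where the exponential equals its quadratic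
    interpolation, with coefficients sinh t and cosh t - 1. *)
Lemma expR_sign (t e : R) : e ^+ 3 = e ->
  expR (t * e) = 1 + e * ((expR t - expR (- t)) / 2) + e ^+ 2 * ((expR t + expR (- t)) / 2 - 1).
Proof.
move=> e3; have : (e == 0) || (e == 1) || (e == -1).
  rewrite -subr_eq0 -[e == 1]subr_eq0 -[e == -1]subr_eq0 opprK -!mulf_eq0.
  by apply/eqP; ring: e3.
by case/orP => [/orP[]|] /eqP ->; rewrite ?mulr0 ?mulr1 ?mulrN1 ?expR0; field.
Qed.

Lemma trunc_log_le n : (n < 2 ^ h.+1)%N -> (trunc_log 2 n <= h)%N.
Proof.
case: n => [|n] nh; first by rewrite trunc_log0.
rewrite -ltnS -(@ltn_exp2l 2) //; apply: leq_ltn_trans nh.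
exact: trunc_logP.
Qed.

Lemma density_ge0 n nu (x : d.-tuple R) : in_cube x -> 0 <= haar_density beta n nu x.
Proof.
move=> hx; have := haar_density_bound d0 beta01 n nu hx.
have /andP[b0 b1] := beta01.
by rewrite ler_norml => /andP[h1 _]; lra.
Qed.

Lemma density_le n nu (x : d.-tuple R) : in_cube x -> haar_density beta n nu x <= 3 / 2.
Proof.
move=> hx; have := haar_density_bound d0 beta01 n nu hx.
have /andP[b0 b1] := beta01.
by rewrite ler_norml => /andP[_ h1]; lra.
Qed.

(** The one-step bounds depend on the time, so the comparison is required only for words of the
    length reached by the innermost step. *)
Lemma iter_step_mono n F G z : (forall z', size z' = (n + size z)%N -> F z' <= G z') ->
  iter n step F z <= iter n step G z.
Proof.
elim: n z => [|n IH] z FG /=; first exact: FG.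
rewrite /step ler_pM2r ?invr_gt0 ?card_gridT_gt0 //; apply: ler_sum => q _.
apply: ler_wpM2l; first by apply: density_ge0; apply: gpt_cube.
by apply: IH => z' hz'; apply: FG; rewrite hz' size_rcons addnS.
Qed.

(** The density has mean 1, so constants pass through the operator unchanged. *)
Lemma iter_step_affine n F z (a b : R) : (n + size z < 2 ^ h.+1)%N ->
  iter n step (fun z => a * F z + b) z = a * iter n step F z + b.
Proof.
elim: n z => [|n IH] z nz //=; rewrite /step.
under eq_bigr => q _ do rewrite IH ?size_rcons ?addnS // mulrDr mulrCA.
rewrite big_split /= -mulr_sumr -mulr_suml density_mean; last first.
  by apply: trunc_log_le; apply: leq_ltn_trans nz; lia.
by rewrite mulrDl -mulrA mulrAC divff ?mul1r // gt_eqF // card_gridT_gt0.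
Qed.

(** The first bound keeps [theta] at most 1/8; the second absorbs the factor 2^d of [haar_norm_le]
    in the phase before activation. *)
Hypotheses (W2 : (2 <= W)%N) (Wd : (2 ^ d <= W ^ 2)%N).

(** Half of beta / 2W, so that the second-order term costs at most half of the contraction given by
    the drift. *)
Let theta : R := beta / (4 * W%:R).
Let S := (expR theta - expR (- theta)) / 2.
Let C := (expR theta + expR (- theta)) / 2 - 1.

Let W0 : 0 < W%:R :> R. Proof. by rewrite ltr0n; apply: leq_trans W2. Qed.

Let theta_gt0 : 0 < theta.
Proof. by have /andP[b0 _] := beta01; rewrite divr_gt0 ?mulr_gt0. Qed.

Let theta_le : theta <= 1 / 8.
Proof.
have /andP[_ b1] := beta01; rewrite ler_pdivrMr ?mulr_gt0 //.
have : 2 <= W%:R :> R by rewrite ler_nat.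
by lra.
Qed.

(** The upper bound comes from e^-theta >= 1 - theta: as theta <= 1/8, e^theta <= 1 / (1 - theta) <=
    1 + 8 theta / 7. *)
Let expR_theta : [/\ 1 + theta <= expR theta, expR theta <= 1 + 8 / 7 * theta,
  0 <= expR (- theta) & expR theta * expR (- theta) = 1].
Proof.
split; [exact: expR_ge1Dx| |exact: expR_ge0|by rewrite -expRD subrr expR0].
have h1 : 1 - theta <= expR (- theta) by apply: expR_ge1Dx.
have h2 : expR theta * expR (- theta) = 1 by rewrite -expRD subrr expR0.
have h3 : 0 < expR theta by apply: expR_gt0.
have t0 := theta_gt0; have t1 := theta_le.
nra.
Qed.

Let S_bounds : theta / 2 <= S <= 8 / 7 * theta.
Proof.
have [h1 h2 h3 h4] := expR_theta; have t0 := theta_gt0; have t1 := theta_le.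
rewrite /S; apply/andP; split; last by nra.
have : expR (- theta) <= 1 by nra.
by lra.
Qed.

(** Here [S] is sinh theta and [C] is cosh theta - 1. With e = e^theta and f = 1 / e, C is half of
    (e - 1) times (e - 1) f; the first factor is at most 8 theta / 7, and the second is at most [S]
    because f <= 1. *)
Let C_bounds : 0 <= C <= 4 / 7 * theta * S.
Proof.
have [h1 h2 h3 h4] := expR_theta; have t0 := theta_gt0; have t1 := theta_le.
rewrite /C /S; move: (expR theta) (expR (- theta)) h1 h2 h3 h4 => e f h1 h2 h3 h4.
have fE : f = 1 - (e - 1) * f by rewrite mulrBl h4; ring.
have CE : (e + f) / 2 - 1 = (e - 1) * ((e - 1) * f) / 2 by nra.
have f0 : 0 <= (e - 1) * f by apply: mulr_ge0 => //; lra.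
have SE : (e - f) / 2 = ((e - 1) + (e - 1) * f) / 2 by nra.
rewrite CE SE; apply/andP; split; first by nra.
have : (e - 1) * ((e - 1) * f) <= 8 / 7 * theta * ((e - 1) * f) by nra.
have : (e - 1) * f <= e - 1 by nra.
nra.
Qed.

Lemma cosh2_rcons K z q : haar_set R 1 h%:Z K ->
  cosh2 theta K (rcons z q) = cosh2 theta K z
  + (expR (theta * pairing (map gpt z) (haar K))
     - expR (- (theta * pairing (map gpt z) (haar K)))) * S * haar K (gpt q)
  + cosh2 theta K z * C * haar K (gpt q) ^+ 2.
Proof.
move=> hK; rewrite /cosh2 map_rcons /pairing -cats1 big_cat big_seq1 /=.
set Y := \sum_(_ <- _) _; set H := haar K (gpt q).
have [_] := haar_norm1 hK (gpt_cube q : in_cube (gpt q)); rewrite -/H => H3.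
have H3' : (- H) ^+ 3 = - H by rewrite -[in RHS]H3; ring.
rewrite mulrDr opprD !expRD -[- (theta * H)]mulrN (expR_sign _ H3) (expR_sign _ H3').
rewrite -/S -/C sqrrN; ring.
Qed.

(** The first-order term keeps the exact mean of the density against [K]; in the second-order term
    the density is replaced by its bound 3/2. *)
Lemma step_cosh2 K z : ((size z).+1 < 2 ^ h.+1)%N -> haar_set R 1 h%:Z K ->
  step (cosh2 theta K) z <= cosh2 theta K z
  + (expR (theta * pairing (map gpt z) (haar K))
     - expR (- (theta * pairing (map gpt z) (haar K)))) * S
    * ((\sum_(q : Q) haar_density beta (size z).+1 (map gpt z) (gpt q) * haar K (gpt q)) / #|{: Q}|%:R)
  + cosh2 theta K z * C * (3 / 2 * haar_norm h K).
Proof.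
move=> zh hK; have hn := trunc_log_le zh; rewrite /step.
have VC0 : 0 <= cosh2 theta K z * C.
  by apply: mulr_ge0; [rewrite addr_ge0 ?expR_ge0|case/andP: C_bounds].
under eq_bigr do rewrite cosh2_rcons //.
set T := 3 / 2 * _; have TE : T = 3 / 2 * haar_norm h K by []; clearbody T.
move: VC0; move: (cosh2 theta K z) (_ * S) (_ * C) => V DS VC VC0.
under eq_bigr do rewrite !mulrDr.
rewrite !big_split /= -mulr_suml density_mean // !mulrDl.
have N0 := card_gridT_gt0.
rewrite mulrAC divff ?mul1r ?gt_eqF // -!addrA lerD2l; apply: lerD.
  rewrite le_eqVlt; apply/orP; left; apply/eqP.
  under eq_bigr do rewrite mulrCA.
  by rewrite -mulr_sumr mulrA.
under eq_bigr do rewrite mulrCA.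
rewrite -mulr_sumr -mulrA; apply: ler_wpM2l => //.
rewrite TE /haar_norm mulrA ler_pM2r ?invr_gt0 // mulr_sumr; apply: ler_sum => q _.
by apply: ler_wpM2r; [apply: sqr_ge0|apply/density_le/gpt_cube].
Qed.

Lemma haar_norm_le1 K : haar_set R 1 h%:Z K -> @haar_norm R d h K <= 1.
Proof.
move=> hK; rewrite ler_pdivrMr ?card_gridT_gt0 // mul1r -sum1_card natr_sum.
by apply: ler_sum => q _; have [] := haar_norm1 hK (gpt_cube q : in_cube (gpt q)).
Qed.

(** Of two positive numbers with product 1 the smaller is at most 1, and their distance is their sum
    minus twice the smaller. *)
Lemma sinh_cosh_le (y : R) : expR y + expR (- y) - 2 <= `|expR y - expR (- y)|.
Proof.
have e1 : expR y * expR (- y) = 1 by rewrite -expRD subrr expR0.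
have e2 := expR_gt0 y; have e3 := expR_gt0 (- y).
move: e1 e2 e3; move: (expR y) (expR (- y)) => a b ab a0 b0.
by rewrite ler_normr; have [ab'|ab'] := leP b a; apply/orP; [left|right]; nra.
Qed.

(** With V the value of [cosh2], the drift removes at least 2x (V - 2), since the weight at the
    current time is at most [W], and the second-order term returns at most x V. The resulting affine
    map fixes 4. *)
Lemma step_late K z : ((size z).+1 < 2 ^ h.+1)%N -> haar_set R 1 h%:Z K ->
  haar_set R 1 (trunc_log 2 (size z).+1)%:Z K ->
  forall x, x = beta / (2 * W%:R) * S * haar_norm h K / 2 ->
  step (cosh2 theta K) z <= (1 - x) * cosh2 theta K z + 4 * x.
Proof.
move=> zh hK hKn x xE; apply: le_trans (step_cosh2 zh hK) _.
have hn := trunc_log_le zh; rewrite density_haar // asboolT //.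
set hz := trunc_log _ _ in hKn hn *; set Wz : R := (haar_weight d hz)%:R.
have Wz0 : 0 < Wz.
  rewrite ltr0n haar_weightE // subn_gt0.
  have /haar_setP[a [s [_ _ /andP[h1 h2]]]] := hKn.
  have hz0 : (0 < hz)%N by apply: leq_trans h2.
  have : ('C(1 + d, d) <= 'C(hz + d, d))%N by apply: leq_bin2l; rewrite leq_add2r.
  by rewrite add1n binSn; apply: leq_trans; rewrite ltnS.
have WzW : Wz <= W%:R.
  rewrite ler_nat !haar_weightE //; apply: leq_sub2r; apply: leq_bin2l.
  by rewrite leq_add2r.
set Y := pairing _ _; set p := haar_norm h K; set V := cosh2 _ _ _.
have -> : beta / (2 * Wz) * Num.sg (- Y) * (\sum_(q : Q) haar K (gpt q) ^+ 2) / #|{: Q}|%:R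
    = beta / (2 * Wz) * (Num.sg (- Y) * p) by rewrite -!mulrA.
have /andP[s0 s1] := S_bounds; have /andP[c0 c1] := C_bounds.
have t0 := theta_gt0.
have /andP[b0 b1] := beta01.
have p0 : 0 <= p by apply: haar_norm_ge0.
have V0 : 0 <= V by rewrite addr_ge0 ?expR_ge0.
have S0 : 0 <= S by lra.
set D := expR (theta * Y) - _.
have DV : V - 2 <= `|D| by apply: sinh_cosh_le.
(* [D] has the sign of the pairing, and the drift the opposite one. *)
have Dsg : D * Num.sg (- Y) = - `|D|.
  rewrite sgrN mulrN; congr (- _); rewrite /D.
  have [Y0|Y0|->] := ltgtP Y 0; last by rewrite mulr0 oppr0 subrr normr0 mul0r.
    rewrite ltr0_sg // mulrN1 ler0_norm // subr_le0 ler_expR.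
    by rewrite lerNr -mulrN ler_pM2l //; lra.
  rewrite gtr0_sg // mulr1 ger0_norm // subr_ge0 ler_expR.
  by rewrite lerNl -mulrN ler_pM2l //; lra.
have dW : beta / (2 * W%:R) <= beta / (2 * Wz).
  by rewrite ler_pM2l // lef_pV2 ?posrE ?mulr_gt0 // ler_pM2l.
have th : theta = beta / (2 * W%:R) / 2.
  by rewrite /theta; field; rewrite gt_eqF.
move: dW th xE; set del := beta / (2 * W%:R); set dz := beta / (2 * Wz) => dW th xE.
have del0 : 0 <= del by rewrite divr_ge0 ?mulr_ge0 // ltW.
have h1 : D * S * (dz * (Num.sg (- Y) * p)) <= - (V - 2) * (S * (del * p)).
  rewrite (_ : _ * _ = - `|D| * (S * (dz * p))); last by rewrite -Dsg; ring.
  rewrite !mulNr lerN2.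
  apply: (@le_trans _ _ (`|D| * (S * (del * p)))).
    by apply: ler_wpM2r => //; do 2!apply: mulr_ge0 => //.
  by do 2!(apply: ler_wpM2l => //); apply: ler_wpM2r.
have h2 : V * C * (3 / 2 * p) <= V * (S * (del * p)) / 2.
  rewrite (_ : V * C * _ = 3 / 2 * (V * p * C)); last by ring.
  have : V * p * C <= V * p * (4 / 7 * theta * S) by apply: ler_wpM2l => //; apply: mulr_ge0.
  have : 0 <= V * p * theta * S by apply: mulr_ge0 => //; apply: mulr_ge0; [exact: mulr_ge0|exact: ltW].
  rewrite th; nra.
rewrite xE -/p; nra.
Qed.

Lemma step_early K z : ((size z).+1 < 2 ^ h.+1)%N -> haar_set R 1 h%:Z K ->
  ~ haar_set R 1 (trunc_log 2 (size z).+1)%:Z K ->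
  step (cosh2 theta K) z <= (1 + C * (3 / 2 * haar_norm h K)) * cosh2 theta K z + 0.
Proof.
move=> zh hK hKn; apply: le_trans (step_cosh2 zh hK) _.
have hn := trunc_log_le zh; rewrite density_haar // asboolF // mul0r mulr0 addr0.
by rewrite addr0 [leRHS]mulrDl mul1r lerD2l -mulrA mulrC.
Qed.

(** The mean starts from 2. Before activation a step adds at most 6Cp, as the mean is at most 4 and
    grows at the rate 3Cp / 2; afterwards the affine bound preserves 4. The linear bound is carried
    along because it ensures that 4 is not exceeded before activation. *)
Lemma cosh2_moment K n : haar_set R 1 h%:Z K -> (n < 2 ^ h.+1)%N ->
  iter n step (cosh2 theta K) [::] <= 4.
Proof.
move=> hK; have /haar_setP[a [s [adm KE /andP[h0 hs]]]] := hK.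
have oE := haar_orderE a s; rewrite -KE in oE.
set o := (\sum_(i < d) s i)%N in h0 hs oE.
have /andP[s0 s1] := S_bounds; have /andP[c0 c1] := C_bounds.
have t0 := theta_gt0; have t1 := theta_le.
set p : R := haar_norm h K.
have p0 : 0 <= p by apply: haar_norm_ge0.
have p1 : p <= 1 by apply: haar_norm_le1.
have /andP[b0 b1] := beta01.
(* C <= theta^2 and theta W <= 1/4 give C W^2 <= 1/16, and p 2^o <= 2^d <= W^2: the total growth is
   at most 6/16. *)
have early : 6 * C * p * 2 ^+ o <= 2.
  have po : p * 2 ^+ o <= 2 ^+ d := haar_norm_le hK oE.
  have hW : (2 : R) ^+ d <= W%:R ^+ 2 by rewrite -!natrX ler_nat.
  have tW : theta * W%:R <= 1 / 4.
    rewrite /theta (_ : _ * _ = beta / 4); first by lra.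
    by field; rewrite gt_eqF.
  have tW0 : 0 <= theta * W%:R by rewrite mulr_ge0 // ltW.
  have h1 : C <= theta ^+ 2 by rewrite expr2; nra.
  have h2 : C * W%:R ^+ 2 <= 1 / 16.
    apply: (@le_trans _ _ ((theta * W%:R) ^+ 2)); last by rewrite expr2; nra.
    by rewrite exprMn; apply: ler_wpM2r => //; rewrite exprn_ge0 // ltW.
  have h3 : C * (p * 2 ^+ o) <= C * W%:R ^+ 2.
    by apply: ler_wpM2l => //; apply: le_trans hW.
  have h4 : C * (p * 2 ^+ o) <= 1 / 16 by apply: le_trans h3 h2.
  rewrite (_ : 6 * C * p * 2 ^+ o = 6 * (C * (p * 2 ^+ o))); last by rewrite !mulrA.
  apply: (@le_trans _ _ (6 * (1 / 16))); first by rewrite ler_wpM2l.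
  by lra.
have base : cosh2 theta K [::] = 2.
  by rewrite /cosh2 /pairing big_nil mulr0 oppr0 expR0.
suff H m : (m < 2 ^ h.+1)%N -> iter m step (cosh2 theta K) [::] <= 4 /\
    ((m < 2 ^ o)%N -> iter m step (cosh2 theta K) [::] <= 2 + 6 * C * p * m%:R).
  by move=> /H[].
elim: m => [|m IH] mh.
  by rewrite /= base mulr0 addr0; split=> //; lra.
have [IH1 IH2] := IH (ltnW mh).
(* The last step in time is the innermost application, so the one-step bounds act under the
   operator. *)
rewrite -[iter m.+1 _ _]/(step (iter m step _)) -iterS iterSr.
have [hKm|hKm] := pselect (haar_set R 1 (trunc_log 2 m.+1)%:Z K).
  have om : (2 ^ o <= m.+1)%N.
    have : (o <= trunc_log 2 m.+1)%N by move: hKm => [_ /andP[_]]; rewrite oE lez_nat.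
    by move=> ho; apply: leq_trans (trunc_logP (isT : 1 < 2)%N (isT : 0 < m.+1)%N); rewrite leq_pexp2l.
  split; last by rewrite ltnNge om.
  set x := beta / (2 * W%:R) * S * p / 2.
  have x1 : x <= 1.
    have : beta / (2 * W%:R) <= 1 / 4.
      rewrite ler_pdivrMr ?mulr_gt0 //.
      have : 2 <= W%:R :> R by rewrite ler_nat.
      by lra.
    have del0 : 0 <= beta / (2 * W%:R) by rewrite divr_ge0 ?mulr_ge0 // ltW.
    rewrite /x; move: (beta / _) del0 => e e0 e1.
    have : e * S <= 1 by nra.
    have : 0 <= e * S by rewrite mulr_ge0 //; lra.
    move: (e * S) => f f0 f1; nra.
  apply: (@le_trans _ _ (iter m step (fun z => (1 - x) * cosh2 theta K z + 4 * x) [::])).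
    apply: iter_step_mono => z /=; rewrite addn0 => zm.
    by apply: step_late; rewrite ?zm.
  rewrite iter_step_affine ?addn0 ?(ltnW mh) //; nra.
have mo : (m.+1 < 2 ^ o)%N.
  rewrite ltnNge; apply/negP => om; apply: hKm; split; first by case: hK.
  rewrite oE; apply/andP; split; first by rewrite lez_nat.
  by rewrite lez_nat trunc_log_max.
have IH2' := IH2 (ltnW mo).
have le : iter m step (step (cosh2 theta K)) [::] <= 2 + 6 * C * p * m.+1%:R.
  apply: (@le_trans _ _ (iter m step (fun z => (1 + C * (3 / 2 * p)) * cosh2 theta K z + 0) [::])).
    apply: iter_step_mono => z /=; rewrite addn0 => zm.
    by apply: step_early; rewrite ?zm.
  rewrite iter_step_affine ?addn0 ?(ltnW mh) // -natr1.
  have cp : 0 <= C * p by rewrite mulr_ge0.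
  nra.
split=> //; apply: le_trans le _.
have : 6 * C * p * m.+1%:R <= 6 * C * p * 2 ^+ o.
  by apply: ler_wpM2l; [do 2!apply: mulr_ge0 => //|rewrite -natrX ler_nat ltnW].
by lra.
Qed.

End ExponentialMoment.

(** * The law of the samples *)

Section UniformLaw.
Context {R : realType}.

Lemma uniform_probE (A : set R) : measurable A ->
  uniform_prob (@ltr01 R) A = lebesgue_measure (A `&` `[0, 1]).
Proof.
move=> mA; rewrite /uniform_prob integral_uniform_pdf.
rewrite (eq_integral (fun=> 1%:E)); last first.
  move=> x; rewrite inE => -[_]; rewrite /= in_itv /= /uniform_pdf => ->.
  by rewrite subr0 invr1.
by rewrite integral_cst ?mul1e //; apply: measurableI.
Qed.

Lemma uniform_prob_itvco (a b : R) : 0 <= a -> a <= b -> b <= 1 ->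
  uniform_prob (@ltr01 R) `[a, b[%classic = (b - a)%:E.
Proof.
move=> a0 ab b1; rewrite uniform_probE // setIidl; last first.
  move=> x; rewrite /= !in_itv /= => /andP[h1 h2].
  by rewrite (le_trans a0 h1) (le_trans (ltW h2)).
rewrite lebesgue_measure_itv /= lte_fin -EFinB.
by have [//|ba] := ltP a b; rewrite (le_anti (introT andP (conj ab ba))) subrr.
Qed.

Lemma uniform_prob_itvoy (c : R) : 0 <= c <= 1 ->
  uniform_prob (@ltr01 R) `]c, +oo[%classic = (1 - c)%:E.
Proof.
move=> /andP[c0 c1]; rewrite uniform_probE //.
rewrite (_ : _ `&` _ = `]c, 1]%classic); last first.
  apply/seteqP; split => x; rewrite /= !in_itv /= ?andbT; first by move=> [-> /andP[_ ->]].
  by move=> /andP[h1 ->]; rewrite h1 (le_trans c0 (ltW h1)).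
rewrite lebesgue_measure_itv /= lte_fin -EFinB.
by have [//|ba] := ltP c 1; rewrite (le_anti (introT andP (conj c1 ba))) subrr.
Qed.

End UniformLaw.

Section Decisions.
Context {R : realType} {d : nat}.
Implicit Types (f : @strategy R d) (x : nat -> d.-tuple R) (u : nat -> R).

Lemma size_decisions f x u n : size (decisions f x u n) = n.
Proof. by elim: n => //= n IH; rewrite size_rcons IH. Qed.

Lemma size_selected x chi : size (selected x chi) = size chi.
Proof. by rewrite size_map size_iota. Qed.

Lemma selected_rcons x chi (b : bool) :
  selected x (rcons chi b) = rcons (selected x chi) (x (size chi + count id chi + b)%N).
Proof.
rewrite /selected size_rcons -[(size chi).+1]addn1 iotaD map_cat cats1 add0n /=.
congr rcons; last first.
  by congr x; rewrite take_oversize ?size_rcons // -cats1 count_cat /= addn0 addnA.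
apply/eq_in_map => i; rewrite mem_iota add0n => /andP[_ hi].
by rewrite -cats1 takel_cat.
Qed.

Lemma selected_cube x chi z : (forall m, in_cube (x m)) ->
  z \in selected x chi -> in_cube z.
Proof. by move=> hx /mapP[i _ ->]. Qed.

End Decisions.

Section Law.
Context {disp : measure_display} {T : measurableType disp} {R : realType}.
Variables (P : probability T R) (d : nat) (beta : R) (h : nat).
Variables (X : nat -> {RV P >-> d.-tuple R}) (U : nat -> {RV P >-> R}).
Hypothesis XU : thinning_randomness X U.
Hypothesis (d0 : (0 < d)%N) (beta01 : 0 < beta <= 1).

Local Notation Q := (gridT d h).
Local Notation gpt := (@gpt R d h).
Local Notation cell := (@cell R d h).

Definition Pr (A : set T) : R := fine (P A).

Lemma PrE A : measurable A -> P A = (Pr A)%:E.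
Proof. by move=> mA; rewrite fineK // fin_num_measure. Qed.

Lemma Pr_ge0 A : 0 <= Pr A.
Proof. by apply: fine_ge0. Qed.

Lemma Pr_bigcup (I : finType) (F : I -> set T) : (forall i, measurable (F i)) ->
  trivIset setT F -> Pr (\bigcup_i F i) = \sum_i Pr (F i).
Proof.
move=> mF tF; rewrite /Pr measure_fin_bigcup //; last exact: finite_finset.
rewrite (fsbigE (index_enum I)) ?index_enum_uniq //; last first.
  by move=> i _; rewrite mem_index_enum.
rewrite (eq_bigl xpredT); last by move=> i; rewrite in_setT.
rewrite (eq_bigr (fun i => (Pr (F i))%:E)) ?sumEFin // => i _.
exact: PrE.
Qed.

Let events (j : nat + nat) : set (set T) :=
  match j with inl m => events_of (X m) | inr n => events_of (U n) end.

Let fresh (k n : nat) (j : nat + nat) : bool :=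
  match j with inl m => (k <= m)%N | inr i => (n <= i)%N end.

Lemma events_measurable j A : events j A -> measurable A.
Proof.
case: j => [m|m] [B mB <-]; rewrite setTI.
  exact: (measurable_funPTI (X m)).
exact: (measurable_funPTI (U m)).
Qed.

(* [G] is independent of the points from the [k]-th and of the auxiliary
   numbers from the [n]-th on. *)
Definition past (k n : nat) (G : set T) : Prop := measurable G /\
  forall (s : seq (nat + nat)%type) (E : nat + nat -> set T), uniq s ->
    (forall j, j \in s -> fresh k n j /\ events j (E j)) ->
    Pr (G `&` \bigcap_(j in [set` s]) E j) = Pr G * \prod_(j <- s) Pr (E j).

Lemma past_setT : past 0 0 setT.
Proof.
split=> // s E us hs; have [_ _ _ ind] := XU.
rewrite setTI /Pr ind //; last first.
  by move=> j /hs[_]; case: j.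
rewrite probability_setT mul1r.
rewrite (_ : (\prod_(j <- s) P (E j))%E = (\prod_(j <- s) Pr (E j))%:E) // -prodEFin.
rewrite big_seq [RHS]big_seq; apply: eq_bigr => j js.
by apply: PrE; apply: (events_measurable (hs j js).2).
Qed.

(** The variable [j0] is spent: its event joins the past, and independence is kept for the other
    fresh indices only. The product formula for a family is the former one for that family with [j0]
    added. *)
Lemma past_cap k n k' n' G j0 E0 : past k n G -> fresh k n j0 -> events j0 E0 ->
  (forall j, fresh k' n' j -> fresh k n j && (j != j0)) ->
  past k' n' (G `&` E0) /\ Pr (G `&` E0) = Pr G * Pr E0.
Proof.
move=> [mG hG] fr0 ev0 hfr.
have eq : Pr (G `&` E0) = Pr G * Pr E0.
  have := hG [:: j0] (fun=> E0) isT; rewrite bigcap_seq !big_seq1; apply.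
  by move=> j; rewrite inE => /eqP ->.
split=> //; split; first by apply: measurableI => //; apply: events_measurable ev0.
move=> s E us hs; pose E' j := if j == j0 then E0 else E j.
have j0s : j0 \notin s.
  by apply/negP => /hs[/hfr/andP[_]]; rewrite eqxx.
have := hG (j0 :: s) E'; rewrite /= j0s us bigcap_seq !big_cons /E' eqxx.
have E1 : \big[setI/setT]_(j <- s) E' j = \bigcap_(j in [set` s]) E j.
  rewrite bigcap_seq big_seq [RHS]big_seq; apply: eq_bigr => j js.
  by rewrite /E'; case: eqP => // e; rewrite -e js in j0s.
have E2 : \prod_(j <- s) Pr (E' j) = \prod_(j <- s) Pr (E j).
  rewrite big_seq [RHS]big_seq; apply: eq_bigr => j js.
  by rewrite /E'; case: eqP => // e; rewrite -e js in j0s.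
rewrite E1 E2 setIA eq mulrA; apply=> // j; rewrite inE => /orP[/eqP ->|js].
  by rewrite eqxx.
case: eqP => [->//|_]; have [fj ej] := hs j js; split=> //.
by have /andP[] := hfr j fj.
Qed.

Lemma past_bigcup k n (I : finType) (F : I -> set T) : (forall i, past k n (F i)) ->
  trivIset setT F -> past k n (\bigcup_i F i).
Proof.
move=> hF tF; have mF i : measurable (F i) by have [] := hF i.
split; first by apply: fin_bigcup_measurable => //; apply: finite_finset.
move=> s E us hs; rewrite setI_bigcupl.
have mE : measurable (\bigcap_(j in [set` s]) E j).
  apply: fin_bigcap_measurable; first exact: finite_seq.
  by move=> j /hs[_]; apply: events_measurable.
rewrite !Pr_bigcup // ?mulr_suml.
- by apply: eq_bigr => i _; have [_] := hF i; apply.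
- by move=> i; apply: measurableI.
- by apply: trivIset_setIr.
Qed.

Lemma cell_event m q : events (inl m) [set w | cell (X m w) = q]
  /\ Pr [set w | cell (X m w) = q] = #|{: Q}|%:R^-1.
Proof.
have [cube unif _ _] := XU.
pose A i := `[(q i)%:R / 2 ^+ h, (q i).+1%:R / 2 ^+ h[%classic : set R.
pose B := [set x : d.-tuple R | forall i, A i (tnth x i)].
have mA i : measurable (A i) by apply: measurable_itv.
have mB : measurable B.
  rewrite (_ : B = \bigcap_(i in [set: 'I_d]) ((@tnth _ _)^~ i @^-1` A i)).
    apply: fin_bigcap_measurable; first exact: finite_finset.
    move=> i _; rewrite -[X in measurable X]setTI; apply: measurable_tnth => //.
  by apply/seteqP; split => [x hx i _|x hx i]; [apply: hx|apply: (hx i)].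
have E : [set w | cell (X m w) = q] = X m @^-1` B.
  have p : 0 < (2 : R) ^+ h by rewrite exprn_gt0.
  apply/seteqP; split => w /=; rewrite /B /A /=.
    move=> <- i; have := cellE h i (cube m w); rewrite in_itv /= => ->.
    rewrite ler_pdivrMr // ltr_pdivlMr // ![_ * 2 ^+ h]mulrC.
    by apply: dfloor_itv; case/andP: (cube m w i).
  move=> hB; apply/ffunP => i; apply: val_inj; rewrite /= cellE //.
  apply/eqP; rewrite dfloor_eq; last by case/andP: (cube m w i).
  by have := hB i; rewrite in_itv /= ler_pdivrMr // ltr_pdivlMr // ![_ * 2 ^+ h]mulrC.
split; first by exists B => //; rewrite setTI E.
have := unif m A mA; rewrite /distribution /pushforward -E /Pr => ->.
rewrite (eq_bigr (fun=> (2 ^- h)%:E)); last first.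
  move=> i _; rewrite /A uniform_prob_itvco.
  - by rewrite -mulrBl -natrB // subSnn mul1r.
  - by rewrite divr_ge0 ?exprn_ge0.
  - by rewrite ler_wpM2r ?invr_ge0 ?exprn_ge0 // ler_nat.
  - by rewrite ler_pdivrMr ?exprn_gt0 // mul1r -natrX ler_nat.
by rewrite prodEFin /= prodr_const card_ord card_gridT exprVn.
Qed.

Lemma aux_event i (c : R) : 0 <= c <= 1 ->
  [/\ events (inr i) [set w | c < U i w], events (inr i) [set w | ~~ (c < U i w)],
      Pr [set w | c < U i w] = 1 - c & Pr [set w | ~~ (c < U i w)] = c].
Proof.
move=> hc; have [_ _ unif _] := XU.
have mc : measurable (`]c, +oo[%classic : set R) by apply: measurable_itv.
have E : [set w | c < U i w] = U i @^-1` `]c, +oo[%classic.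
  by apply/seteqP; split => w; rewrite /= in_itv /= andbT.
have EC : [set w | ~~ (c < U i w)] = ~` [set w | c < U i w].
  by apply/seteqP; split => w /= /negP.
have ev : events (inr i) [set w | c < U i w] by exists `]c, +oo[%classic => //; rewrite setTI E.
have mE := events_measurable ev.
have pE : P [set w | c < U i w] = (1 - c)%:E.
  by rewrite E; have := unif i _ mc; rewrite /distribution /pushforward => ->; apply: uniform_prob_itvoy.
split=> //; last 2 first.
- by rewrite /Pr pE.
- by rewrite EC /Pr probability_setC // pE -EFinB /= subKr.
- exists (~` `]c, +oo[%classic); first exact: measurableC.
  by rewrite setTI EC E.
Qed.

Local Notation xs w := (fun m => X m w).
Local Notation us w := (fun m => U m w).

(** The decisions are kept together with the cells because they tell which points of the sequence
    have been consumed, hence which are still fresh. *)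
Definition history n (chi : seq bool) (z : seq Q) : set T :=
  [set w | decisions (haar_strategy beta) (xs w) (us w) n = chi
           /\ map cell (selected (xs w) chi) = z].

Definition cell_strategy (z : seq Q) (q : Q) : R :=
  haar_density beta (size z).+1 (map gpt z) (gpt q) - beta / 2.

Lemma cell_strategy01 z q : 0 <= cell_strategy z q <= 1.
Proof.
have := haar_density_bound d0 beta01 (size z).+1 (map gpt z) (gpt_cube q).
have /andP[b0 b1] := beta01; rewrite /cell_strategy ler_norml => /andP[h1 h2].
by apply/andP; split; lra.
Qed.

(** In the threshold, [density_cell] replaces the samples by their cells, which is possible as long
    as [trunc_log 2 n.+1 <= h]. *)
Lemma history_rcons n chi z b q : size chi = n -> (n.+1 < 2 ^ h.+1)%N ->
  history n.+1 (rcons chi b) (rcons z q) =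
  history n chi z `&` [set w | cell (X (n + count id chi + b)%N w) = q]
  `&` [set w | (cell_strategy z (cell (X (n + count id chi)%N w)) < U n w) = b].
Proof.
move=> sc nh; have [cube _ _ _] := XU.
have fE w : map cell (selected (xs w) chi) = z ->
    haar_strategy beta (selected (xs w) chi) (X (n + count id chi)%N w)
    = cell_strategy z (cell (X (n + count id chi)%N w)).
  move=> zE; rewrite /haar_strategy /cell_strategy -zE size_map size_selected sc.
  rewrite density_cell //; first exact: trunc_log_le nh.
  by move=> y; apply: selected_cube.
apply/seteqP; split => w /=; rewrite /history /= selected_rcons map_rcons sc.
  by move=> [/rcons_inj[-> hb] /rcons_inj[hz hq]]; rewrite -fE.
move=> [[[hd hz] hq] hb]; split; last by rewrite hz hq.
by rewrite hd fE // hb.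
Qed.

Let freshX k n j : fresh k.+1 n j -> fresh k n j && (j != inl k).
Proof.
case: j => m /= => [km|->//]; rewrite (ltnW km) /=.
by apply/eqP => -[e]; rewrite e ltnn in km.
Qed.

Let freshU k n j : fresh k n.+1 j -> fresh k n j && (j != inr n).
Proof.
case: j => m /= => [->//|km]; rewrite (ltnW km) /=.
by apply/eqP => -[e]; rewrite e ltnn in km.
Qed.

(** An acceptance spends one point and one auxiliary number; once the cell is known to be [q], the
    threshold is a constant. *)
Lemma history_accept n chi z q : size chi = n -> (n.+1 < 2 ^ h.+1)%N ->
  past (n + count id chi) n (history n chi z) ->
  past (n.+1 + count id chi) n.+1 (history n.+1 (rcons chi false) (rcons z q)) /\
  Pr (history n.+1 (rcons chi false) (rcons z q))
  = Pr (history n chi z) / #|{: Q}|%:R * cell_strategy z q.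
Proof.
move=> sc nh pG; rewrite history_rcons // addn0.
set k := (n + count id chi)%N in pG *.
have [ev1 pr1] := cell_event k q.
have [_ ev2 _ pr2] := aux_event n (cell_strategy01 z q).
have [pA prA] := past_cap pG (leqnn k : fresh k n (inl k)) ev1 (@freshX k n).
have [pB prB] := past_cap pA (leqnn n : fresh k.+1 n (inr n)) ev2 (@freshU k.+1 n).
rewrite [X in past _ _ X](_ : _ = history n chi z `&` [set w | cell (X k w) = q]
    `&` [set w | ~~ (cell_strategy z q < U n w)]); last first.
  apply/seteqP; split => w /=.
    by move=> [[h1 <-] h3]; rewrite h3.
  by move=> [[h1 h2] /negbTE h3]; rewrite h2.
split; first exact: pB.
rewrite (_ : _ `&` _ = history n chi z `&` [set w | cell (X k w) = q]
    `&` [set w | ~~ (cell_strategy z q < U n w)]); last first.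
  apply/seteqP; split => w /=.
    by move=> [[h1 <-] h3]; rewrite h3.
  by move=> [[h1 h2] /negbTE h3]; rewrite h2.
by rewrite prB prA pr1 pr2.
Qed.

(** A rejection spends two points. The event is split along the cell of the rejected one, which
    makes the threshold constant on each part, and the cell of the replacement is uniform. *)
Lemma history_reject n chi z q : size chi = n -> (n.+1 < 2 ^ h.+1)%N ->
  past (n + count id chi) n (history n chi z) ->
  past (n.+2 + count id chi) n.+1 (history n.+1 (rcons chi true) (rcons z q)) /\
  Pr (history n.+1 (rcons chi true) (rcons z q))
  = Pr (history n chi z) / #|{: Q}|%:R
    * ((\sum_(q' : Q) (1 - cell_strategy z q')) / #|{: Q}|%:R).
Proof.
move=> sc nh pG; rewrite history_rcons // addn1.
set k := (n + count id chi)%N in pG *.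
set A := _ `&` _.
have -> : A = \bigcup_(q' : Q) (history n chi z
    `&` [set w | cell (X k w) = q'] `&` [set w | cell (X k.+1 w) = q]
    `&` [set w | cell_strategy z q' < U n w]).
  apply/seteqP; split => w /=.
    by move=> [[h1 h2] h3]; exists (cell (X k w)).
  by move=> [q' _ [[[h1 h2] h3] h4]]; rewrite /A /= h2 h4.
have main q' : past k.+2 n.+1 (history n chi z
    `&` [set w | cell (X k w) = q'] `&` [set w | cell (X k.+1 w) = q]
    `&` [set w | cell_strategy z q' < U n w]) /\
    Pr (history n chi z
    `&` [set w | cell (X k w) = q'] `&` [set w | cell (X k.+1 w) = q]
    `&` [set w | cell_strategy z q' < U n w])
    = Pr (history n chi z) / #|{: Q}|%:R * ((1 - cell_strategy z q') / #|{: Q}|%:R).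
  have [ev1 pr1] := cell_event k q'; have [ev2 pr2] := cell_event k.+1 q.
  have [ev3 _ pr3 _] := aux_event n (cell_strategy01 z q').
  have [p1 e1] := past_cap pG (leqnn k : fresh k n (inl k)) ev1 (@freshX k n).
  have [p2 e2] := past_cap p1 (leqnn k.+1 : fresh k.+1 n (inl k.+1)) ev2 (@freshX k.+1 n).
  have [p3 e3] := past_cap p2 (leqnn n : fresh k.+2 n (inr n)) ev3 (@freshU k.+2 n).
  by split=> //; rewrite e3 e2 e1 pr1 pr2 pr3 -mulrA [X in _ * X]mulrC.
have triv : trivIset [set: Q] (fun q' => history n chi z
    `&` [set w | cell (X k w) = q'] `&` [set w | cell (X k.+1 w) = q]
    `&` [set w | cell_strategy z q' < U n w]).
  by move=> q1 q2 _ _ [w [[[[_ <-] _] _] [[[_ <-] _] _]]].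
split; first by apply: past_bigcup => // q'; have [] := main q'.
rewrite Pr_bigcup //; last by move=> q'; have [[]] := main q'.
by rewrite mulr_suml mulr_sumr; apply: eq_bigr => q' _; have [_ ->] := main q'.
Qed.

Lemma history_past n chi z : size chi = n -> size z = n -> (n < 2 ^ h.+1)%N ->
  past (n + count id chi) n (history n chi z).
Proof.
elim: n chi z => [|n IH] chi z.
  case: chi z => // -[] // _ _ _.
  rewrite (_ : history _ _ _ = setT); first exact: past_setT.
  by apply/seteqP; split.
case/lastP: chi => // chi b; case/lastP: z => // z q.
rewrite !size_rcons => -[sc] [sz] nh.
have {}IH := IH chi z sc sz (ltnW nh).
rewrite -{1}cats1 count_cat /= addn0; case: b.
  rewrite (_ : (n.+1 + (count id chi + true) = n.+2 + count id chi)%N); last by rewrite /=; lia.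
  by have [] := history_reject q sc nh IH.
by rewrite addn0; have [] := history_accept q sc nh IH.
Qed.

Fixpoint words (A : eqType) (s : seq A) n : seq (seq A) :=
  if n is n'.+1 then [seq rcons z q | z <- words s n', q <- s] else [:: [::]].

Lemma mem_words (A : eqType) (s : seq A) n z :
  (z \in words s n) = (size z == n) && all [in s] z.
Proof.
elim: n z => [|n IH] z /=; first by case: z.
apply/allpairsP/idP => [[[z' q] /= [hz hq ->]]|].
  by rewrite size_rcons all_rcons hq eqSS -IH hz.
case/lastP: z => // z q; rewrite size_rcons all_rcons eqSS => /and3P[sz hq hz].
by exists (z, q); rewrite IH sz hz.
Qed.

Lemma sum_words (A : eqType) (s : seq A) n (F : seq A -> R) :
  \sum_(z <- words s n.+1) F z = \sum_(z <- words s n) \sum_(q <- s) F (rcons z q).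
Proof. exact: big_allpairs_dep. Qed.

Definition cell_law n z : R :=
  \sum_(chi <- words [:: false; true] n) Pr (history n chi z).

(** With N cells and density lambda, acceptance in [q] has conditional probability (lambda(q) - beta
    / 2) / N. As lambda has mean 1, a rejection has probability beta / 2, and the replacement then
    falls in [q] with probability 1 / N: the sum is lambda(q) / N. *)
Lemma cell_law_rcons n z q : size z = n -> (n.+1 < 2 ^ h.+1)%N ->
  cell_law n.+1 (rcons z q) = cell_law n z *
    (haar_density beta n.+1 (map gpt z) (gpt q) / #|{: Q}|%:R).
Proof.
move=> sz nh; rewrite /cell_law sum_words mulr_suml.
rewrite big_seq [RHS]big_seq; apply: eq_bigr => chi.
rewrite mem_words => /andP[/eqP sc _]; rewrite !big_cons big_nil addr0.
have ph := history_past sc sz (ltnW nh).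
have [_ ->] := history_accept q sc nh ph; have [_ ->] := history_reject q sc nh ph.
rewrite -mulrDr -mulrA; congr (_ * _); rewrite mulrC; congr (_ / _).
have N0 : #|{: Q}|%:R != 0 :> R by rewrite gt_eqF // card_gridT_gt0.
have E (c : R) : \sum_(q' : Q) c = #|{: Q}|%:R * c by rewrite sumr_const mulr_natl.
rewrite /cell_strategy sumrB sumrB density_mean ?sz; last exact: trunc_log_le nh.
by rewrite !E mulr1 opprB addrCA subrr addr0 [X in _ + X]mulrC mulKf // subrK.
Qed.

(** A backward equation: integrating out the last cell applies [step] to the function. *)
Lemma cell_law_step n (F : seq Q -> R) : (n < 2 ^ h.+1)%N ->
  \sum_(z <- words (enum {: Q}) n) cell_law n z * F z = iter n (@step R d beta h) F [::].
Proof.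
elim: n F => [|n IH] F nh.
  rewrite /= big_seq1 /cell_law big_seq1 (_ : history _ _ _ = setT).
    by rewrite /Pr probability_setT mul1r.
  by apply/seteqP; split.
rewrite iterSr -IH ?(ltnW nh) // sum_words big_seq [RHS]big_seq.
apply: eq_bigr => z; rewrite mem_words => /andP[/eqP sz _].
rewrite big_enum /= /step [X in _ = _ * X]mulr_suml [RHS]mulr_sumr sz; apply: eq_bigr => q _.
by rewrite cell_law_rcons // -!mulrA [F _ / _]mulrC.
Qed.

End Law.

(** * Measurability of the discrepancy *)

Section DiscrepancyMeasurable.
Context {R : realType} {d : nat}.
Implicit Types (a b : d.-tuple R) (zs : seq (d.-tuple R)).

Definition valid_box a b : Prop :=
  forall i, [/\ 0 <= tnth a i, tnth a i < tnth b i & tnth b i <= 1].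

Definition in_box a b : pred (d.-tuple R) :=
  fun z => [forall i, tnth a i <= tnth z i < tnth b i].

Definition box_disc a b zs : R :=
  `|(count (in_box a b) zs)%:R - (size zs)%:R * \prod_(i < d) (tnth b i - tnth a i)|.

Lemma box_volume a b : valid_box a b ->
  0 <= \prod_(i < d) (tnth b i - tnth a i) <= 1.
Proof.
move=> ab; rewrite prodr_ge0 /=; last by move=> i _; have [] := ab i; lra.
by apply: prodr_ile1 => i _; have [h1 h2 h3] := ab i; apply/andP; split; lra.
Qed.

Lemma box_disc_le a b zs : valid_box a b -> box_disc a b zs <= (size zs)%:R.
Proof.
move=> /box_volume/andP[v0 v1]; rewrite /box_disc ler_norml.
have c1 : (count (in_box a b) zs)%:R <= (size zs)%:R :> R by rewrite ler_nat count_size.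
have c0 : 0 <= (count (in_box a b) zs)%:R :> R by [].
have n0 : 0 <= (size zs)%:R :> R by [].
by apply/andP; split; nra.
Qed.

Let values zs : set R := [set r | exists a b, valid_box a b /\ r = box_disc a b zs].

Let discE zs : discrepancy zs = sup (values zs).
Proof. by []. Qed.

Let values_nonempty zs : values zs !=set0.
Proof.
exists (box_disc [tuple 0 | i < d] [tuple 1 | i < d] zs).
exists [tuple 0 | i < d], [tuple 1 | i < d]; split=> // i.
by rewrite !tnth_mktuple; split; rewrite ?lexx ?ltr01.
Qed.

Lemma discrepancy_size zs : discrepancy zs <= (size zs)%:R.
Proof. by rewrite discE; apply: ge_sup => // r [a [b [ab ->]]]; apply: box_disc_le. Qed.

Let values_ub zs : has_ubound (values zs).
Proof. by exists (size zs)%:R => r [a [b [ab ->]]]; apply: box_disc_le. Qed.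

(** Boxes contain their left ends and not their right ends, so an end may be moved slightly to the
    left: if no listed number is passed, all comparisons are unchanged. *)
Lemma rational_below (l : seq R) (L y : R) : L < y ->
  exists q : rat, [/\ L < ratr q, ratr q <= y &
    forall x, x \in l -> (ratr q <= x) = (y <= x)].
Proof.
elim: l L => [|x l IH] L Ly.
  have [q] := rat_in_itvoo Ly; rewrite in_itv /= => /andP[h1 h2].
  by exists q; split=> //; apply: ltW.
have [xy|yx] := ltP x y; last first.
  have [q [h1 h2 h3]] := IH L Ly; exists q; split=> // x'.
  rewrite inE => /orP[/eqP ->|/h3//].
  by rewrite yx (le_trans h2).
have [|q [h1 h2 h3]] := IH (Num.max L x); first by rewrite gt_max Ly.
move: h1; rewrite gt_max => /andP[h0 h1]; exists q; split=> // x'.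
rewrite inE => /orP[/eqP ->|/h3//].
by rewrite !leNgt h1 xy.
Qed.

Lemma prod_dist n (f g : 'I_n -> R) (e : R) :
  (forall i, 0 <= f i <= 1) -> (forall i, 0 <= g i <= 1) ->
  (forall i, `|f i - g i| <= e) ->
  `|\prod_(i < n) f i - \prod_(i < n) g i| <= n%:R * e.
Proof.
elim: n f g => [|n IH] f g hf hg hfg; first by rewrite !big_ord0 subrr normr0 mul0r.
rewrite !big_ord_recl; set F := \prod_(_ < _) _; set G := \prod_(_ < _) _.
have FG : `|F - G| <= n%:R * e by apply: IH.
have G1 : 0 <= G <= 1.
  rewrite prodr_ge0 /=; last by move=> i _; have /andP[] := hg (lift ord0 i).
  by apply: prodr_ile1 => i _; apply: hg.
rewrite (_ : _ - _ = f ord0 * (F - G) + (f ord0 - g ord0) * G); last by ring.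
apply: le_trans (ler_normD _ _) _; rewrite !normrM -natr1 mulrDl mul1r.
have /andP[f0 f1] := hf ord0; case/andP: G1 => G0 G1.
rewrite (ger0_norm f0) (ger0_norm G0); apply: lerD.
  by apply: le_trans FG; rewrite ler_piMl.
by apply: le_trans (hfg ord0); rewrite ler_piMr.
Qed.

Lemma rational_box a b zs (e : R) : valid_box a b -> 0 < e ->
  exists qa qb : d.-tuple rat,
    let a' := map_tuple ratr qa in let b' := map_tuple ratr qb in
    valid_box a' b' /\ box_disc a b zs <= box_disc a' b' zs + e.
Proof.
move=> ab e0.
(* The volume changes by at most [d] times [eps] and is weighted by the number of points; the
   successors avoid a division by 0. *)
pose eps := e / ((size zs).+1%:R * d.+1%:R).
have eps0 : 0 < eps by rewrite divr_gt0 // mulr_gt0.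
have choose i : exists p : rat * rat,
  [/\ 0 <= ratr p.1 :> R, ratr p.1 < ratr p.2 :> R, ratr p.2 <= 1 :> R,
    `|(tnth b i - tnth a i) - (ratr p.2 - ratr p.1)| <= eps &
    forall z, z \in zs ->
      (ratr p.1 <= tnth z i < ratr p.2) = (tnth a i <= tnth z i < tnth b i)].
  have [h1 h2 h3] := ab i; pose l := [seq tnth z i | z <- zs].
  (* The right end stays above [a i], so the box remains nonempty when the left end moves left. *)
  have [qb [b1 b2 b3]] : exists q : rat, [/\ Num.max (tnth a i) (tnth b i - eps) < ratr q,
      ratr q <= tnth b i & forall x, x \in l -> (ratr q <= x) = (tnth b i <= x)].
    by apply: rational_below; rewrite gt_max h2 gtrBl.
  have [qa [a1 a2 a3 a4]] : exists q : rat, [/\ 0 <= ratr q :> R, tnth a i - eps < ratr q,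
      ratr q <= tnth a i & forall x, x \in l -> (ratr q <= x) = (tnth a i <= x)].
    (* There is no room to the left of 0, but 0 is rational. *)
    have [->|a0] := eqVneq (tnth a i) 0.
      by exists 0; rewrite rmorph0; split=> //; rewrite gtrBl.
    have [q [a1 a2 a3]] : exists q : rat, [/\ Num.max 0 (tnth a i - eps) < ratr q,
      ratr q <= tnth a i & forall x, x \in l -> (ratr q <= x) = (tnth a i <= x)].
      by apply: rational_below; rewrite gt_max gtrBl eps0 andbT lt_def a0.
    by move: a1; rewrite gt_max => /andP[a0' a1]; exists q; split=> //; apply: ltW.
  move: b1; rewrite gt_max => /andP[b0 b1].
  exists (qa, qb); split=> //=.
  - exact: le_lt_trans a3 b0.
  - exact: le_trans b2 h3.
  - by rewrite ler_norml; apply/andP; split; lra.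
  - move=> z zz; have zl : tnth z i \in l by apply/mapP; exists z.
    by rewrite a4 // !ltNge b3.
have /boolp.choice[p hp] := choose.
exists [tuple (p i).1 | i < d], [tuple (p i).2 | i < d] => a' b'.
have Ea i : tnth a' i = ratr (p i).1 by rewrite tnth_map tnth_mktuple.
have Eb i : tnth b' i = ratr (p i).2 by rewrite tnth_map tnth_mktuple.
have ab' : valid_box a' b' by move=> i; rewrite Ea Eb; have [] := hp i.
split=> //; rewrite /box_disc.
have -> : count (in_box a' b') zs = count (in_box a b) zs.
  apply: eq_in_count => z zz; apply: eq_forallb => i.
  by rewrite Ea Eb; have [_ _ _ _ ->] := hp i.
have dist : `|\prod_(i < d) (tnth b i - tnth a i) - \prod_(i < d) (tnth b' i - tnth a' i)|
    <= d%:R * eps.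
  apply: prod_dist => i.
  - by have [h1 h2 h3] := ab i; apply/andP; split; lra.
  - by have [h1 h2 h3] := ab' i; apply/andP; split; lra.
  - by rewrite Ea Eb; have [] := hp i.
move: dist; set V := \prod_(i < d) _; set V' := \prod_(i < d) _ => dist.
have dist2 : (size zs)%:R * `|V - V'| <= e.
  apply: (@le_trans _ _ ((size zs)%:R * (d%:R * eps))); first by rewrite ler_wpM2l.
  rewrite /eps mulrA mulrCA ler_piMr ?(ltW e0) // ler_pdivrMr ?mulr_gt0 // mul1r.
  by rewrite -!natrM ler_nat leq_mul.
set c := (count _ _)%:R.
rewrite (_ : c - _ * V = (c - (size zs)%:R * V') - (size zs)%:R * (V - V')); last by ring.
apply: le_trans (ler_normB _ _) _; rewrite lerD2l normrM ger0_norm //.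
Qed.

(** Rational boxes approximate the supremum from below, and the slack 1 / (k + 1) turns the large
    inequality into countably many conditions, each a countable union over rational boxes. *)
Lemma discrepancy_geP zs (c : R) : c <= discrepancy zs <->
  forall k : nat, exists q : d.-tuple rat * d.-tuple rat,
    valid_box (map_tuple ratr q.1) (map_tuple ratr q.2) /\
    c - k.+1%:R^-1 < box_disc (map_tuple ratr q.1) (map_tuple ratr q.2) zs.
Proof.
rewrite discE; split=> [hc k|hq].
  have : 0 < k.+1%:R^-1 :> R by rewrite invr_gt0.
  move: (k.+1%:R^-1) => dl k0.
  have [r [a [b [ab ->]]] hr] : exists2 r, values zs r & c - dl / 2 < r.
    by apply: sup_gt => //; apply: lt_le_trans hc; rewrite gtrBl divr_gt0.
  have k2 : 0 < dl / 2 by rewrite divr_gt0.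
  have [qa [qb [vq hle]]] := rational_box zs ab k2.
  have lt : c - dl < box_disc (map_tuple ratr qa) (map_tuple ratr qb) zs by lra.
  by exists (qa, qb).
apply/ler_addgt0Pr => e e0.
have [k hk] : exists k : nat, k.+1%:R^-1 < e.
  have ei : 0 <= e^-1 by rewrite invr_ge0 ltW.
  exists (Num.trunc e^-1); rewrite invf_plt ?posrE //.
  by have /andP[] := truncn_itv ei.
have [q [vq lt]] := hq k.
have : box_disc (map_tuple ratr q.1) (map_tuple ratr q.2) zs <= sup (values zs).
  by apply: ub_le_sup; [exact: values_ub|exists (map_tuple ratr q.1), (map_tuple ratr q.2)].
move: hk lt; move: (k.+1%:R^-1) (box_disc _ _ _) (sup _) => dl bd S; lra.
Qed.

Lemma measurable_box a b : measurable [set z : d.-tuple R | in_box a b z].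
Proof.
rewrite (_ : [set z | _] = \bigcap_(i in [set: 'I_d])
    ((@tnth d R)^~ i @^-1` `[tnth a i, tnth b i[)).
  apply: fin_bigcap_measurable; first exact: finite_finset.
  by move=> i _; rewrite -[X in measurable X]setTI; apply: measurable_tnth.
apply/seteqP; split => z /=.
  by move=> /forallP hz i _; rewrite /= in_itv; apply: hz.
by move=> hz; apply/forallP => i; have := hz i I; rewrite /= in_itv.
Qed.

Lemma measurable_discrepancy disp (T : measurableType disp) J (s : seq J)
    (Y : J -> T -> d.-tuple R) (c : R) : (forall i, measurable_fun setT (Y i)) ->
  measurable [set w | c <= discrepancy [seq Y i w | i <- s]].
Proof.
move=> mY.
rewrite (_ : [set w | _] = \bigcap_k \bigcup_(q in setT)
  [set w | valid_box (map_tuple ratr q.1) (map_tuple ratr q.2) /\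
    c - k.+1%:R^-1 < box_disc (map_tuple ratr q.1) (map_tuple ratr q.2) [seq Y i w | i <- s]]);
  last first.
  apply/seteqP; split => w /=; first by move=> /discrepancy_geP h k _; have [q hq] := h k; exists q.
  by move=> h; apply/discrepancy_geP => k; have [q _ hq] := h k I; exists q.
apply: bigcapT_measurable => k; apply: countable_bigcupT_measurable => // q.
have [vq|nvq] := pselect (valid_box (map_tuple ratr q.1) (map_tuple ratr q.2 : d.-tuple R)); last first.
  rewrite (_ : [set w | _] = set0); first exact: measurable0.
  by apply/seteqP; split => w //= -[].
move: vq; set a := map_tuple ratr q.1; set b := map_tuple ratr q.2 => vq.
set c' := c - _.
pose g w : R := \sum_(i <- s) \1_[set z | in_box a b z] (Y i w)
  - (size s)%:R * \prod_(i < d) (tnth b i - tnth a i).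
have gE w : box_disc a b [seq Y i w | i <- s] = `|g w|.
  rewrite /box_disc /g size_map count_map -sum1_count natr_sum big_mkcond.
  congr (`|_ - _|); apply: eq_bigr => i _; rewrite indicE.
  have -> : (Y i w \in [set z | in_box a b z]) = in_box a b (Y i w) by apply/idP/idP; rewrite inE.
  by rewrite -[preim _ _ i]/(in_box a b (Y i w)); case: (in_box a b (Y i w)).
have mg : measurable_fun setT g.
  apply: measurable_realfun.measurable_funB; last exact: measurable_cst.
  apply: measurable_sum => j; apply: measurableT_comp (mY j).
  by apply: measurable_realfun.measurable_indic; apply: measurable_box.
have mng : measurable_fun setT (Num.norm \o g).
  by apply: measurableT_comp mg; apply: measurable_realfun.normr_measurable.
rewrite [X in measurable X](_ : _ = setT `&` (Num.norm \o g) @^-1` `]c', +oo[); last first.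
  rewrite setTI; apply/seteqP; split => w /=; rewrite gE in_itv /= andbT => //.
  by case.
by apply: mng => //; apply: measurable_itv.
Qed.

End DiscrepancyMeasurable.

(** * The tail bound *)

Section Tail.
Context {disp : measure_display} {T : measurableType disp} {R : realType}.
Variables (P : probability T R) (d : nat) (beta : R) (n : nat).
Variables (X : nat -> {RV P >-> d.-tuple R}) (U : nat -> {RV P >-> R}).
Hypothesis XU : thinning_randomness X U.
Hypothesis (d0 : (0 < d)%N) (beta01 : 0 < beta <= 1).

Let h := trunc_log 2 n.
Local Notation Q := (gridT d h).
Local Notation gpt := (@gpt R d h).
Local Notation cell := (@cell R d h).
Local Notation W := (haar_weight d h).
Local Notation xs w := (fun m => X m w).
Local Notation us w := (fun m => U m w).
Local Notation Z w := (samples (haar_strategy beta) (xs w) (us w) n).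
Local Notation chis := (words [:: false; true] n).
Local Notation zqs := (words (enum {: Q}) n).

Let nh : (n < 2 ^ h.+1)%N.
Proof. exact: trunc_log_ltn. Qed.

Let cube m w : in_cube (X m w).
Proof. by have [] := XU. Qed.

Let history_measurable chi z : chi \in chis -> z \in zqs ->
  measurable (history beta X U n chi z).
Proof.
rewrite !mem_words => /andP[/eqP sc _] /andP[/eqP sz _].
by have [] := history_past XU d0 beta01 sc sz nh.
Qed.

Let history_cover w : exists chi z, [/\ chi \in chis, z \in zqs,
  history beta X U n chi z w & z = map cell (Z w)].
Proof.
exists (decisions (haar_strategy beta) (xs w) (us w) n), (map cell (Z w)); split=> //.
  by rewrite mem_words size_decisions eqxx; apply/allP => -[]; rewrite !inE.
rewrite mem_words size_map size_selected size_decisions eqxx.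
by apply/allP => q _; rewrite mem_enum.
Qed.

(** On each of the finitely many histories the decisions are fixed, so the samples are fixed terms
    of the sequence of points and [measurable_discrepancy] applies. *)
Lemma samples_event_measurable (c : R) :
  measurable [set w | c <= discrepancy (Z w)].
Proof.
rewrite (_ : [set w | _] = \big[setU/set0]_(p <- [seq (chi, z) | chi <- chis, z <- zqs])
    ([set w | c <= discrepancy (selected (xs w) p.1)] `&` history beta X U n p.1 p.2)).
  rewrite big_seq; apply: bigsetU_measurable => p /allpairsP[[chi z] [/= hc hz ->]] /=.
  apply: measurableI; last exact: history_measurable.
  rewrite /selected.
  apply: (@measurable_discrepancy _ _ _ _ _ _ (fun i w => X (i + count id (take i.+1 chi))%N w)).
  by move=> i; apply: measurable_funPT.
apply/seteqP; split => w /=.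
  move=> hw; have [chi [z [hc hz [hd h2] _]]] := history_cover w.
  rewrite -bigcup_seq; exists (chi, z); first by apply/allpairsP; exists (chi, z).
  by split=> //=; rewrite -hd.
rewrite -bigcup_seq => -[[chi z] _ [/= h1 [h2 _]]].
by rewrite /samples h2.
Qed.

Lemma measure_seq_le (I : eqType) (s : seq I) (F : I -> set T) :
  (forall i, i \in s -> measurable (F i)) ->
  (P (\big[setU/set0]_(i <- s) F i) <= (\sum_(i <- s) Pr P (F i))%:E)%E.
Proof.
elim: s => [|i s IH] mF; first by rewrite !big_nil measure0.
rewrite !big_cons EFinD; apply: le_trans (measureU2 _ _ _) _.
- by apply: mF; rewrite inE eqxx.
- rewrite big_seq; apply: bigsetU_measurable => j js; apply: mF.
  by rewrite inE js orbT.
- apply: leeD; last by apply: IH => j js; apply: mF; rewrite inE js orbT.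
  by rewrite -(@PrE _ _ _ P) //; apply: mF; rewrite inE eqxx.
Qed.

Hypotheses (W2 : (2 <= W)%N) (Wd : (2 ^ d <= W ^ 2)%N).

(** Markov's inequality for [cosh2], whose moment is at most 4, and a union bound over the Haar
    functions, both carried out on finite unions of histories. *)
Lemma haar_tail (t : R) E : measurable E ->
  (forall w, E w -> exists2 K, haar_set R 1 h%:Z K & t <= `|pairing (Z w) (haar K)|) ->
  (P E <= (((2 ^ h * h.+1) ^ d)%:R * (4 * expR (- (beta / (4 * W%:R) * t))))%:E)%E.
Proof.
move=> mE hE; have [r [ru hr sr]] := @haar_set_seq R d h.
set theta := beta / _.
have th0 : 0 < theta.
  by case/andP: beta01 => b0 _; rewrite divr_gt0 // mulr_gt0 // ltr0n; apply: leq_trans W2.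
pose bad K z := t <= `|pairing (map gpt z) (haar K)|.
pose s := [seq (K, p) | K <- r, p <- [seq (z, chi) | z <- zqs, chi <- chis]].
pose F (p : d.-tuple (int * int) * (seq Q * seq bool)) : set T :=
  if bad p.1 p.2.1 then history beta X U n p.2.2 p.2.1 else set0.
have mF p : p \in s -> measurable (F p).
  move=> /allpairsP[[K q] [/= _ /allpairsP[[z chi] [/= hz hc ->]] ->]].
  by rewrite /F /=; case: ifP => _ //; apply: history_measurable.
apply: (@le_trans _ _ (P (\big[setU/set0]_(p <- s) F p))).
  apply: le_measure; rewrite ?inE //.
    by rewrite big_seq; apply: bigsetU_measurable.
  move=> w /hE[K hK tK]; have [chi [z [hc hz hw zE]]] := history_cover w.
  rewrite -bigcup_seq; exists (K, (z, chi)).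
    apply/allpairsP; exists (K, (z, chi)); split=> //=; first by rewrite hr in hK.
    by apply/allpairsP; exists (z, chi).
  rewrite /F /= (_ : bad K z) // /bad zE pairing_cell //.
  by move=> y; apply: selected_cube => m; apply: cube.
apply: le_trans (measure_seq_le mF) _; rewrite lee_fin /s big_allpairs.
have main K : K \in r -> \sum_(p <- [seq (z, chi) | z <- zqs, chi <- chis]) Pr P (F (K, p))
    <= 4 * expR (- (theta * t)).
  move=> Kr; have hK : haar_set R 1 h%:Z K by rewrite hr.
  rewrite big_allpairs mulrC.
  apply: (@le_trans _ _ (expR (- (theta * t)) * \sum_(z <- zqs) cell_law beta X U n z * cosh2 theta K z)).
    rewrite mulr_sumr; apply: ler_sum => z _; rewrite /cell_law /F /=.
    have c0 : 0 <= cosh2 theta K z by rewrite addr_ge0 ?expR_ge0.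
    have l0 : 0 <= \sum_(chi <- chis) Pr P (history beta X U n chi z).
      by apply: sumr_ge0 => chi _; apply: Pr_ge0.
    case: (boolP (bad K z)) => [hb|_]; last first.
      rewrite big1; first by rewrite !mulr_ge0 ?expR_ge0.
      by move=> chi _; rewrite /Pr measure0.
    rewrite [leRHS](mulrCA (expR (- (theta * t)))); apply: ler_peMr => //.
    move: hb; rewrite /bad /cosh2; set Y := pairing _ _ => hb.
    (* One of the two exponentials in [cosh2] has the exponent [theta * |Y|], whichever the sign of
       the pairing. *)
    have h1 : 1 <= expR (- (theta * t)) * expR (theta * `|Y|).
      rewrite -expRD -expR0 ler_expR addrC subr_ge0 ler_pM2l //.
    apply: le_trans h1 _; rewrite ler_wpM2l ?expR_ge0 //.
    have [Y0|Y0] := leP 0 Y.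
      by rewrite ger0_norm // lerDl expR_ge0.
    by rewrite ltr0_norm // mulrN lerDr expR_ge0.
  rewrite ler_wpM2l ?expR_ge0 // (cell_law_step XU d0 beta01) //.
  exact: cosh2_moment.
apply: (@le_trans _ _ (\sum_(K <- r) 4 * expR (- (theta * t)))).
  by rewrite big_seq [leRHS]big_seq; apply: ler_sum.
rewrite big_const_seq count_predT iter_addr_0 -[leLHS]mulr_natl.
by rewrite ler_wpM2r ?mulr_ge0 ?expR_ge0 // ler_nat.
Qed.

End Tail.

(** * Estimates of binomial coefficients *)

Section Numerics.

Lemma bin_ge_succ h d : (0 < d)%N -> (h < 'C(h + d, d))%N.
Proof.
case: d => // d _; elim: d => [|d IH]; first by rewrite addn1 bin1.
by rewrite addnS binS (leq_trans IH) // leq_addl.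
Qed.

Lemma bin_ge_exp h d : (d <= h)%N -> (2 ^ d <= 'C(h + d, d))%N.
Proof.
elim: d => [|d IH] dh; first by rewrite bin0.
have := mul_bin_diag (h + d).+1 d; rewrite /= => e.
rewrite addnS -(leq_pmul2l (ltn0Sn d)) -e expnS mulnA leq_mul ?IH ?(ltnW dh) //.
by lia.
Qed.

(** In other words (9/2)^d <= (25/4) d!^2, which is tightest at d = 2. From d to d + 1 the sides are
    multiplied by 18 and by 4 (d + 1)^2, which suffices from d = 2 on; d = 1 and d = 2 are
    computed. *)
Lemma fact_pow d : (0 < d)%N -> (4 * 18 ^ d <= 25 * 4 ^ d * d`! ^ 2)%N.
Proof.
case: d => // d _; elim: d => // -[|d] IH; first by [].
rewrite expnS [(4 ^ _)%N]expnS factS expnMn.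
apply: (@leq_trans (18 * (25 * 4 ^ d.+2 * d.+2`! ^ 2))).
  by rewrite mulnCA leq_mul2l IH.
have -> : (25 * (4 * 4 ^ d.+2) * (d.+3 ^ 2 * d.+2`! ^ 2) =
    (4 * d.+3 ^ 2) * (25 * 4 ^ d.+2 * d.+2`! ^ 2))%N.
  by move: (4 ^ _)%N (_ ^ 2)%N (_`! ^ 2)%N => x y z; ring.
by rewrite leq_mul2r; apply/orP; right; rewrite -mulnn; nia.
Qed.

(** For [2 * d <= h] the binomial C(h + d, d) is at most (3h / 2)^d / d!. It bounds the weight, and
    the number of boxes up to the factor 2^(d+1); the constant 4 (9/2)^d / d!^2 that results is at
    most 25 by [fact_pow]. *)
Lemma box_weight_le h d : (0 < d)%N -> (2 * d <= h)%N ->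
  (2 * (box_count d h * haar_weight d h) <= 25 * h ^ (2 * d))%N.
Proof.
move=> d0 dh; set C := 'C(h + d, d).
have hW : (haar_weight d h <= C)%N by rewrite haar_weightE // leq_subr.
apply: (@leq_trans (2 * (2 ^ d.+1 * C * C))).
  by rewrite leq_mul2l; apply/orP; right; apply: leq_mul => //; apply: box_count_le.
have CF : (2 ^ d * (C * d`!) <= (3 * h) ^ d)%N.
  rewrite bin_ffact ffact_prod.
  apply: (@leq_trans (2 ^ d * (h + d) ^ d)).
    rewrite leq_mul2l; apply/orP; right.
    rewrite -[X in (_ <= _ ^ X)%N]card_ord -prod_nat_const.
    by apply: leq_prod => i _; apply: leq_subr.
  by rewrite -expnMn leq_exp2r //; lia.
have CF2 := leq_mul CF CF.
rewrite -(@leq_pmul2r (4 ^ d * d`! ^ 2)); last by rewrite muln_gt0 !expn_gt0 fact_gt0.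
apply: (@leq_trans (4 * 2 ^ d * ((3 * h) ^ d * (3 * h) ^ d))).
  rewrite (_ : 2 * _ * _ = 4 * 2 ^ d * (2 ^ d * (C * d`!) * (2 ^ d * (C * d`!))))%N.
    by rewrite leq_mul2l CF2 orbT.
  have -> : (4 ^ d = 2 ^ d * 2 ^ d)%N by rewrite -expnMn.
  rewrite expnS -[(d`! ^ 2)%N]mulnn; move: (2 ^ d)%N (d`!) => x f.
  ring.
rewrite (_ : 4 * 2 ^ d * _ = 4 * 18 ^ d * h ^ (2 * d))%N; last first.
  rewrite -expnMn (_ : 18 ^ d = 2 ^ d * (9 ^ d))%N; last by rewrite -expnMn.
  rewrite expnM -!mulnA; congr (_ * (_ * _))%N; rewrite -expnMn; congr (_ ^ _)%N; lia.
rewrite (_ : 25 * _ * _ = 25 * 4 ^ d * d`! ^ 2 * h ^ (2 * d))%N; last by ring.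
by rewrite leq_mul2r fact_pow ?orbT.
Qed.

Lemma haar_weight_ge2 h d : (0 < d)%N -> (2 * d <= h)%N -> (2 <= haar_weight d h)%N.
Proof. by move=> d0 dh; rewrite haar_weightE //; have := bin_ge_succ h d0; lia. Qed.

(** The binomial C = W + 1 is at least 2^d, and (C - 1)^2 >= C because C >= 3. *)
Lemma haar_weight_sq h d : (0 < d)%N -> (2 * d <= h)%N ->
  (2 ^ d <= haar_weight d h ^ 2)%N.
Proof.
move=> d0 dh; have := haar_weight_ge2 d0 dh; rewrite haar_weightE // => W2.
apply: (@leq_trans 'C(h + d, d)); first by apply: bin_ge_exp; lia.
by move: W2; move: 'C(h + d, d)%N => C C3; rewrite -mulnn; nia.
Qed.

End Numerics.

Lemma log2_ge_trunc (R : realType) n : (0 < n)%N ->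
  (trunc_log 2 n)%:R <= log2 (n%:R : R).
Proof.
move=> n0; have l2 : 0 < ln (2 : R) by rewrite ln_gt0 // ltr1n.
rewrite /log2 ler_pdivlMr // mulr_natl -lnXn // ler_ln ?posrE ?exprn_gt0 ?ltr0n //.
by rewrite -natrX ler_nat trunc_logP.
Qed.

Lemma haar_thinning_tail (R : realType) (d : nat) (hd : (1 <= d)%N) (beta : R)
    (disp : measure_display) (T : measurableType disp) (P : probability T R)
    (X : nat -> {RV P >-> d.-tuple R}) (U : nat -> {RV P >-> R}) (n : nat) (Delta : R) :
  0 < beta <= 1 -> thinning_randomness X U -> (2 <= n)%N -> 0 < Delta ->
  let Z := fun w =>
     samples (haar_strategy beta) (fun m => X m w) (fun m => U m w) n in
  let E := [set w | beta^-1 * log2 n%:R ^+ (2 * d)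
                       * (Delta + 1000 + 100 * d%:R ^+ 2 * log2 n%:R)
                     <= discrepancy (Z w)] in
  measurable E /\ (P E <= (beta ^- 2 * expR (- Delta / 50))%:E)%E.
Proof.
move=> b01 XU n2 D0 Z E; have /andP[b0 b1] := b01.
have mE : measurable E by apply: samples_event_measurable.
split=> //; pose h := trunc_log 2 n; set L : R := log2 n%:R in E mE *.
have hL : h%:R <= L by apply: log2_ge_trunc; apply: ltnW.
have h1 : (1 <= h)%N by rewrite /h trunc_log_gt0.
have L1 : 1 <= L by apply: le_trans hL; rewrite ler1n.
have nh : (n < 2 ^ h.+1)%N by apply: trunc_log_ltn.
have bi : 1 <= beta^-1 by rewrite invf_ge1.
have rhs0 : 0 <= beta ^- 2 * expR (- Delta / 50).
  by rewrite mulr_ge0 ?expR_ge0 // invr_ge0 exprn_ge0 // ltW.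
have cube m w : in_cube (X m w) by have [] := XU.
have sZ w : size (Z w) = n by rewrite size_selected size_decisions.
have LD0 : 0 <= L ^+ (2 * d) by rewrite exprn_ge0 // (le_trans ler01).
have d1 : 1 <= d%:R :> R by rewrite ler1n.
(* For [h < 2 * d] the threshold exceeds [n], which bounds the discrepancy: n < 2^(h+1) <= 2^(2d) <=
   L^(2d) if h >= 2, and n < 4 if h = 1. *)
have [dh|dh] := leqP (2 * d) h; last first.
  rewrite (_ : E = set0) ?measure0 ?lee_fin //.
  have [c [cE c4]] : exists c : R, c = 1000 /\ 4 <= c by exists 1000; rewrite ler_nat.
  apply/seteqP; split => w //; rewrite /E /= leNgt -cE => /negP; apply.
  apply: le_lt_trans (discrepancy_size _) _; rewrite sZ.
  have c0 : 0 < c by lra.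
  have Y1 : 1 <= L ^+ (2 * d) by apply: exprn_ege1.
  have big : n%:R < L ^+ (2 * d) * c.
    have [h2|h2] := leqP 2 h; last first.
      have h1' : h = 1%N by apply/eqP; rewrite eqn_leq h1 andbT -ltnS.
      apply: (@lt_le_trans _ _ 4); first by rewrite ltr_nat; rewrite h1' in nh.
      by apply: le_trans c4 _; rewrite ler_peMl // ltW.
    apply: (@lt_le_trans _ _ (L ^+ (2 * d))); last first.
      by rewrite ler_peMr //; lra.
    apply: (@lt_le_trans _ _ (2 ^+ (2 * d))).
      by rewrite -natrX ltr_nat; apply: leq_trans nh _; rewrite leq_pexp2l.
    by rewrite lerXn2r ?nnegrE //; [exact: le_trans L1|apply: le_trans hL; rewrite ler_nat].
  apply: lt_le_trans big _; apply: ler_pM => //.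
  - exact: ltW.
  - by rewrite ler_peMl.
  - have : 0 <= 100 * d%:R ^+ 2 * L.
      by apply: mulr_ge0; [apply: mulr_ge0 => //; apply: exprn_ge0|apply: le_trans L1].
    by move: (100 * _ * _) => v v0; lra.
have W2 := haar_weight_ge2 hd dh; have Wd := haar_weight_sq hd dh.
set W := haar_weight d h in W2 Wd.
have W0 : 0 < W%:R :> R by rewrite ltr0n; apply: leq_trans W2.
(* Chosen so that beta t / 4W = Delta / 50 + 2 + 2hd, where 2 + 2hd pays for the union bound. *)
pose t := (Delta / 50 + 2 + 2 * h%:R * d%:R) * (4 * W%:R / beta).
have t0 : 0 <= t.
  have q0 : 0 <= Delta / 50 + 2 + 2 * h%:R * d%:R.
    have : 0 <= 2 * h%:R * d%:R :> R by rewrite !mulr_ge0.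
    by lra.
  by apply: mulr_ge0 => //; apply: divr_ge0; [rewrite mulr_ge0|exact: ltW].
have tail := haar_tail XU hd b01 W2 Wd (t := t) mE.
apply: le_trans (tail _) _.
  move=> w Ew; apply: contrapT => nK.
  have hM K : haar_set R 1 h%:Z K -> `|pairing (Z w) (haar K)| <= t.
    by move=> hK; rewrite leNgt; apply/negP => lt; apply: nK; exists K => //; apply: ltW.
  have zc z : z \in Z w -> in_cube z by apply: selected_cube => m; apply: cube.
  have := discrepancy_le zc t0 hM; rewrite sZ => /(_ nh) hdisc.
  have := le_trans Ew hdisc; rewrite leNgt => /negP; apply.
  set B := box_count d h in hdisc *.
  have BW : 2 * (B%:R * W%:R) <= 25 * L ^+ (2 * d) :> R.
    apply: (@le_trans _ _ (25 * h%:R ^+ (2 * d))).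
      by rewrite -natrX -!natrM ler_nat; apply: box_weight_le.
    by rewrite ler_pM2l // lerXn2r ?nnegrE // (le_trans ler01).
  set Y := L ^+ (2 * d) in BW LD0 *.
  have Y1 : 1 <= Y by apply: exprn_ege1.
  have W1 : 1 <= W%:R / beta :> R.
    rewrite ler_pdivlMr // mul1r; apply: le_trans b1 _; rewrite ler1n; exact: leq_trans W2.
  have B0 : 0 <= B%:R :> R by [].
  pose q := Delta / 50 + 2 + 2 * h%:R * d%:R.
  have hd0 : 0 <= h%:R * d%:R :> R by rewrite mulr_ge0.
  have q0 : 0 <= 4 * q + 2 by rewrite /q; lra.
  (* The term 2B is absorbed because W / beta >= 1. Then BW <= 25Y / 2, and 25 / 2 times 4q + 2 is
     Delta + 125 + 100hd, below the last factor of the threshold: this is the origin of 50 and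
     100. *)
  apply: (@le_lt_trans _ _ (beta^-1 * (B%:R * W%:R) * (4 * q + 2))).
    rewrite (_ : B%:R * (t + 2) = beta^-1 * (B%:R * W%:R) * (4 * q) + B%:R * 2); last first.
      by rewrite /t -/q; ring.
    rewrite [leRHS]mulrDr lerD2l; apply: ler_wpM2r => //.
    by rewrite mulrCA ler_peMr // mulrC.
  apply: (@le_lt_trans _ _ (beta^-1 * (25 * Y / 2) * (4 * q + 2))).
    by apply: ler_wpM2r => //; apply: ler_wpM2l; [rewrite invr_ge0 ltW|lra].
  have -> : beta^-1 * (25 * Y / 2) * (4 * q + 2) = beta^-1 * Y * (25 / 2 * (4 * q + 2)).
    by field; rewrite gt_eqF.
  rewrite ltr_pM2l; last by rewrite mulr_gt0 ?invr_gt0 // (lt_le_trans ltr01).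
  have hdL : h%:R * d%:R <= d%:R ^+ 2 * L :> R.
    rewrite mulrC expr2 -mulrA; apply: ler_wpM2l => //.
    by apply: le_trans hL _; rewrite ler_peMl // (le_trans ler01).
  rewrite /q -[2 * h%:R * _]mulrA -[100 * _ * _]mulrA.
  by move: hdL; move: (h%:R * _) (_ ^+ 2 * L) => u v uv; lra.
rewrite lee_fin.
have -> : beta / (4 * W%:R) * t = Delta / 50 + (2 + 2 * h%:R * d%:R).
  by rewrite /t; field; rewrite !gt_eqF.
rewrite opprD expRD mulNr.
have e2 : 2 <= expR 1 :> R by have := expR_ge1Dx (1 : R); lra.
(* As h + 1 <= 2^h, the left side is at most 2^(2 + 2hd), and 2 <= e. *)
have key : ((2 ^ h * h.+1) ^ d)%:R * 4 <= expR (2 + 2 * h%:R * d%:R) :> R.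
  apply: (@le_trans _ _ ((2 : R) ^+ (2 + 2 * h * d))).
    rewrite exprD [leRHS]mulrC -[2 ^+ 2]natrX; apply: ler_wpM2r => //.
    rewrite -natrX ler_nat expnM leq_exp2r // mul2n -addnn expnD leq_mul2l.
    by rewrite ltn_expl ?orbT.
  rewrite (_ : 2 + _ = (2 + 2 * h * d)%:R * 1); last by rewrite natrD !natrM mulr1.
  by rewrite expRM_natl lerXn2r ?nnegrE ?expR_ge0.
have key2 : ((2 ^ h * h.+1) ^ d)%:R * 4 * expR (- (2 + 2 * h%:R * d%:R)) <= 1 :> R.
  rewrite expRN ler_pdivrMr ?expR_gt0 // mul1r; exact: key.
have b2 : 1 <= beta ^- 2 by rewrite -exprVn exprn_ege1.
have e0 := expR_ge0 (- (Delta / 50)).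
apply: (@le_trans _ _ (1 * expR (- (Delta / 50)))); last by rewrite ler_wpM2r.
apply: le_trans (ler_wpM2r e0 key2); rewrite mulrA -[leRHS]mulrA.
by rewrite [X in _ <= _ * X]mulrC.
Qed.

(** * The random access machine *)

Section Runs.
Context {R : realType}.
Implicit Types (m : @memory R) (e : expr) (c : cmd).

Definition evals m e v S := exists2 s, eval_expr m e v s & (s <= S)%N.

Lemma evals_const m k S : evals m (Const k) k%:R S.
Proof. by exists 0%N => //; apply: eval_const. Qed.

Lemma evals_cell m e k v S : evals m e v S -> v = k%:R -> (k < S)%N ->
  evals m (Cell e) (m k) S.
Proof.
move=> [s es sS] vk kS; rewrite vk in es.
by exists (maxn s k.+1); [apply: eval_cell|rewrite geq_max sS].
Qed.

Lemma evals_var m k S : (k < S)%N -> evals m (Cell (Const k)) (m k) S.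
Proof. by move=> kS; apply: evals_cell => //; apply: evals_const. Qed.

Lemma evals_op m o e1 e2 v1 v2 S : evals m e1 v1 S -> evals m e2 v2 S ->
  evals m (Op o e1 e2) (apply_op o v1 v2) S.
Proof.
move=> [s1 h1 l1] [s2 h2 l2]; exists (maxn s1 s2); last by rewrite geq_max l1.
exact: eval_op.
Qed.

(** Time and space are only bounded from above and the postcondition may be another [runs], so
    specifications compose like weakest preconditions with a remaining budget. *)
Definition runs c m (S t : nat) (Q : @memory R -> Prop) : Prop :=
  exists m' t' s, [/\ exec c m m' t' s, (t' <= t)%N, (s <= S)%N & Q m'].

Lemma runs_weaken c m S t t' Q Q' : runs c m S t Q -> (t <= t')%N ->
  (forall m', Q m' -> Q' m') -> runs c m S t' Q'.
Proof.
move=> [m' [u [s [h1 h2 h3 h4]]]] tt QQ; exists m', u, s; split=> //.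
  exact: leq_trans tt.
exact: QQ.
Qed.

Lemma runs_skip m S t Q : Q m -> runs Skip m S t Q.
Proof. by move=> Qm; exists m, 0%N, 0%N; split=> //; apply: exec_skip. Qed.

Lemma runs_store a e m k va v S t Q : evals m a va S -> va = k%:R -> (k < S)%N ->
  evals m e v S -> (expr_cost a + expr_cost e < t)%N ->
  Q (set_cell m k v) -> runs (Store a e) m S t Q.
Proof.
move=> [sa ha la] vk kS [se he le] ht Qm; rewrite vk in ha.
exists (set_cell m k v), (expr_cost a + expr_cost e).+1, (maxn (maxn sa se) k.+1).
split=> //; first exact: exec_store.
by rewrite !geq_max la le.
Qed.

Lemma runs_set k e m v S t Q : evals m e v S -> (k < S)%N ->
  ((expr_cost e).+1 < t)%N -> Q (set_cell m k v) -> runs (Store (Const k) e) m S t Q.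
Proof. by move=> he kS ht; apply: runs_store he _ => //; apply: evals_const. Qed.

Lemma runs_seq c1 c2 m S t1 t2 t Q :
  runs c1 m S t1 (fun m1 => runs c2 m1 S t2 Q) -> (t1 + t2 <= t)%N ->
  runs (Seq c1 c2) m S t Q.
Proof.
move=> [m1 [u1 [s1 [h1 h2 h3 [m2 [u2 [s2 [g1 g2 g3 Q2]]]]]]]] ht.
exists m2, (u1 + u2)%N, (maxn s1 s2); split=> //; first exact: exec_seq h1 g1.
  by apply: leq_trans ht; apply: leq_add.
by rewrite geq_max h3.
Qed.

Lemma runs_seq_set k e c m v S t Q : evals m e v S -> (k < S)%N ->
  ((expr_cost e).+2 <= t)%N -> runs c (set_cell m k v) S (t - (expr_cost e).+2) Q ->
  runs (Seq (Store (Const k) e) c) m S t Q.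
Proof.
move=> he kS ht hc; apply: (@runs_seq _ _ _ _ (expr_cost e).+2 (t - (expr_cost e).+2)); last by rewrite subnKC.
exact: runs_set he _ _ _.
Qed.

Lemma runs_if e1 e2 c1 c2 m v1 v2 S t t' Q : evals m e1 v1 S -> evals m e2 v2 S ->
  (expr_cost e1 + expr_cost e2 + t < t')%N ->
  runs (if v1 < v2 then c1 else c2) m S t Q -> runs (IfLt e1 e2 c1 c2) m S t' Q.
Proof.
move=> [s1 h1 l1] [s2 h2 l2] ht [m' [u [s [g1 g2 g3 g4]]]].
exists m', (expr_cost e1 + expr_cost e2 + u).+1, (maxn (maxn s1 s2) s); split=> //.
- exact: exec_if h1 h2 g1.
- by apply: leq_ltn_trans ht; rewrite leq_add2l.
- by rewrite !geq_max l1 l2.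
Qed.

Lemma runs_while_stop e1 e2 c m v1 v2 S t Q : evals m e1 v1 S -> evals m e2 v2 S ->
  (expr_cost e1 + expr_cost e2 < t)%N -> (v1 < v2) = false -> Q m ->
  runs (WhileLt e1 e2 c) m S t Q.
Proof.
move=> [s1 h1 l1] [s2 h2 l2] ht lt Qm.
exists m, (expr_cost e1 + expr_cost e2).+1, (maxn s1 s2); split=> //.
  exact: exec_while_stop h1 h2 lt.
by rewrite geq_max l1.
Qed.

Lemma runs_while_loop e1 e2 c m v1 v2 S t1 t2 t Q :
  evals m e1 v1 S -> evals m e2 v2 S ->
  (expr_cost e1 + expr_cost e2 + t1 + t2 < t)%N -> v1 < v2 ->
  runs c m S t1 (fun m1 => runs (WhileLt e1 e2 c) m1 S t2 Q) ->
  runs (WhileLt e1 e2 c) m S t Q.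
Proof.
move=> [s1 h1 l1] [s2 h2 l2] ht lt [m1 [u1 [r1 [g1 g2 g3 [m2 [u2 [r2 [k1 k2 k3 Q2]]]]]]]].
exists m2, (expr_cost e1 + expr_cost e2 + u1 + u2).+1, (maxn (maxn s1 s2) (maxn r1 r2)).
split=> //; first exact: exec_while_loop h1 h2 lt g1 k1.
  by apply: leq_ltn_trans ht; apply: leq_add => //; rewrite leq_add2l.
by rewrite !geq_max l1 l2 g3.
Qed.

Lemma set_same m k v : set_cell m k v k = v.
Proof. by rewrite /set_cell eqxx. Qed.

Lemma set_other m k v j : (j == k) = false -> set_cell m k v j = m j.
Proof. by rewrite /set_cell => ->. Qed.

End Runs.

(** * Enumeration of the Haar functions at a point by nested loops *)

Section Leaves.
Context {R : realType}.
Implicit Types (xc : nat -> R) (v : seq nat).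

Definition order_code (h : nat) v p : nat := foldl (fun p s => p * h.+1 + s)%N p v.

(** Mixed-radix digits: the digit for the order [s] is less than 2^s, so the code is less than 2 to
    the total order, however this order is distributed. *)
Fixpoint place_code xc i v a : nat :=
  if v is s :: v' then place_code xc i.+1 v' (a * 2 ^ s + (dfloor s (xc i))./2)%N else a.

Fixpoint path_sign xc i v : R :=
  if v is s :: v' then (-1) ^+ odd (dfloor s (xc i)) * path_sign xc i.+1 v' else 1.

(** Total order, order code, position code and sign. A partial leaf accounts for the first
    coordinates only; [leaves] completes it in all ways within the budget. *)
Definition leaf := (nat * nat * nat * R)%type.

Definition leaves h xc k i (l : leaf) : seq leaf :=
  let: (sum, pos, ap, sg) := l in
  [seq ((sum + sumn v)%N, order_code h v pos, place_code xc i v ap, sg * path_sign xc i v)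
  | v <- orders k (h - sum)%N].

Definition next_leaf h xc i (l : leaf) (s : nat) : leaf :=
  let: (sum, pos, ap, sg) := l in
  ((sum + s)%N, (pos * h.+1 + s)%N, (ap * 2 ^ s + (dfloor s (xc i))./2)%N,
   sg * (-1) ^+ odd (dfloor s (xc i))).

Lemma leaves0 h xc i l : leaves h xc 0 i l = [:: l].
Proof. by case: l => [[[sum pos] ap] sg]; rewrite /leaves /= addn0 mulr1. Qed.

Lemma leavesS h xc k i l : (l.1.1.1 <= h)%N ->
  leaves h xc k.+1 i l =
  flatten [seq leaves h xc k i.+1 (next_leaf h xc i l s) | s <- iota 0 (h.+1 - l.1.1.1)].
Proof.
case: l => [[[sum pos] ap] sg] hs; rewrite /leaves /orders -/orders map_allpairs.
have {}hs : (sum <= h)%N by [].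
rewrite -[(_, _, _, _).1.1.1]/sum -subSn //; congr flatten; apply/eq_in_map => s _.
by rewrite /= subnDA; apply: eq_map => v /=; rewrite addnA mulrA.
Qed.

End Leaves.

Definition var (k : nat) : expr := Cell (Const k).

(* Level [i] of the nested loops owns the eight cells [level d i c], [c < 8]:
   the partial leaf (total order, order code, position, sign), then the loop
   variables: the order [s], the fraction and the integer part of
   [2 ^ s * x / 2], and [2 ^ s]. *)
Definition level (d i c : nat) : nat := (10 + d + 8 * i + c)%N.

(** The first cell after the deepest level. Below the levels, the cells 3 + d to 9 + d hold the
    number of samples, h, 2^h - 1, the offset of the current table, the sum of signs, its number of
    terms and the index of the point being read. *)
Definition table (d : nat) : nat := (18 + 9 * d)%N.

Definition point_expr (d i : nat) : expr :=
  Cell (Op Add (Const (table d)) (Op Mul (Const 2)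
    (Op Add (Op Mul (Const d) (var (9 + d))) (Const i)))).

Definition enter (d i : nat) : cmd :=
  Seq (Store (Const (level d i.+1 0)) (Op Add (var (level d i 0)) (var (level d i 4))))
  (Seq (Store (Const (level d i.+1 1))
     (Op Add (Op Mul (var (level d i 1)) (Op Add (var (4 + d)) (Const 1))) (var (level d i 4))))
  (Seq (Store (Const (level d i.+1 2))
     (Op Add (Op Mul (var (level d i 2)) (var (level d i 7))) (var (level d i 6))))
  (IfLt (Op Mul (Const 2) (var (level d i 5))) (Const 1)
     (Store (Const (level d i.+1 3)) (var (level d i 3)))
     (Store (Const (level d i.+1 3)) (Op Defs.Sub (Const 0) (var (level d i 3))))))).

(** One more binary digit: doubling the fraction and comparing it with 1 replaces a rounding
    instruction. *)
Definition advance (d i : nat) : cmd :=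
  Seq (Store (Const (level d i 4)) (Op Add (var (level d i 4)) (Const 1)))
  (Seq (Store (Const (level d i 7)) (Op Mul (var (level d i 7)) (Const 2)))
  (IfLt (Op Mul (Const 2) (var (level d i 5))) (Const 1)
    (Seq (Store (Const (level d i 6)) (Op Mul (Const 2) (var (level d i 6))))
         (Store (Const (level d i 5)) (Op Mul (Const 2) (var (level d i 5)))))
    (Seq (Store (Const (level d i 6)) (Op Add (Op Mul (Const 2) (var (level d i 6))) (Const 1)))
         (Store (Const (level d i 5)) (Op Defs.Sub (Op Mul (Const 2) (var (level d i 5))) (Const 1)))))).

(** The depth is a constant of the code, so the loops are nested in its text. The test at the bottom
    excludes the constant function. *)
Fixpoint nest (d : nat) (body : cmd) (k i : nat) : cmd :=
  if k is k'.+1 then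
    Seq (Store (Const (level d i 4)) (Const 0))
    (Seq (Store (Const (level d i 5)) (Op Div (point_expr d i) (Const 2)))
    (Seq (Store (Const (level d i 6)) (Const 0))
    (Seq (Store (Const (level d i 7)) (Const 1))
    (WhileLt (Op Add (var (level d i 0)) (var (level d i 4)))
             (Op Add (var (4 + d)) (Const 1))
      (Seq (enter d i) (Seq (nest d body k' i.+1) (advance d i)))))))
  else IfLt (Const 0) (var (level d i 0)) body Skip.

Ltac neq_addr := clear; apply/eqP; rewrite /level /table; lia.
Ltac rd := repeat first
  [ rewrite set_same
  | rewrite set_other; last by neq_addr ].

Section Nest.
Context {R : realType}.
Variables (d h J S : nat) (xc : nat -> R).
Implicit Types (m : @memory R) (l : @leaf R) (L : seq (@leaf R)).

Hypothesis S_big : (table d <= S)%N.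

Definition at_level i l m : Prop :=
  [/\ m (level d i 0) = l.1.1.1%:R, m (level d i 1) = l.1.1.2%:R,
      m (level d i 2) = l.1.2%:R & m (level d i 3) = l.2].

Definition local_state i s m : Prop :=
  [/\ m (level d i 4) = s%:R,
      m (level d i 5) = 2 ^+ s * xc i / 2 - ((dfloor s (xc i))./2)%:R,
      m (level d i 6) = ((dfloor s (xc i))./2)%:R & m (level d i 7) = 2 ^+ s].

Lemma evals_op_eq m o e1 e2 v1 v2 v : evals m e1 v1 S -> evals m e2 v2 S ->
  apply_op o v1 v2 = v -> evals m (Op o e1 e2) v S.
Proof. by move=> h1 h2 <-; apply: evals_op. Qed.

Lemma evals_var_eq m k v : (k < S)%N -> m k = v -> evals m (var k) v S.
Proof. by move=> kS <-; apply: evals_var. Qed.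

Lemma level_lt i c : (i <= d)%N -> (c < 8)%N -> (level d i c < S)%N.
Proof. by move=> id c8; apply: leq_trans S_big; rewrite /level /table; lia. Qed.

Lemma scalar_lt c : (c < 18)%N -> (c + d < S)%N.
Proof. by move=> c8; apply: leq_trans S_big; rewrite /table; lia. Qed.

(** The first binary digit of the fractional part of 2^s x / 2 is the parity of the integer part of
    2^s x. *)
Lemma double_fraction s (x : R) : 0 <= x ->
  (2 * (2 ^+ s * x / 2 - ((dfloor s x)./2)%:R) < 1) = ~~ odd (dfloor s x).
Proof.
move=> x0; have /andP[h1 h2] := dfloor_itv s x0.
set t := dfloor s x in h1 h2 *.
have tE : t%:R = (odd t)%:R + 2 * (t./2)%:R :> R.
  by rewrite -[in LHS](odd_double_half t) natrD -mul2n natrM.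
move: h1 h2; rewrite -[t.+1%:R]natr1 tE; move: (2 ^+ s * x) ((t./2)%:R) => y a.
case: (odd t) => /= h1 h2; last by have -> : 2 * (y / 2 - a) < 1 by lra.
by apply/negbTE; rewrite -leNgt; lra.
Qed.

Lemma enter_spec i l s m : (i < d)%N -> 0 <= xc i -> m (4 + d)%N = h%:R ->
  at_level i l m -> local_state i s m ->
  runs (enter d i) m S 60 (fun m' => at_level i.+1 (next_leaf h xc i l s) m' /\
    forall j, ~~ (level d i.+1 0 <= j < level d i.+1 4)%N -> m' j = m j).
Proof.
case: l => [[[sum pos] ap] sg] id x0 mh [/= l0 l1 l2 l3] [e4 e5 e6 e7].
apply: runs_seq_set.
- by apply: evals_op; apply: evals_var; apply: level_lt => //; apply: ltnW.
- exact: level_lt.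
- by [].
apply: runs_seq_set.
- apply: evals_op; last by apply: evals_var; apply: level_lt => //; apply: ltnW.
  apply: evals_op; first by apply: evals_var; apply: level_lt => //; apply: ltnW.
  by apply: evals_op; [apply: evals_var; apply: scalar_lt|apply: evals_const].
- exact: level_lt.
- by [].
apply: runs_seq_set.
- apply: evals_op; last by apply: evals_var; apply: level_lt => //; apply: ltnW.
  by apply: evals_op; apply: evals_var; apply: level_lt => //; apply: ltnW.
- exact: level_lt.
- by [].
apply: (@runs_if _ _ _ _ _ _ _ _ _ 12).
- by apply: evals_op; [apply: evals_const|apply: evals_var; apply: level_lt => //; apply: ltnW].
- exact: evals_const.
- by [].
rewrite /apply_op; rd; rewrite e5 double_fraction //.
case o : (odd (dfloor s (xc i))) => /=.
  apply: runs_set.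
  - by apply: evals_op; [apply: evals_const|apply: evals_var; apply: level_lt => //; apply: ltnW].
  - exact: level_lt.
  - by [].
  split.
    rewrite /at_level /apply_op /=; split; rd; rewrite ?l0 ?l1 ?l2 ?l3 ?e4 ?e6 ?e7 ?mh ?natr1 ?natrD ?natrM ?natrX //.
    by rewrite sub0r expr1 mulrN1.
  move=> j hj; rewrite !set_other //; by apply/negP => /eqP jE; move: hj; rewrite jE /level; lia.
apply: runs_set.
- by apply: evals_var; apply: level_lt => //; apply: ltnW.
- exact: level_lt.
- by [].
split.
  rewrite /at_level /apply_op /=; split; rd; rewrite ?l0 ?l1 ?l2 ?l3 ?e4 ?e6 ?e7 ?mh ?natr1 ?natrD ?natrM ?natrX //.
  by rewrite mulr1.
move=> j hj; rewrite !set_other //; by apply/negP => /eqP jE; move: hj; rewrite jE /level; lia.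
Qed.

Lemma advance_spec i s m : (i < d)%N -> 0 <= xc i -> local_state i s m ->
  runs (advance d i) m S 60 (fun m' => local_state i s.+1 m' /\
    forall j, ~~ (level d i 4 <= j < level d i.+1 0)%N -> m' j = m j).
Proof.
move=> id x0 [e4 e5 e6 e7]; have id' := ltnW id.
have lt c : (c < 8)%N -> (level d i c < S)%N by apply: level_lt.
apply: runs_seq_set.
- by apply: evals_op; [apply: evals_var; apply: lt|apply: evals_const].
- exact: lt.
- by [].
apply: runs_seq_set.
- by apply: evals_op; [apply: evals_var; apply: lt|apply: evals_const].
- exact: lt.
- by [].
apply: (@runs_if _ _ _ _ _ _ _ _ _ 30).
- by apply: evals_op; [apply: evals_const|apply: evals_var; apply: lt].
- exact: evals_const.
- by [].
rewrite /apply_op; rd; rewrite e5 double_fraction //.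
have oE : (dfloor s (xc i))%:R = (odd (dfloor s (xc i)))%:R + 2 * ((dfloor s (xc i))./2)%:R :> R.
  by rewrite -[in LHS](odd_double_half (dfloor s (xc i))) natrD -mul2n natrM.
case o : (odd (dfloor s (xc i))) oE => /= oE.
  apply: runs_seq_set.
  - apply: evals_op; last exact: evals_const.
    by apply: evals_op; [apply: evals_const|apply: evals_var; apply: lt].
  - exact: lt.
  - by [].
  apply: runs_set.
  - apply: evals_op; last exact: evals_const.
    by apply: evals_op; [apply: evals_const|apply: evals_var; apply: lt].
  - exact: lt.
  - by [].
  split.
    rewrite /local_state /apply_op dfloorS // exprS; split; rd; rewrite ?e4 ?e5 ?e6 ?e7 ?natr1 //.
    + by rewrite oE; field.
    + by rewrite oE addrC.
    + by rewrite mulrC.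
  move=> j hj; rewrite !set_other //; by apply/negP => /eqP jE; move: hj; rewrite jE /level; lia.
apply: runs_seq_set.
- by apply: evals_op; [apply: evals_const|apply: evals_var; apply: lt].
- exact: lt.
- by [].
apply: runs_set.
- by apply: evals_op; [apply: evals_const|apply: evals_var; apply: lt].
- exact: lt.
- by [].
split.
  rewrite /local_state /apply_op dfloorS // exprS; split; rd; rewrite ?e4 ?e5 ?e6 ?e7 ?natr1 //.
  + by rewrite oE; field.
  + by rewrite oE add0r.
  + by rewrite mulrC.
move=> j hj; rewrite !set_other //; by apply/negP => /eqP jE; move: hj; rewrite jE /level; lia.
Qed.

Definition loop_cell j := (10 + d <= j < table d)%N.

(** [Inv L] describes the memory once the body has treated the leaves of [L]. It must ignore the
    loop cells and the body must preserve them; the adding and the evaluating passes are two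
    instances. *)
Variables (body : cmd) (tb : nat) (Inv : seq (@leaf R) -> @memory R -> Prop).
Variable all_leaves : seq (@leaf R).

Hypothesis xc01 : forall i, (i < d)%N -> 0 <= xc i < 1.
Hypothesis J_small : (table d + 2 * (d * J + d) <= S)%N.
Hypothesis Inv_frame : forall L m m', (forall j, ~~ loop_cell j -> m' j = m j) ->
  Inv L m -> Inv L m'.
Hypothesis Inv_ctx : forall L m, Inv L m -> [/\ m (4 + d)%N = h%:R, m (9 + d)%N = J%:R &
  forall i, (i < d)%N -> m (table d + 2 * (d * J + i))%N = xc i].
Hypothesis body_spec : forall L l m, Inv L m -> at_level d l m -> l \in all_leaves ->
  (0 < l.1.1.1)%N ->
  runs body m S tb (fun m' => Inv (rcons L l) m' /\ forall j, loop_cell j -> m' j = m j).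

Let live (l : @leaf R) := (0 < l.1.1.1)%N.

Fixpoint nest_time k : nat :=
  if k is k'.+1 then (100 + h.+1 * (200 + nest_time k'))%N else (tb + 10)%N.

Lemma loop_cell_level i c j : (i <= d)%N -> (c <= 8)%N ->
  (level d i 0 <= j < level d i c)%N -> loop_cell j.
Proof. by rewrite /loop_cell /level /table => id c8 hj; lia. Qed.

Let Inv_frame' i (a b : nat) L m m' : (i <= d)%N -> (b <= 8)%N ->
  (forall j, ~~ (level d i a <= j < level d i b)%N -> m' j = m j) -> Inv L m -> Inv L m'.
Proof.
move=> id b8 hm; apply: Inv_frame => j hj; apply: hm; apply/negP => hj'.
case/negP: hj; apply: loop_cell_level id b8 _.
by move: hj'; rewrite /level; lia.
Qed.

(** Induction on the number [r] of orders still to be tried at level [i]; the behaviour of the inner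
    levels is a premise, supplied by the induction of [nest_spec]. The frame protects the outer
    levels and the partial leaf of this one. *)
Lemma while_spec k i l : (i + k.+1 = d)%N -> (l.1.1.1 <= h)%N ->
  {subset leaves h xc k.+1 i l <= all_leaves} ->
  (forall l' L m, (l'.1.1.1 <= h)%N -> {subset leaves h xc k i.+1 l' <= all_leaves} ->
     Inv L m -> at_level i.+1 l' m ->
     runs (nest d body k i.+1) m S (nest_time k) (fun m' =>
       Inv (L ++ [seq l'' <- leaves h xc k i.+1 l' | live l'']) m' /\
       forall j, loop_cell j -> (j < level d i.+1 4)%N -> m' j = m j)) ->
  forall r s L m, (s + r = h.+1 - l.1.1.1)%N -> Inv L m -> at_level i l m ->
    local_state i s m ->
    runs (WhileLt (Op Add (var (level d i 0)) (var (level d i 4)))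
          (Op Add (var (4 + d)) (Const 1))
          (Seq (enter d i) (Seq (nest d body k i.+1) (advance d i)))) m S
      (20 + r * (200 + nest_time k)) (fun m' =>
      Inv (L ++ [seq l'' <- flatten [seq leaves h xc k i.+1 (next_leaf h xc i l s') | s' <- iota s r] | live l'']) m'
      /\ forall j, loop_cell j -> (j < level d i 4)%N -> m' j = m j).
Proof.
move=> ik lh sub IH; have id : (i < d)%N by rewrite -ik addnS ltnS leq_addr.
have id' := ltnW id.
have ev1 s m : at_level i l m -> local_state i s m ->
    evals m (Op Add (var (level d i 0)) (var (level d i 4))) (l.1.1.1 + s)%:R S.
  move=> [e0 _ _ _] [e4 _ _ _]; apply: evals_op_eq; last by rewrite natrD.
    by apply: evals_var_eq e0; apply: level_lt.
  by apply: evals_var_eq e4; apply: level_lt.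
have ev2 L m : Inv L m -> evals m (Op Add (var (4 + d)) (Const 1)) (h.+1)%:R S.
  move=> /Inv_ctx[e0 _ _]; apply: evals_op_eq; last by rewrite -natr1.
    by apply: evals_var_eq e0; apply: scalar_lt.
  exact: evals_const.
elim=> [|r IHr] s L m sr IL al ls.
  apply: (runs_while_stop _ (ev1 _ _ al ls) (ev2 _ _ IL)) => //.
    by rewrite ltr_nat; apply/negbTE; rewrite -leqNgt; lia.
  by rewrite cats0.
have /andP[xi _] := xc01 id.
have [mh mJ mp] := Inv_ctx IL.
apply: (runs_while_loop (t1 := 130 + nest_time k) (t2 := 20 + r * (200 + nest_time k))
  (ev1 _ _ al ls) (ev2 _ _ IL)).
- by rewrite /= mulSn; lia.
- by rewrite ltr_nat; lia.
set l' := next_leaf h xc i l s.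
have sl' : l'.1.1.1 = (l.1.1.1 + s)%N by rewrite /l' /next_leaf; case: (l) => [[[? ?] ?] ?].
have l'h : (l'.1.1.1 <= h)%N by rewrite sl'; lia.
have sub' : {subset leaves h xc k i.+1 l' <= all_leaves}.
  move=> l'' hl''; apply: sub; rewrite leavesS //; apply/flattenP.
  exists (leaves h xc k i.+1 l') => //; apply/mapP; exists s => //.
  by rewrite mem_iota; lia.
apply: (runs_seq (t1 := 60) (t2 := 70 + nest_time k)); last by lia.
apply: runs_weaken (enter_spec id xi mh al ls) (leqnn _) _ => m1 [al1 fr1].
have IL1 : Inv L m1 by apply: Inv_frame' fr1 IL.
apply: (runs_seq (t1 := nest_time k) (t2 := 60)); last by lia.
apply: runs_weaken (IH _ _ _ l'h sub' IL1 al1) (leqnn _) _ => m2 [IL2 fr2].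
have keep c : (c < 8)%N -> m2 (level d i c) = m (level d i c).
  move=> c8; rewrite fr2; last by rewrite /level; lia.
    by rewrite fr1 // /level; lia.
  by apply: (@loop_cell_level i 8) => //; rewrite /level; lia.
have ls2 : local_state i s m2.
  by case: ls => *; rewrite /local_state !keep.
apply: runs_weaken (advance_spec id xi ls2) (leqnn _) _ => m3 [ls3 fr3].
have fr03 c : (c < 4)%N -> m3 (level d i c) = m (level d i c).
  by move=> c4; rewrite fr3 ?keep //; rewrite /level; lia.
have al3 : at_level i l m3.
  by case: al => *; rewrite /at_level !fr03.
have IL3 : Inv (L ++ [seq l'' <- leaves h xc k i.+1 l' | live l'']) m3.
  apply: (@Inv_frame' i 4 8) IL2 => // j hj; apply: fr3.
  by move: hj; rewrite /level; lia.
apply: runs_weaken (IHr s.+1 _ m3 _ IL3 al3 ls3) (leqnn _) _; first by lia.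
move=> m4 [IL4 fr4]; split; first by rewrite /= filter_cat catA.
move=> j lj j4; rewrite fr4 // fr3; last by move: j4; rewrite /level; lia.
rewrite fr2 //; last by move: j4; rewrite /level; lia.
by rewrite fr1 //; move: j4; rewrite /level; lia.
Qed.

Lemma evals_point i m : (i < d)%N -> m (9 + d)%N = J%:R ->
  m (table d + 2 * (d * J + i))%N = xc i -> evals m (point_expr d i) (xc i) S.
Proof.
move=> id mJ <-.
have E : evals m (Op Add (Const (table d)) (Op Mul (Const 2)
    (Op Add (Op Mul (Const d) (var (9 + d))) (Const i))))
    (table d + 2 * (d * J + i))%:R S.
  apply: evals_op_eq; first exact: evals_const.
    apply: evals_op; first exact: evals_const.
    apply: evals_op; last exact: evals_const.
    apply: evals_op; first exact: evals_const.
    by apply: evals_var_eq mJ; apply: scalar_lt.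
  by rewrite /apply_op -natrM -natrD -natrM -natrD.
apply: evals_cell E _ _ => //.
by apply: leq_trans J_small; clear -id; lia.
Qed.

Lemma nest_spec k i l L m : (i + k = d)%N -> (l.1.1.1 <= h)%N ->
  {subset leaves h xc k i l <= all_leaves} -> Inv L m -> at_level i l m ->
  runs (nest d body k i) m S (nest_time k) (fun m' =>
    Inv (L ++ [seq l' <- leaves h xc k i l | live l']) m' /\
    forall j, loop_cell j -> (j < level d i 4)%N -> m' j = m j).
Proof.
elim: k i l L m => [|k IH] i l L m ik lh sub IL al.
  rewrite addn0 in ik; rewrite ik in al *.
  rewrite leaves0 /=.
  apply: (@runs_if _ _ _ _ _ _ _ _ _ tb).
  - exact: evals_const.
  - by apply: evals_var; apply: level_lt.
  - by rewrite /=; lia.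
  have [-> _ _ _] := al; rewrite ltr_nat -/(live l).
  case lv : (live l).
    apply: runs_weaken (body_spec IL al _ lv) (leqnn _) _.
      by apply: sub; rewrite leaves0 inE.
    by move=> m' [h1 h2]; rewrite cats1; split=> // j hj _; apply: h2.
  by apply: runs_skip; rewrite cats0.
have id : (i < d)%N by rewrite -ik addnS ltnS leq_addr.
have id' := ltnW id.
have [mh mJ mp] := Inv_ctx IL.
rewrite /nest -/nest /nest_time -/nest_time.
apply: runs_seq_set; [exact: evals_const|exact: level_lt|by []|].
set m1 := set_cell m _ _.
have ep1 : evals m1 (Op Div (point_expr d i) (Const 2)) (xc i / 2) S.
  apply: evals_op_eq; [|exact: evals_const|by []].
  apply: evals_point => //; first by rewrite /m1; rd.
  by rewrite /m1 set_other ?mp //; apply/eqP; rewrite /level /table; clear -id; lia.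
apply: runs_seq_set; [exact: ep1|exact: level_lt| |].
  by rewrite /=; lia.
apply: runs_seq_set; [exact: evals_const|exact: level_lt| |].
  by rewrite /=; lia.
apply: runs_seq_set; [exact: evals_const|exact: level_lt| |].
  by rewrite /=; lia.
set m4 := set_cell _ _ _.
have fr j : ~~ (level d i 4 <= j < level d i 8)%N -> m4 j = m j.
  move=> hj; rewrite /m4 /m1 !set_other //;
  by apply/negP => /eqP jE; move: hj; rewrite jE /level; clear; lia.
have IL4 : Inv L m4 by apply: Inv_frame' fr IL.
have al4 : at_level i l m4.
  by case: al => *; rewrite /at_level !fr //; rewrite /level; clear; lia.
have ls4 : local_state i 0 m4.
  rewrite /local_state dfloor0 ?xc01 // /m4 /m1; split; rd; rewrite ?expr0 ?mul1r //=.
  by rewrite subr0.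
have IHk l' L' m' (l'h : (l'.1.1.1 <= h)%N) (s' : {subset leaves h xc k i.+1 l' <= all_leaves}) :=
  IH i.+1 l' L' m' (etrans (addSnnS i k) ik) l'h s'.
apply: runs_weaken (while_spec ik lh sub IHk (add0n _) IL4 al4 ls4) _ _.
  rewrite /= -!subnDA; move: (nest_time k) => t.
  apply: (@leq_trans (20 + h.+1 * (200 + t))); last by lia.
  by rewrite leq_add2l leq_mul2r leq_subr orbT.
move=> m' [IL' fr']; split; first by rewrite leavesS.
by move=> j lj j4; rewrite fr' // fr // /level; move: j4; rewrite /level; clear; lia.
Qed.

End Nest.

Lemma nest_time_le h tb k : (nest_time h tb k <= h.+1 ^ k * (tb + 10 + 300 * k))%N.
Proof.
elim: k => [|k IH] /=; first by rewrite expn0 mul1n muln0 addn0.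
rewrite expnS -mulnA.
apply: (@leq_trans (h.+1 * (300 + nest_time h tb k))).
  by rewrite !mulnDr; clear; lia.
rewrite leq_mul2l /=; apply: leq_trans (leq_add (leqnn 300) IH) _.
rewrite [(300 * k.+1)%N]mulnS addnCA [leqRHS]mulnDr leq_add2r leq_pmull //.
by rewrite expn_gt0.
Qed.

(** * The table of pairings *)

Section Codes.
Context {R : realType}.
Variables (d h : nat).
Implicit Types (x z : d.-tuple R) (v : seq nat) (l : @leaf R).

Definition coord x (i : nat) : R := nth 0 x i.

Definition leaf_of x v : leaf := (sumn v, order_code h v 0, place_code (coord x) 0 v 0, haar_sgn v x).

Definition top_leaf : @leaf R := (0%N, 0%N, 0%N, 1).

Definition live_leaves x : seq leaf :=
  [seq l <- leaves h (coord x) d 0 top_leaf | (0 < l.1.1.1)%N].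

Definition code l : nat := (l.1.1.2 * 2 ^ h + l.1.2)%N.

Lemma coord_tnth x (i : 'I_d) : coord x i = tnth x i.
Proof. by rewrite (tnth_nth 0). Qed.

Lemma coord_cube x i : in_cube x -> (i < d)%N -> 0 <= coord x i < 1.
Proof. by move=> hx id; have := hx (Ordinal id); rewrite -coord_tnth. Qed.

Lemma path_sign_prod (xc : nat -> R) i v :
  path_sign xc i v = \prod_(j < size v) (-1) ^+ odd (dfloor (nth 0%N v j) (xc (i + j)%N)).
Proof.
elim: v i => [|s v IH] i /=; first by rewrite big_ord0.
rewrite big_ord_recl /= addn0 IH; congr (_ * _); apply: eq_bigr => j _.
by rewrite /= /bump addSnnS.
Qed.

Lemma leavesE x : leaves h (coord x) d 0 top_leaf = map (leaf_of x) (orders d h).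
Proof.
rewrite /leaves /top_leaf subn0; apply/eq_in_map => v; rewrite mem_orders => /andP[/eqP sv _].
rewrite /leaf_of add0n mul1r path_sign_prod sv; congr (_, _, _, _).
by apply: eq_bigr => j _; rewrite add0n coord_tnth.
Qed.

Lemma sum_live_leaves x (F : leaf -> R) :
  \sum_(l <- live_leaves x) F l = \sum_(v <- orders d h | (0 < sumn v)%N) F (leaf_of x v).
Proof. by rewrite big_filter leavesE big_map. Qed.

Lemma size_live_leaves x : (0 < d)%N -> size (live_leaves x) = haar_weight d h.
Proof.
by move=> d0; rewrite -size_orders_pos // /live_leaves leavesE !size_filter count_map.
Qed.

Lemma order_code_lt v p : (sumn v <= h)%N -> (order_code h v p < p.+1 * h.+1 ^ size v)%N.
Proof.
elim: v p => [|s v IH] p /= hv; first by rewrite muln1.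
apply: leq_trans (IH _ _) _; first by apply: leq_trans hv; rewrite leq_addl.
rewrite expnS mulnA leq_mul2r; apply/orP; right.
by rewrite mulSn [(h.+1 + _)%N]addnC -addnS leq_add2l; apply: leq_trans hv; rewrite leq_addr.
Qed.

Lemma half_dfloor_lt s (y : R) : 0 <= y < 1 -> ((dfloor s y)./2 < 2 ^ s)%N.
Proof.
move=> hy; apply: leq_ltn_trans (dfloor_lt s hy).
by rewrite -[X in (_ <= X)%N]odd_double_half -addnn addnA leq_addl.
Qed.

Lemma place_code_lt (xc : nat -> R) i v a : (forall j, (j < size v)%N -> 0 <= xc (i + j)%N < 1) ->
  (place_code xc i v a < a.+1 * 2 ^ sumn v)%N.
Proof.
elim: v i a => [|s v IH] i a /= hx; first by rewrite muln1.
apply: leq_trans (IH _ _ _) _; first by move=> j jv; rewrite addSnnS; apply: hx.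
rewrite expnD mulnA leq_mul2r; apply/orP; right.
rewrite mulSn [(2 ^ s + _)%N]addnC -addnS leq_add2l half_dfloor_lt //.
by have := hx 0%N; rewrite addn0; apply.
Qed.

Lemma mulD_inj b p p' s s' : (s < b)%N -> (s' < b)%N ->
  (p * b + s = p' * b + s')%N -> p = p' /\ s = s'.
Proof.
move=> sb s'b e; have b0 : (0 < b)%N by apply: leq_ltn_trans sb.
have := congr1 (fun n => n %/ b)%N e; rewrite !divnMDl // !divn_small // !addn0 => pp.
by split=> //; move: e; rewrite pp => /addnI.
Qed.

Lemma order_code_inj v v' p p' : size v = size v' -> (sumn v <= h)%N -> (sumn v' <= h)%N ->
  order_code h v p = order_code h v' p' -> p = p' /\ v = v'.
Proof.
elim: v v' p p' => [|s v IH] [|s' v'] //= p p' [sz] hv hv' e.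
have hs : (s <= h)%N by apply: leq_trans hv; rewrite leq_addr.
have hs' : (s' <= h)%N by apply: leq_trans hv'; rewrite leq_addr.
have [||e1 ->] := IH v' _ _ sz _ _ e.
- by apply: leq_trans hv; rewrite leq_addl.
- by apply: leq_trans hv'; rewrite leq_addl.
by have [-> ->] := mulD_inj (hs : (s < h.+1)%N) (hs' : (s' < h.+1)%N) e1.
Qed.

Lemma place_code_inj (xc yc : nat -> R) i v a a' :
  (forall j, (j < size v)%N -> 0 <= xc (i + j)%N < 1) ->
  (forall j, (j < size v)%N -> 0 <= yc (i + j)%N < 1) ->
  place_code xc i v a = place_code yc i v a' ->
  a = a' /\ forall j, (j < size v)%N ->
    (dfloor (nth 0%N v j) (xc (i + j)%N))./2 = (dfloor (nth 0%N v j) (yc (i + j)%N))./2.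
Proof.
elim: v i a a' => [|s v IH] i a a' //= hx hy e.
have [||e1 e2] := IH _ _ _ _ _ e.
- by move=> j jv; rewrite addSnnS; apply: hx.
- by move=> j jv; rewrite addSnnS; apply: hy.
have lx := half_dfloor_lt s (hx 0%N isT); have ly := half_dfloor_lt s (hy 0%N isT).
rewrite addn0 in lx ly; have [-> e3] := mulD_inj lx ly e1.
split=> // -[|j] /=; first by rewrite addn0.
by rewrite ltnS => jv; rewrite -addSnnS; apply: e2.
Qed.

Lemma ap_lt x v : in_cube x -> v \in orders d h -> (place_code (coord x) 0 v 0 < 2 ^ h)%N.
Proof.
move=> hx; rewrite mem_orders => /andP[/eqP sv hv].
apply: leq_trans (place_code_lt _ _) _; first by rewrite sv => j jd; apply: coord_cube.
by rewrite mul1n leq_pexp2l.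
Qed.

Lemma code_lt x v : in_cube x -> v \in orders d h ->
  (code (leaf_of x v) < h.+1 ^ d * 2 ^ h)%N.
Proof.
move=> hx vs; have ap := ap_lt hx vs.
move: vs; rewrite mem_orders => /andP[/eqP sv hv].
have := order_code_lt 0 hv; rewrite mul1n sv /code /= => ps.
apply: (@leq_trans ((order_code h v 0).+1 * 2 ^ h)); last by rewrite leq_mul2r ps orbT.
by rewrite mulSn addnC ltn_add2r.
Qed.

(** The first part of the code determines the order vector, and then the second can be decoded digit
    by digit: a cell of the table belongs to exactly one Haar function. *)
Lemma code_eq x z v v' : in_cube x -> in_cube z -> v \in orders d h -> v' \in orders d h ->
  (code (leaf_of z v') == code (leaf_of x v)) = (v' == v) && (haar_at v x == haar_at v z).
Proof.
move=> hx hz vs v's; have ax := ap_lt hx vs; have az := ap_lt hz v's.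
move: vs v's; rewrite !mem_orders => /andP[/eqP sv hv] /andP[/eqP sv' hv'].
apply/eqP/andP => [e|[/eqP -> /eqP e]]; last first.
  congr (_ * _ + _)%N; rewrite /=.
  have same j : (j < d)%N -> (dfloor (nth 0%N v j) (coord z j))./2
      = (dfloor (nth 0%N v j) (coord x j))./2.
    move=> jd; have := congr1 (fun t => tnth t (Ordinal jd)) e.
    by rewrite !tnth_mktuple -!coord_tnth /haar_itv => -[/esym].
  have gen (w : seq nat) i a : (forall j, (j < size w)%N -> (dfloor (nth 0%N w j) (coord z (i + j)%N))./2
      = (dfloor (nth 0%N w j) (coord x (i + j)%N))./2) ->
      place_code (coord z) i w a = place_code (coord x) i w a.
    elim: w i a => //= s w IH i a hw; have := hw 0%N isT; rewrite addn0 /= => ->.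
    by apply: IH => j jw; rewrite addSnnS; apply: (hw j.+1).
  by apply: gen => j; rewrite sv add0n; apply: same.
have [e1 e2] := mulD_inj az ax e.
have [_ vv] := order_code_inj (etrans sv' (esym sv)) hv' hv e1.
move: e2; rewrite /leaf_of /= vv => e2; split=> //.
have [||_ e3] := place_code_inj _ _ e2.
- by move=> j; rewrite sv; apply: coord_cube.
- by move=> j; rewrite sv; apply: coord_cube.
apply/eqP; apply: eq_mktuple => i; rewrite -!coord_tnth.
by have := e3 i; rewrite sv add0n => ->.
Qed.

Definition contrib x A : R := \sum_(l <- live_leaves x) (code l == A)%:R * l.2.

(** All codes are below this bound, so the cells beyond the table still contain 0 when the next
    table is placed there. *)
Lemma contrib_big x A : in_cube x -> (h.+1 ^ d * 2 ^ h <= A)%N -> contrib x A = 0.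
Proof.
move=> hx hA; rewrite /contrib sum_live_leaves big_seq_cond big1 // => v /andP[vs _].
by rewrite (_ : (_ == A) = false) ?mul0r //; apply/negbTE; rewrite ltn_eqF // (leq_trans (code_lt hx vs)).
Qed.

(** Among the leaves of [z] only the one with orders [v] can have this code, and it does so exactly
    when [z] is in the support of the Haar function taken at [x]. *)
Lemma contrib_haar x z v : in_cube x -> in_cube z -> v \in orders d h -> (0 < sumn v)%N ->
  contrib z (code (leaf_of x v)) = haar (haar_at v x) z.
Proof.
move=> hx hz vs v0; rewrite /contrib sum_live_leaves haar_at_sgn //.
transitivity (\sum_(v' <- orders d h | v' == v) (haar_at v x == haar_at v z)%:R * haar_sgn v z).
  rewrite [LHS]big_mkcond [RHS]big_mkcond /= [LHS]big_seq [RHS]big_seq.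
  apply: eq_bigr => v' v's; rewrite code_eq //.
  case: (eqVneq v' v) => [->|_]; first by rewrite v0.
  by rewrite mul0r; case: ifP.
by rewrite -big_filter filter_pred1_uniq ?orders_uniq // big_seq1.
Qed.

End Codes.

(* Points are stored at even distances from [table d] and pairings at odd ones,
   so that both tables can grow. *)
Definition haar_cell (d off A : nat) : nat := (table d + 1 + 2 * (off + A))%N.

Definition addr_expr (d : nat) : expr :=
  Op Add (Const (table d + 1)) (Op Mul (Const 2) (Op Add (var (6 + d))
    (Op Add (Op Mul (var (level d d 1)) (Op Add (var (5 + d)) (Const 1))) (var (level d d 2))))).

Definition add_body (d : nat) : cmd :=
  Store (addr_expr d) (Op Add (Cell (addr_expr d)) (var (level d d 3))).

(** The sign of minus the pairing decides between adding, subtracting and doing nothing. Counting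
    the leaves in the cell 8 + d yields W without a binomial coefficient. *)
Definition eval_body (d : nat) : cmd :=
  Seq (Store (Const (8 + d)) (Op Add (var (8 + d)) (Const 1)))
  (IfLt (Cell (addr_expr d)) (Const 0)
    (Store (Const (7 + d)) (Op Add (var (7 + d)) (var (level d d 3))))
    (IfLt (Const 0) (Cell (addr_expr d))
      (Store (Const (7 + d)) (Op Defs.Sub (var (7 + d)) (var (level d d 3)))) Skip)).

Definition pass (d : nat) (body : cmd) : cmd :=
  Seq (Store (Const (level d 0 0)) (Const 0))
  (Seq (Store (Const (level d 0 1)) (Const 0))
  (Seq (Store (Const (level d 0 2)) (Const 0))
  (Seq (Store (Const (level d 0 3)) (Const 1)) (nest d body d 0)))).

Section Passes.
Context {R : realType}.
Variables (d h J off S : nat) (x : d.-tuple R).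
Implicit Types (m : @memory R) (l : @leaf R) (L : seq (@leaf R)).

Hypothesis d0 : (0 < d)%N.
Hypothesis x_cube : in_cube x.
Hypothesis S_points : (table d + 2 * (d * J + d) <= S)%N.
Hypothesis S_haar : (haar_cell d off (h.+1 ^ d * 2 ^ h) <= S)%N.

Definition context m : Prop :=
  [/\ m (4 + d)%N = h%:R, m (5 + d)%N = (2 ^ h - 1)%N%:R, m (6 + d)%N = off%:R,
      m (9 + d)%N = J%:R &
      forall i, (i < d)%N -> m (table d + 2 * (d * J + i))%N = coord x i].

Let all_leaves := leaves h (coord x) d 0 top_leaf.

Let S_big : (table d <= S)%N.
Proof. by apply: leq_trans S_points; rewrite leq_addr. Qed.

Lemma pass_spec body tb (Inv : seq (@leaf R) -> @memory R -> Prop) m :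
  (forall L m m', (forall j, ~~ loop_cell d j -> m' j = m j) -> Inv L m -> Inv L m') ->
  (forall L m, Inv L m -> context m) ->
  (forall L l m, Inv L m -> at_level d d l m -> l \in all_leaves -> (0 < l.1.1.1)%N ->
    runs body m S tb (fun m' => Inv (rcons L l) m' /\ forall j, loop_cell d j -> m' j = m j)) ->
  Inv [::] m ->
  runs (pass d body) m S (20 + nest_time h tb d) (fun m' => Inv (live_leaves h x) m').
Proof.
move=> fr cx bs I0.
have lt c : (c < 8)%N -> (level d 0 c < S)%N by move=> c8; exact (level_lt S_big (leq0n d) c8).
apply: runs_seq_set; [exact: evals_const|exact: lt|by []|].
apply: runs_seq_set; [exact: evals_const|exact: lt|by []|].
apply: runs_seq_set; [exact: evals_const|exact: lt|by []|].
apply: runs_seq_set; [exact: evals_const|exact: lt|by []|].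
set m1 := set_cell _ _ _.
have I1 : Inv [::] m1.
  apply: fr I0 => j hj; rewrite /m1 !set_other //;
  by apply/negP => /eqP jE; move: hj; rewrite jE /loop_cell /level /table; clear; lia.
have al1 : at_level d 0 top_leaf m1 by rewrite /m1; split; rd.
have cx' L m' (IL : Inv L m') : [/\ m' (4 + d)%N = h%:R, m' (9 + d)%N = J%:R &
    forall i, (i < d)%N -> m' (table d + 2 * (d * J + i))%N = coord x i].
  by have [? ? ? ? ?] := cx _ _ IL.
have := @nest_spec R d h J S (coord x) S_big body tb Inv all_leaves
  (fun i => coord_cube x_cube) S_points fr cx' bs d 0 top_leaf [::] m1 (add0n d) isT.
move=> /(_ (fun l hl => hl) I1 al1) h1.
by apply: runs_weaken h1 _ _ => [|m' []//]; rewrite /=; lia.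
Qed.

Lemma code_small l : l \in all_leaves -> (code h l < h.+1 ^ d * 2 ^ h)%N.
Proof. by rewrite /all_leaves leavesE => /mapP[v vs ->]; apply: code_lt. Qed.

Lemma haar_cell_lt l : l \in all_leaves -> (haar_cell d off (code h l) < S)%N.
Proof.
by move=> /code_small cl; apply: leq_trans S_haar; rewrite /haar_cell; lia.
Qed.

Lemma evals_addr m l : m (5 + d)%N = (2 ^ h - 1)%N%:R -> m (6 + d)%N = off%:R ->
  at_level d d l m -> evals m (addr_expr d) (haar_cell d off (code h l))%:R S.
Proof.
move=> m5 m6 [_ e1 e2 _].
have lt c : (c < 8)%N -> (level d d c < S)%N by move=> c8; exact (level_lt S_big (leqnn d) c8).
apply: evals_op_eq; first exact: evals_const.
  apply: evals_op; first exact: evals_const.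
  apply: evals_op; first by apply: evals_var_eq m6; apply: (scalar_lt S_big).
  apply: evals_op; last by apply: evals_var_eq e2; apply: lt.
  apply: evals_op; first by apply: evals_var_eq e1; apply: lt.
  apply: evals_op; last exact: evals_const.
  by apply: evals_var_eq m5; apply: (scalar_lt S_big).
rewrite /apply_op /haar_cell /code natr1 -subSn ?expn_gt0 // subn1 /=.
by rewrite -!natrM -!natrD -!natrM -!natrD.
Qed.

Lemma haar_cell_eq A A' : (haar_cell d off A == haar_cell d off A') = (A == A').
Proof. by rewrite /haar_cell eqn_add2l eqn_mul2l /= eqn_add2l. Qed.

Let Inv_add m0 L m : Prop := forall j, ~~ loop_cell d j ->
  m j = m0 j + \sum_(l <- L) (j == haar_cell d off (code h l))%:R * l.2.

Let not_haar j A : (j < 10 + d)%N -> (j == haar_cell d off A) = false.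
Proof. by move=> hj; apply/eqP; rewrite /haar_cell /table; clear -hj; lia. Qed.

Let even_not_haar k A : (table d + 2 * k == haar_cell d off A)%N = false.
Proof. by apply/eqP; rewrite /haar_cell; clear; lia. Qed.

Let not_loop j : (j < 10 + d)%N || (table d <= j)%N -> ~~ loop_cell d j.
Proof. by rewrite /loop_cell => hj; lia. Qed.

Let add_context m0 L m : context m0 -> Inv_add m0 L m -> context m.
Proof.
move=> [c4 c5 c6 c9 cp] IL.
have E j : (j < 10 + d)%N -> m j = m0 j.
  move=> hj; rewrite IL; last by apply: not_loop; rewrite hj.
  by rewrite big1 ?addr0 // => l _; rewrite not_haar // mul0r.
split; rewrite ?E //; try by clear; lia.
move=> i id; rewrite IL; last by apply: not_loop; rewrite leq_addr orbT.
by rewrite big1 ?addr0 ?cp // => l _; rewrite even_not_haar mul0r.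
Qed.

Lemma pass_add m0 : context m0 ->
  runs (pass d (add_body d)) m0 S (20 + nest_time h 40 d) (fun m =>
    [/\ forall A, m (haar_cell d off A) = m0 (haar_cell d off A) + contrib h x A,
        forall j, (j < 10 + d)%N -> m j = m0 j &
        forall k, m (table d + 2 * k)%N = m0 (table d + 2 * k)%N]).
Proof.
move=> c0.
have base : Inv_add m0 [::] m0 by move=> j _; rewrite big_nil addr0.
apply: runs_weaken (pass_spec (body := add_body d) (tb := 40) (Inv := Inv_add m0) _ _ _ base) _ _ => //.
- by move=> L m m' fr IL j hj; rewrite fr // IL.
- by move=> L m; apply: add_context.
- move=> L l m IL al hl l0; have [c4 c5 c6 c9 cp] := add_context c0 IL.
  have ea := evals_addr c5 c6 al; have hlt := haar_cell_lt hl.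
  have [_ _ _ e3] := al.
  apply: (runs_store ea) => //.
    apply: evals_op; first exact: evals_cell ea _ _.
    by apply: evals_var_eq e3; exact (level_lt S_big (leqnn d) (isT : 3 < 8)%N).
  split=> j hj; last first.
    rewrite set_other //; apply/eqP => jE; move: hj; rewrite jE /loop_cell /haar_cell.
    by clear; lia.
  rewrite big_rcons /=.
  have [->|ne] := eqVneq j (haar_cell d off (code h l)); last first.
    by rewrite set_other ?(negbTE ne) // mul0r addr0 IL.
  rewrite set_same mul1r IL; last by apply: not_loop; rewrite /haar_cell -addnA leq_addr orbT.
  by rewrite addrA.
- move=> m IL; split=> [A|j hj|k].
  + rewrite IL; last by apply: not_loop; rewrite /haar_cell -addnA leq_addr orbT.
    by congr (_ + _); apply: eq_bigr => l _; rewrite haar_cell_eq eq_sym.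
  + rewrite IL; last by apply: not_loop; rewrite hj.
    by rewrite big1 ?addr0 // => l _; rewrite not_haar // mul0r.
  + rewrite IL; last by apply: not_loop; rewrite leq_addr orbT.
    by rewrite big1 ?addr0 // => l _; rewrite even_not_haar mul0r.
Qed.

Let Inv_eval m0 L m : Prop :=
  [/\ forall j, ~~ loop_cell d j -> j != (7 + d)%N -> j != (8 + d)%N -> m j = m0 j,
      m (7 + d)%N = m0 (7 + d)%N
        + \sum_(l <- L) Num.sg (- m0 (haar_cell d off (code h l))) * l.2 &
      m (8 + d)%N = m0 (8 + d)%N + (size L)%:R].

Let eval_context m0 L m : context m0 -> Inv_eval m0 L m -> context m.
Proof.
move=> [c4 c5 c6 c9 cp] [E _ _].
split; first (by rewrite E //; try (by rewrite /loop_cell; clear; lia); clear; lia).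
- by rewrite E //; try (by rewrite /loop_cell; clear; lia); clear; lia.
- by rewrite E //; try (by rewrite /loop_cell; clear; lia); clear; lia.
- by rewrite E //; try (by rewrite /loop_cell; clear; lia); clear; lia.
- move=> i id; rewrite E ?cp //; last (by rewrite /table; clear; lia); last by rewrite /table; clear; lia.
  by rewrite /loop_cell; clear; lia.
Qed.

Lemma pass_eval m0 : context m0 ->
  runs (pass d (eval_body d)) m0 S (20 + nest_time h 80 d) (fun m =>
    [/\ forall j, ~~ loop_cell d j -> j != (7 + d)%N -> j != (8 + d)%N -> m j = m0 j,
      m (7 + d)%N = m0 (7 + d)%N
        + \sum_(l <- live_leaves h x) Num.sg (- m0 (haar_cell d off (code h l))) * l.2 &
      m (8 + d)%N = m0 (8 + d)%N + (haar_weight d h)%:R]).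
Proof.
move=> c0; rewrite -(size_live_leaves h x d0).
have base : Inv_eval m0 [::] m0 by split=> //; rewrite ?big_nil addr0.
apply: runs_weaken (pass_spec (body := eval_body d) (tb := 80) (Inv := Inv_eval m0) _ _ _ base) _ _ => //.
- move=> L m m' fr [h1 h2 h3]; split.
  + by move=> j hj j7 j8; rewrite fr // h1.
  + by rewrite fr // /loop_cell; clear; lia.
  + by rewrite fr // /loop_cell; clear; lia.
- by move=> L m; apply: eval_context.
move=> L l m IL al hl l0; have [c4 c5 c6 c9 cp] := eval_context c0 IL.
have [h1 h2 h3] := IL.
have hlt := haar_cell_lt hl; have [_ _ _ e3] := al.
have lt7 : (7 + d < S)%N by apply: (scalar_lt S_big).
have lt8 : (8 + d < S)%N by apply: (scalar_lt S_big).
apply: runs_seq_set; [apply: evals_op; [exact: evals_var|exact: evals_const]|exact: lt8|by []|].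
set m1 := set_cell _ _ _.
have al1 : at_level d d l m1 by case: al => *; rewrite /m1; split; rd.
have c51 : m1 (5 + d)%N = (2 ^ h - 1)%N%:R by rewrite /m1; rd.
have c61 : m1 (6 + d)%N = off%:R by rewrite /m1; rd.
have ea := evals_addr c51 c61 al1.
have ec := evals_cell ea (erefl _) hlt.
have mc : m1 (haar_cell d off (code h l)) = m0 (haar_cell d off (code h l)).
  rewrite /m1 set_other; last by apply/eqP; rewrite /haar_cell /table; clear; lia.
  apply: h1; first by rewrite /loop_cell /haar_cell; clear; lia.
    by apply/eqP; rewrite /haar_cell /table; clear; lia.
  by apply/eqP; rewrite /haar_cell /table; clear; lia.
have e31 : m1 (level d d 3) = l.2 by rewrite /m1; rd.
have e71 : m1 (7 + d)%N = m (7 + d)%N by rewrite /m1; rd.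
have done v : v = Num.sg (- m0 (haar_cell d off (code h l))) * l.2 ->
    Inv_eval m0 (rcons L l) (set_cell m1 (7 + d) (m1 (7 + d)%N + v)) /\
    forall j, loop_cell d j -> set_cell m1 (7 + d) (m1 (7 + d)%N + v) j = m j.
  move=> ->; split; last first.
    move=> j hj; rewrite /m1 !set_other //;
    by apply/negP => /eqP jE; move: hj; rewrite jE /loop_cell; clear; lia.
  split.
  - by move=> j hj j7 j8; rewrite /m1 !set_other ?(negbTE j7) ?(negbTE j8) // h1.
  - by rewrite set_same e71 h2 big_rcons /= addrA.
  - by rewrite /m1; rd; rewrite h3 size_rcons /= -addrA natr1.
have e3S := evals_var_eq (level_lt S_big (leqnn d) (isT : 3 < 8)%N) e31.
have e7S := evals_var m1 lt7.
rewrite mc in ec.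
apply: (@runs_if _ _ _ _ _ _ _ _ _ 50); [exact: ec|exact: evals_const|by []|].
case: ltP => [neg|nneg].
  apply: runs_set; [exact: evals_op e7S e3S|exact: lt7|by []|].
  by apply: done; rewrite gtr0_sg ?mul1r // oppr_gt0.
apply: (@runs_if _ _ _ _ _ _ _ _ _ 10); [exact: evals_const|exact: ec|by []|].
case: ltP => [pos|npos].
  apply: runs_set; [exact: evals_op e7S e3S|exact: lt7|by []|].
  rewrite /apply_op -mulN1r; apply: done.
  by rewrite ltr0_sg // oppr_lt0.
have z : m0 (haar_cell d off (code h l)) = 0 by apply/eqP; rewrite eq_le npos.
(* A pairing equal to 0 contributes sgn(0) = 0, and leaving the memory as it is amounts to storing
   the same sum again. *)
have := done 0; rewrite z oppr0 sgr0 mul0r => /(_ erefl).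
have -> : set_cell m1 (7 + d) (m1 (7 + d)%N + 0) = m1.
  by apply: boolp.funext => j; rewrite /set_cell addr0; case: eqP => // ->.
by move=> Q; apply: runs_skip.
Qed.

End Passes.

(** * The overseer *)

Definition point_addr (d i : nat) : expr :=
  Op Add (Const (table d)) (Op Mul (Const 2)
    (Op Add (Op Mul (Const d) (var (9 + d))) (Const i))).

Fixpoint copy_from (d k i : nat) : cmd :=
  if k is k'.+1 then
    Seq (Store (point_addr d i) (var (3 + i))) (copy_from d k' i.+1)
  else Skip.

Definition add_pass (d : nat) : cmd := pass d (add_body d).

Definition pow_expr (d : nat) (e : expr) : expr := iter d (Op Mul e) (Const 1).

Definition rebuild_loop (d : nat) : cmd :=
  WhileLt (var (9 + d)) (var (3 + d))
    (Seq (add_pass d) (Store (Const (9 + d)) (Op Add (var (9 + d)) (Const 1)))).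

(* The new table starts just above the old one, where all the cells still
   contain 0. *)
Definition rebuild (d : nat) : cmd :=
  Seq (Store (Const (6 + d)) (Op Add (var (6 + d))
        (Op Mul (pow_expr d (Op Add (var (4 + d)) (Const 1))) (Op Add (var (5 + d)) (Const 1)))))
  (Seq (Store (Const (4 + d)) (Op Add (var (4 + d)) (Const 1)))
  (Seq (Store (Const (5 + d)) (Op Add (Op Mul (Const 2) (var (5 + d))) (Const 1)))
  (Seq (Store (Const (9 + d)) (Const 0)) (rebuild_loop d)))).

(** At the first sample the cell 8 + d contains 0; the quotient by 0 is 0 for the machine as in
    [haar_density], which gives the density 1. *)
Definition threshold_expr (d : nat) : expr :=
  Op Defs.Sub (Op Add (Const 1)
    (Op Mul (Op Div (var 0) (Op Mul (Const 2) (var (8 + d)))) (var (7 + d))))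
    (Op Div (var 0) (Const 2)).

(** The current point is written provisionally in the next free slot, where the pass reads it;
    [haar_update] overwrites that slot with the selected point. *)
Definition haar_decide (d : nat) : cmd :=
  Seq (Store (Const (9 + d)) (var (3 + d)))
  (Seq (copy_from d d 0)
  (Seq (IfLt (Op Add (var (3 + d)) (Const 1))
         (Op Mul (Const 2) (Op Add (var (5 + d)) (Const 1))) Skip (rebuild d))
  (Seq (Store (Const (7 + d)) (Const 0))
  (Seq (Store (Const (8 + d)) (Const 0))
  (Seq (pass d (eval_body d))
  (IfLt (threshold_expr d) (var 1) (Store (Const 2) (Const 1)) (Store (Const 2) (Const 0)))))))).

Definition haar_update (d : nat) : cmd :=
  Seq (Store (Const (9 + d)) (var (3 + d)))
  (Seq (copy_from d d 0)
  (Seq (add_pass d) (Store (Const (3 + d)) (Op Add (var (3 + d)) (Const 1))))).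

Section Overseer.
Context {R : realType}.
Variables (d : nat) (beta : R) (z0 : d.-tuple R).
Implicit Types (m : @memory R) (x z : d.-tuple R) (pts zs : seq (d.-tuple R)).

Hypothesis d0 : (0 < d)%N.

Definition stored pts m : Prop := forall j i, (j < size pts)%N -> (i < d)%N ->
  m (table d + 2 * (d * j + i))%N = coord (nth z0 pts j) i.

Definition tallied h off zs m : Prop :=
  forall A, m (haar_cell d off A) = \sum_(z <- zs) contrib h z A.

(** Storing 2^h - 1 instead of 2^h makes the initial memory, which is 0 except for beta, a correct
    state with h = 0. *)
Definition registers (N h off : nat) m : Prop :=
  [/\ m 0%N = beta, m (3 + d)%N = N%:R, m (4 + d)%N = h%:R,
      m (5 + d)%N = (2 ^ h - 1)%N%:R & m (6 + d)%N = off%:R].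

(** [pts] may exceed the [N] samples by the provisional point, and [zs] lists the points already
    entered in the table. *)
Definition state pts N zs h off m : Prop :=
  [/\ registers N h off m, stored pts m & tallied h off zs m].

Lemma state_frame pts N zs h off m m' :
  (forall j, [|| j == 0%N, (3 + d <= j < 7 + d)%N | (table d <= j)%N] -> m' j = m j) ->
  state pts N zs h off m -> state pts N zs h off m'.
Proof.
move=> fr [[r0 r3 r4 r5 r6] st ta]; split.
- by split; rewrite fr ?orbT //; apply/or3P; apply: Or32; clear; lia.
- by move=> j i hj hi; rewrite fr ?st // leq_addr !orbT.
- by move=> A; rewrite fr ?ta // /haar_cell -addnA leq_addr !orbT.
Qed.

Lemma copy_spec k i J S x m : (i + k = d)%N -> (table d + 2 * (d * J + d) <= S)%N ->
  m (9 + d)%N = J%:R -> (forall i, (i < d)%N -> m (3 + i)%N = coord x i) ->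
  runs (copy_from d k i) m S (30 * k) (fun m' =>
    (forall i', (i <= i' < d)%N -> m' (table d + 2 * (d * J + i'))%N = coord x i') /\
    forall j, ~~ [exists i' : 'I_d, (i <= i')%N && (j == table d + 2 * (d * J + i'))%N] ->
      m' j = m j).
Proof.
move=> + hS; elim: k i m => [|k IH] i m ik mJ mx.
  apply: runs_skip; split=> // i' /andP[h1 h2].
  by have := leq_ltn_trans h1 h2; clear -ik; lia.
have id : (i < d)%N by rewrite -ik addnS ltnS leq_addr.
have S_big : (table d <= S)%N by apply: leq_trans hS; rewrite leq_addr.
have ea : evals m (point_addr d i) (table d + 2 * (d * J + i))%:R S.
  apply: evals_op_eq; first exact: evals_const.
    apply: evals_op; first exact: evals_const.
    apply: evals_op; last exact: evals_const.
    apply: evals_op; first exact: evals_const.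
    by apply: evals_var_eq mJ; apply: (scalar_lt S_big).
  by rewrite /apply_op -natrM -natrD -natrM -natrD.
have lt : (table d + 2 * (d * J + i) < S)%N by apply: leq_trans hS; clear -id; lia.
apply: (runs_seq (t1 := 30) (t2 := 30 * k)); last by rewrite mulnS.
apply: (runs_store ea (erefl _) lt).
- by apply: evals_var_eq (mx _ id); apply: leq_trans S_big; rewrite /table; clear -id; lia.
- by [].
set m1 := set_cell _ _ _.
have m1E j : (j < table d)%N -> m1 j = m j.
  by move=> hj; rewrite /m1 set_other //; apply/eqP; clear -hj; lia.
have mJ1 : m1 (9 + d)%N = J%:R by rewrite m1E // /table; clear; lia.
have mx1 i' : (i' < d)%N -> m1 (3 + i')%N = coord x i'.
  by move=> hi; rewrite m1E ?mx // /table; clear -hi; lia.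
apply: runs_weaken (IH i.+1 m1 (etrans (addSnnS i k) ik) mJ1 mx1) (leqnn _) _.
move=> m' [h1 h2]; split.
  move=> i' /andP[]; rewrite leq_eqVlt => /orP[/eqP <- _|ii' hi']; last by rewrite h1 // ii'.
  rewrite h2 ?/m1 ?set_same //; apply/existsPn => i2; apply/negP => /andP[hi2 /eqP].
  by clear -hi2; lia.
move=> j /existsPn hj; rewrite h2; last first.
  by apply/existsPn => i2; apply: contra (hj i2) => /andP[h3 ->]; rewrite ltnW.
rewrite /m1 set_other //; have := hj (Ordinal id).
by rewrite /= leqnn => /negbTE.
Qed.

Lemma copy_state S x m zs N h off zs' : (table d + 2 * (d * size zs + d) <= S)%N ->
  m (9 + d)%N = (size zs)%:R -> (forall i, (i < d)%N -> m (3 + i)%N = coord x i) ->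
  state zs N zs' h off m ->
  runs (copy_from d d 0) m S (30 * d) (fun m' => state (rcons zs x) N zs' h off m' /\
    forall j, (j < table d)%N -> m' j = m j).
Proof.
move=> hS mJ mx [[r0 r3 r4 r5 r6] st ta].
apply: runs_weaken (copy_spec (add0n d) hS mJ mx) (leqnn _) _ => m' [h1 h2].
have low j : (j < table d)%N -> m' j = m j.
  move=> hj; apply: h2; apply/existsPn => i'; apply/negP => /= /eqP.
  by clear -hj; lia.
have lowc c : (c < 10)%N -> m' (c + d)%N = m (c + d)%N.
  by move=> c10; rewrite low // /table; clear -c10; lia.
split=> //; split.
- by split; rewrite ?lowc // low.
- move=> j i; rewrite size_rcons ltnS leq_eqVlt => /orP[/eqP ->|haar_itv] hi.
    by rewrite nth_rcons ltnn eqxx h1.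
  rewrite nth_rcons haar_itv h2 ?st //; apply/existsPn => i'; apply/negP => /= /eqP e.
  have {e} : (d * j + i = d * size zs + i')%N by clear -e; lia.
  move=> e; have := mulD_inj hi (ltn_ord i') (_ : j * d + i = size zs * d + i')%N.
  by rewrite ![(_ * d)%N]mulnC => /(_ e) [js]; rewrite js ltnn in haar_itv.
- move=> A; rewrite h2 ?ta //; apply/existsPn => i'; apply/negP => /= /eqP.
  by rewrite /haar_cell; clear; lia.
Qed.

Lemma state_context pts N zs h off J m : (J < size pts)%N -> m (9 + d)%N = J%:R ->
  state pts N zs h off m -> context h J off (nth z0 pts J) m.
Proof. by move=> Jp mJ [[r0 r3 r4 r5 r6] st _]; split=> // i id; apply: st. Qed.

Lemma add_pass_spec S pts N zs h off J m : (forall z, z \in pts -> in_cube z) ->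
  (table d + 2 * (d * J + d) <= S)%N -> (haar_cell d off (h.+1 ^ d * 2 ^ h) <= S)%N ->
  (J < size pts)%N -> m (9 + d)%N = J%:R -> state pts N zs h off m ->
  runs (add_pass d) m S (20 + nest_time h 40 d) (fun m' =>
    state pts N (rcons zs (nth z0 pts J)) h off m' /\
    forall j, (j < 10 + d)%N -> m' j = m j).
Proof.
move=> cube S1 S2 Jp mJ sm; have cx := state_context Jp mJ sm.
have xc : in_cube (nth z0 pts J) by apply: cube; apply: mem_nth.
have [[r0 r3 r4 r5 r6] st ta] := sm.
apply: runs_weaken (pass_add d0 xc S1 S2 cx) (leqnn _) _ => m' [h1 h2 h3].
split=> //; split.
- by split; rewrite h2 //; clear; lia.
- by move=> j i hj hi; rewrite h3 st.
- by move=> A; rewrite h1 ta big_rcons.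
Qed.

Lemma rebuild_loop_spec S zs x h off : (forall z, z \in rcons zs x -> in_cube z) ->
  (table d + 2 * (d * size zs + d) <= S)%N -> (haar_cell d off (h.+1 ^ d * 2 ^ h) <= S)%N ->
  forall r j m, (j + r = size zs)%N -> m (9 + d)%N = j%:R ->
  state (rcons zs x) (size zs) (take j zs) h off m ->
  runs (rebuild_loop d) m S (10 + r * (40 + nest_time h 40 d)) (fun m' =>
    [/\ state (rcons zs x) (size zs) zs h off m', m' (9 + d)%N = (size zs)%:R &
        forall j, (j < 3 + d)%N -> m' j = m j]).
Proof.
move=> cube S1 S2; have S_big : (table d <= S)%N by apply: leq_trans S1; rewrite leq_addr.
elim=> [|r IH] j m jr mj sm; have [[r0 r3 r4 r5 r6] st ta] := sm.
  rewrite addn0 in jr.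
  apply: (runs_while_stop _ (evals_var_eq (scalar_lt S_big (isT : 9 < 18)%N) mj)
    (evals_var_eq (scalar_lt S_big (isT : 3 < 18)%N) r3)) => //.
    by rewrite jr ltxx.
  by move: sm mj; rewrite jr take_size.
have haar_itv : (j < size zs)%N by rewrite -jr addnS ltnS leq_addr.
apply: (runs_while_loop (t1 := 30 + nest_time h 40 d) (t2 := 10 + r * (40 + nest_time h 40 d))
  (evals_var_eq (scalar_lt S_big (isT : 9 < 18)%N) mj)
  (evals_var_eq (scalar_lt S_big (isT : 3 < 18)%N) r3)).
- by rewrite mulSn /=; move: (nest_time _ _ _) (r * _)%N => t u; clear; lia.
- by rewrite ltr_nat.
have jp : (j < size (rcons zs x))%N by rewrite size_rcons ltnW.
apply: (runs_seq (t1 := 20 + nest_time h 40 d) (t2 := 10)); last by clear; lia.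
have Sj : (table d + 2 * (d * j + d) <= S)%N.
  by apply: leq_trans S1; rewrite leq_add2l leq_mul2l /= leq_add2r leq_mul2l ltnW ?orbT.
apply: runs_weaken (add_pass_spec cube Sj S2 jp mj sm) (leqnn _) _ => m1 [sm1 low1].
have mj1 : m1 (9 + d)%N = j%:R by rewrite low1 ?mj //; clear; lia.
apply: (runs_set (v := j.+1%:R)).
- apply: evals_op_eq; last by rewrite -natr1.
    by apply: evals_var_eq mj1; apply: scalar_lt.
  exact: evals_const.
- exact: scalar_lt.
- by [].
have jr' : (j.+1 + r = size zs)%N by rewrite addSnnS.
set m2 := set_cell _ _ _.
have low2 i : i != (9 + d)%N -> m2 i = m1 i by move=> /negbTE hi; rewrite /m2 set_other.
apply: runs_weaken (IH j.+1 m2 jr' _ _) (leqnn _) _.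
- by rewrite /m2 set_same.
- apply: (@state_frame _ _ _ _ _ m1).
    by move=> i hi; apply: low2; move: hi; rewrite /table; clear; lia.
  move: sm1; rewrite nth_rcons haar_itv.
  by rewrite (take_nth z0 haar_itv).
move=> m3 [s3 e3 l3]; split=> // i hi.
rewrite l3 // low2 ?low1 //; first by clear -hi; lia.
by clear -hi; lia.
Qed.

Lemma evals_pow S m e (k : nat) n : evals m e k%:R S -> evals m (pow_expr n e) (k ^ n)%N%:R S.
Proof.
move=> he; elim: n => [|n IH]; first exact: evals_const.
by rewrite /pow_expr iterS; apply: evals_op_eq he IH _; rewrite expnS natrM.
Qed.

Lemma pow_expr_cost n e : expr_cost (pow_expr n e) = (n * (expr_cost e).+1 + 1)%N.
Proof. by elim: n => //= n ->; rewrite mulSn; lia. Qed.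

Lemma registers_evals S N h off m : (table d <= S)%N -> registers N h off m ->
  [/\ evals m (var (3 + d)) N%:R S, evals m (var (4 + d)) h%:R S,
      evals m (Op Add (var (4 + d)) (Const 1)) h.+1%:R S,
      evals m (Op Add (var (5 + d)) (Const 1)) (2 ^ h)%N%:R S &
      evals m (var (6 + d)) off%:R S].
Proof.
move=> S_big [r0 r3 r4 r5 r6].
have e4 : evals m (var (4 + d)) h%:R S by apply: evals_var_eq r4; apply: scalar_lt.
split=> //.
- by apply: evals_var_eq r3; apply: scalar_lt.
- by apply: evals_op_eq e4 (evals_const _ _ _) _; rewrite /apply_op natr1.
- apply: (@evals_op_eq _ _ _ _ _ _ (2 ^ h - 1)%N%:R 1); last first.
  + by rewrite /apply_op natr1 -subSn ?expn_gt0 // subn1.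
  + exact: evals_const.
  + by apply: evals_var_eq r5; apply: scalar_lt.
- by apply: evals_var_eq r6; apply: scalar_lt.
Qed.

Definition region (h : nat) : nat := (h.+1 ^ d * 2 ^ h)%N.

Lemma rebuild_spec S zs x h off m : (forall z, z \in rcons zs x -> in_cube z) ->
  (table d + 2 * (d * size zs + d) <= S)%N ->
  (haar_cell d (off + region h) (region h.+1) <= S)%N ->
  state (rcons zs x) (size zs) zs h off m ->
  runs (rebuild d) m S (100 + 10 * d + size zs * (40 + nest_time h.+1 40 d)) (fun m' =>
    [/\ state (rcons zs x) (size zs) zs h.+1 (off + region h) m',
        m' (9 + d)%N = (size zs)%:R & forall j, (j < 3 + d)%N -> m' j = m j]).
Proof.
move=> cube S1 S2 [rg st ta]; have S_big : (table d <= S)%N by apply: leq_trans S1; rewrite leq_addr.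
have lt c : (c < 18)%N -> (c + d < S)%N by apply: scalar_lt.
have [e3 e4 e41 e51 e6] := registers_evals S_big rg.
have [r0 r3 r4 r5 r6] := rg.
set TL := nest_time _ _ _.
apply: (runs_seq (t1 := 30 + 5 * d) (t2 := 70 + 5 * d + size zs * (40 + TL))); last by clear; lia.
apply: runs_set.
- by apply: evals_op e6 (evals_op _ (evals_pow d e41) e51).
- exact: lt.
- by rewrite /= pow_expr_cost /=; clear; lia.
apply: runs_seq_set; [exact: evals_op (evals_var _ (lt 4%N isT)) (evals_const _ _ _)|exact: lt| |].
  by rewrite /=; clear; lia.
apply: runs_seq_set.
- apply: evals_op; last exact: evals_const.
  by apply: evals_op; [exact: evals_const|apply: evals_var; apply: lt].
- exact: lt.
- by rewrite /=; clear; lia.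
apply: runs_seq_set; [exact: evals_const|exact: lt| |].
  by rewrite /=; clear; lia.
set m1 := set_cell _ _ _.
have other j : ~~ ((4 + d <= j < 7 + d) || (j == 9 + d))%N -> m1 j = m j.
  move=> hj; rewrite /m1 !set_other //;
  by apply/negP => /eqP jE; move: hj; rewrite jE; clear; lia.
have sm1 : state (rcons zs x) (size zs) (take 0 zs) h.+1 (off + region h) m1.
  split.
  - rewrite /m1 /apply_op; split; rd; rewrite ?r0 ?r3 ?r4 ?r5 ?r6 ?natr1 //.
      rewrite -[2%:R * _]natrM natr1; congr (_%:R); rewrite expnS.
      have : (0 < 2 ^ h)%N by rewrite expn_gt0.
      by move: (2 ^ h)%N; clear; lia.
    by rewrite -natrM -natrD.
  - move=> j i hj hi; rewrite other ?st //.
    by rewrite /table; clear; lia.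
  - move=> A; rewrite take0 big_nil other; last by rewrite /haar_cell /table; clear; lia.
    rewrite (_ : haar_cell d (off + region h) A = haar_cell d off (region h + A)); last first.
      by rewrite /haar_cell addnA.
    rewrite ta big_seq big1 // => z zz.
    by apply: contrib_big; rewrite ?leq_addr //; apply: cube; rewrite mem_rcons inE zz orbT.
have mj1 : m1 (9 + d)%N = 0%:R by rewrite /m1; rd.
apply: runs_weaken (rebuild_loop_spec cube S1 S2 (add0n (size zs)) mj1 sm1) _ _.
  by rewrite /= -/TL; clear; lia.
move=> m2 [h1 h2 h3]; split=> // j hj; rewrite h3 // other //.
by clear -hj; lia.
Qed.

Lemma eval_sum zs h off x m : (forall z, z \in zs -> in_cube z) -> in_cube x ->
  tallied h off zs m ->
  \sum_(l <- live_leaves h x) Num.sg (- m (haar_cell d off (code h l))) * l.2 =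
  \sum_(K \in haar_set R 1 h%:Z) Num.sg (pairing zs (fun y => - haar K y)) * haar K x.
Proof.
move=> cube hx ta; rewrite haar_sum // sum_live_leaves big_seq_cond [RHS]big_seq_cond.
apply: eq_bigr => v /andP[vs v0]; rewrite ta pairing_opp; congr (Num.sg (- _) * _).
rewrite /pairing big_seq [RHS]big_seq; apply: eq_bigr => z zz.
by apply: contrib_haar => //; apply: cube.
Qed.

(** Tables are laid end to end; the doubling keeps the offset, which is the total size of the former
    ones, at most the size of the current one. *)
Lemma region_double h : (region h + region h <= region h.+1)%N.
Proof.
by rewrite /region expnS addnn -mul2n mulnCA leq_mul2r leq_exp2r // leqnSn orbT.
Qed.

Definition decide_time n h : nat :=
  (500 + 50 * d + (if n.+1 == 2 ^ h then n * (40 + nest_time h 40 d) else 0)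
   + nest_time h 80 d)%N.

(** The factor 4 covers the offset and the table, each at most one region, at every second cell. *)
Definition enough_space S n : Prop :=
  (table d + 2 * (d * n + d) <= S)%N /\ (table d + 1 + 4 * region (trunc_log 2 n.+1) <= S)%N.

Lemma haar_cell_space S h off : (off <= region h)%N ->
  (table d + 1 + 4 * region h <= S)%N -> (haar_cell d off (region h) <= S)%N.
Proof. by move=> o s; apply: leq_trans s; rewrite /haar_cell; lia. Qed.

Lemma grow_spec S zs x m off0 : let n := size zs in let h := trunc_log 2 n.+1 in
  (forall z, z \in rcons zs x -> in_cube z) -> enough_space S n ->
  (off0 <= region (trunc_log 2 n))%N -> m (9 + d)%N = n%:R ->
  state (rcons zs x) n zs (trunc_log 2 n) off0 m ->
  runs (IfLt (Op Add (var (3 + d)) (Const 1))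
         (Op Mul (Const 2) (Op Add (var (5 + d)) (Const 1))) Skip (rebuild d)) m S
    (150 + 10 * d + (if n.+1 == 2 ^ h then n * (40 + nest_time h 40 d) else 0))%N
    (fun m' => exists off, [/\ state (rcons zs x) n zs h off m', (off <= region h)%N,
       m' (9 + d)%N = n%:R & forall j, (j < 3 + d)%N -> m' j = m j]).
Proof.
move=> n h cube [S1 S2] o0 mJ sm; set h0 := trunc_log 2 n in o0 sm.
have S_big : (table d <= S)%N by apply: leq_trans S1; rewrite leq_addr.
have [rg st ta] := sm; have [e3 e4 e41 e51 e6] := registers_evals S_big rg.
have nlt : (n < 2 ^ h0.+1)%N by apply: trunc_log_ltn.
have nge : (2 ^ h0 <= n.+1)%N.
  by rewrite /h0; case: (n) => [|k]; [rewrite trunc_log0|apply: leqW; apply: trunc_logP].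
apply: (runs_if (v1 := n.+1%:R) (v2 := (2 ^ h0.+1)%N%:R)
  (t := (100 + 10 * d + (if n.+1 == 2 ^ h then n * (40 + nest_time h 40 d) else 0))%N)).
- by apply: evals_op_eq e3 (evals_const _ _ _) _; rewrite /apply_op natr1.
- by apply: evals_op_eq (evals_const _ _ _) e51 _; rewrite /apply_op -natrM expnS.
- by rewrite /=; move: (if _ then _ else _) => t; clear; lia.
rewrite ltr_nat; case: ltnP => lt.
  have hE : h = h0 by apply: trunc_log_eq; rewrite // nge.
  by apply: runs_skip; exists off0; rewrite hE; split.
have nE : n.+1 = (2 ^ h0.+1)%N by apply/eqP; rewrite eqn_leq lt andbT.
have hE : h = h0.+1 by rewrite /h nE trunc_expnK.
have or : (off0 + region h0 <= region h)%N.
  by rewrite hE; apply: leq_trans (region_double h0); rewrite leq_add2r.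
apply: runs_weaken (rebuild_spec cube S1 _ sm) _ _.
- by have := @haar_cell_space S h _ or S2; rewrite hE.
- by rewrite {1}nE hE eqxx.
by move=> m' [h1 h2 h3]; exists (off0 + region h0)%N; rewrite {1}hE; split.
Qed.

Lemma decide_spec S zs x (u : R) m off0 : let n := size zs in let h := trunc_log 2 n.+1 in
  (forall z, z \in rcons zs x -> in_cube z) -> enough_space S n ->
  (off0 <= region (trunc_log 2 n))%N ->
  state zs n zs (trunc_log 2 n) off0 m -> m 1%N = u ->
  (forall i, (i < d)%N -> m (3 + i)%N = coord x i) ->
  runs (haar_decide d) m S (decide_time n h) (fun m' => exists off,
    [/\ state zs n zs h off m', (off <= region h)%N &
        (m' 2%N != 0) = (haar_strategy beta zs x < u)]).
Proof.
move=> n h cube sp o0 sm mu mx; have [S1 S2] := sp.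
have S_big : (table d <= S)%N by apply: leq_trans S1; rewrite leq_addr.
have lt c : (c < 18)%N -> (c + d < S)%N by apply: scalar_lt.
have lt0 c : (c < 18)%N -> (c < S)%N by move=> /lt; apply: leq_ltn_trans; rewrite leq_addr.
have [[r0 r3 r4 r5 r6] st ta] := sm.
have zc z : z \in zs -> in_cube z by move=> zz; apply: cube; rewrite mem_rcons inE zz orbT.
have xc : in_cube x by apply: cube; rewrite mem_rcons inE eqxx.
rewrite /decide_time; set tg := (if _ then _ else _).
apply: runs_seq_set; [exact: evals_var_eq (lt 3%N isT) r3|exact: lt| |].
  by rewrite /=; clear; lia.
set m1 := set_cell _ _ _.
have m1E j : j != (9 + d)%N -> m1 j = m j by move=> /negbTE hj; rewrite /m1 set_other.
have sm1 : state zs n zs (trunc_log 2 n) off0 m1.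
  by apply: state_frame sm => j hj; apply: m1E; move: hj; rewrite /table; clear; lia.
have mJ1 : m1 (9 + d)%N = n%:R by rewrite /m1 set_same.
have mx1 i : (i < d)%N -> m1 (3 + i)%N = coord x i.
  by move=> id; rewrite m1E ?mx //; clear -id; lia.
apply: (runs_seq (t1 := (30 * d)%N) (t2 := (460 + 20 * d + tg + nest_time h 80 d)%N)); last first.
  by rewrite /=; clear; lia.
apply: runs_weaken (copy_state S1 mJ1 mx1 sm1) (leqnn _) _ => m2 [sm2 low2].
have mJ2 : m2 (9 + d)%N = n%:R by rewrite low2 // /table; clear; lia.
apply: (runs_seq (t1 := (150 + 10 * d + tg)%N) (t2 := (310 + 10 * d + nest_time h 80 d)%N)); last first.
  by clear; lia.
apply: runs_weaken (grow_spec cube sp o0 mJ2 sm2) (leqnn _) _.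
move=> m3 [off [sm3 oh mJ3 low3]].
apply: runs_seq_set; [exact: evals_const|exact: lt| |].
  by rewrite /=; clear; lia.
apply: runs_seq_set; [exact: evals_const|exact: lt| |].
  by rewrite /=; clear; lia.
set m4 := set_cell _ _ _.
have m4E j : j != (7 + d)%N -> j != (8 + d)%N -> m4 j = m3 j.
  by move=> /negbTE hj /negbTE hj'; rewrite /m4 !set_other.
have sm4 : state (rcons zs x) n zs h off m4.
  by apply: state_frame sm3 => j hj; apply: m4E; move: hj; rewrite /table; clear; lia.
have mJ4 : m4 (9 + d)%N = n%:R by rewrite /m4; rd.
have np : (n < size (rcons zs x))%N by rewrite size_rcons.
have := state_context np mJ4 sm4; rewrite nth_rcons ltnn eqxx => cx4.
apply: (runs_seq (t1 := (20 + nest_time h 80 d)%N) (t2 := (200 + 10 * d)%N)); last first.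
  by rewrite /=; clear; lia.
apply: runs_weaken (pass_eval d0 xc S1 (haar_cell_space oh S2) cx4) (leqnn _) _.
move=> m5 [h51 h57 h58].
have sm5 : state (rcons zs x) n zs h off m5.
  apply: state_frame sm4 => j hj; apply: h51; move: hj; rewrite /table ?/loop_cell /table; clear; lia.
have e0 : m5 0%N = beta by have [[]] := sm5.
have [_ _ ta3] := sm3.
have e7 : m5 (7 + d)%N = \sum_(K \in haar_set R 1 h%:Z)
    Num.sg (pairing zs (fun y => - haar K y)) * haar K x.
  rewrite h57 -(eval_sum zc xc ta3) (_ : m4 (7 + d)%N = 0) ?add0r; last by rewrite /m4; rd.
  apply: eq_bigr => l _; rewrite m4E //; rewrite /haar_cell /table; clear; lia.
have e8 : m5 (8 + d)%N = (haar_weight d h)%:R.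
  by rewrite h58 (_ : m4 (8 + d)%N = 0) ?add0r // /m4; rd.
have e1 : m5 1%N = u.
  rewrite h51 ?/loop_cell; try by clear; lia.
  rewrite m4E; try by clear; lia.
  rewrite low3; last by clear; lia.
  rewrite low2; last by rewrite /table; clear; lia.
  by rewrite m1E ?mu //; clear; lia.
have eth : evals m5 (threshold_expr d) (haar_strategy beta zs x) S.
  apply: (@evals_op_eq _ _ _ _ _ _ (haar_density beta n.+1 zs x) (beta / 2)) => //; last first.
    apply: evals_op_eq; [|exact: evals_const|by []].
    by apply: evals_var_eq e0; apply: lt0.
  apply: evals_op_eq; first exact: evals_const.
    apply: evals_op.
      apply: evals_op; first by apply: evals_var_eq e0; apply: lt0.
      apply: evals_op; first exact: evals_const.
      by apply: evals_var_eq e8; apply: lt.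
    by apply: evals_var_eq e7; apply: lt.
  by [].
(* The provisional point leaves the description, since it need not be the selected one. *)
have fin b : state zs n zs h off (set_cell m5 2%N b).
  have [rg5 st5 ta5] := sm5.
  have : state zs n zs h off m5.
    split=> // j i haar_itv id; have := st5 j i.
    by rewrite size_rcons nth_rcons haar_itv; apply=> //; apply: ltnW.
  apply: state_frame => j hj; rewrite set_other //.
  by apply/negP => /eqP jE; move: hj; rewrite jE /table; clear; lia.
apply: (@runs_if _ _ _ _ _ _ _ _ _ 10); [exact: eth|exact: evals_var_eq (lt0 1%N isT) e1| |].
  by rewrite /=; clear; lia.
case: ifP => _.
  apply: runs_set; [exact: evals_const|exact: lt0|by []|].
  by exists off; split=> //; rewrite set_same oner_neq0.
apply: runs_set; [exact: evals_const|exact: lt0|by []|].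
by exists off; split=> //; rewrite set_same eqxx.
Qed.

Definition update_time h : nat := (100 + 30 * d + nest_time h 40 d)%N.

Lemma update_spec S zs x m off : let n := size zs in let h := trunc_log 2 n.+1 in
  (forall z, z \in rcons zs x -> in_cube z) -> enough_space S n ->
  (off <= region h)%N -> state zs n zs h off m ->
  (forall i, (i < d)%N -> m (3 + i)%N = coord x i) ->
  runs (haar_update d) m S (update_time h) (fun m' =>
    state (rcons zs x) n.+1 (rcons zs x) h off m').
Proof.
move=> n h cube [S1 S2] oh sm mx.
have S_big : (table d <= S)%N by apply: leq_trans S1; rewrite leq_addr.
have lt c : (c < 18)%N -> (c + d < S)%N by apply: scalar_lt.
have [[r0 r3 r4 r5 r6] st ta] := sm.
apply: runs_seq_set; [exact: evals_var_eq (lt 3%N isT) r3|exact: lt| |].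
  by rewrite /update_time /=; clear; lia.
set m1 := set_cell _ _ _.
have m1E j : j != (9 + d)%N -> m1 j = m j by move=> /negbTE hj; rewrite /m1 set_other.
have sm1 : state zs n zs h off m1.
  by apply: state_frame sm => j hj; apply: m1E; move: hj; rewrite /table; clear; lia.
have mJ1 : m1 (9 + d)%N = n%:R by rewrite /m1 set_same.
have mx1 i : (i < d)%N -> m1 (3 + i)%N = coord x i.
  by move=> id; rewrite m1E ?mx //; clear -id; lia.
apply: (runs_seq (t1 := (30 * d)%N) (t2 := (60 + nest_time h 40 d)%N)); last first.
  by rewrite /update_time /=; clear; lia.
apply: runs_weaken (copy_state S1 mJ1 mx1 sm1) (leqnn _) _ => m2 [sm2 low2].
have mJ2 : m2 (9 + d)%N = n%:R by rewrite low2 // /table; clear; lia.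
have np : (n < size (rcons zs x))%N by rewrite size_rcons.
apply: (runs_seq (t1 := (20 + nest_time h 40 d)%N) (t2 := 40%N)); last by clear; lia.
apply: runs_weaken (add_pass_spec cube S1 (haar_cell_space oh S2) np mJ2 sm2) (leqnn _) _.
move=> m3; rewrite nth_rcons ltnn eqxx => -[[[q0 q3 q4 q5 q6] st3 ta3] low3].
apply: runs_set.
- by apply: evals_op; [exact: evals_var (lt 3%N isT)|exact: evals_const].
- exact: lt.
- by [].
split.
- by split; rd => //; rewrite /apply_op q3 natr1.
- by move=> j i hj hi; rewrite set_other ?st3 //; apply/eqP; rewrite /table; clear; lia.
- by move=> A; rewrite set_other ?ta3 //; apply/eqP; rewrite /haar_cell /table; clear; lia.
Qed.

End Overseer.

(** * Total time and space *)

Section Costs.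
Variable d : nat.
Hypothesis d0 : (0 < d)%N.

Definition space_bound n : nat :=
  (table d + 1 + 2 * (d * n + d) + 4 * region d (trunc_log 2 n))%N.

Lemma region_le h h' : (h <= h')%N -> (region d h <= region d h')%N.
Proof.
by move=> hh; rewrite /region leq_mul // ?leq_exp2r // leq_exp2l.
Qed.

Lemma space_boundS n : (space_bound n <= space_bound n.+1)%N.
Proof.
have := region_le (leq_trunc_log 2 (leqnSn n)); rewrite /space_bound.
move: (region _ _) (region _ _) => a b; clear; lia.
Qed.

Lemma space_bound_enough n : enough_space d (space_bound n.+1) n.
Proof.
rewrite /enough_space /space_bound; move: (region _ _) => a.
by split; clear; lia.
Qed.

Definition rate : nat := (1000 + 1000 * d)%N.

(* The term [2 * 2 ^ trunc_log 2 n] pays in advance for the next rebuilding. *)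
Definition time_bound n : nat :=
  (rate * (n + 2 * 2 ^ trunc_log 2 n) * (trunc_log 2 n).+1 ^ d)%N.

Lemma time_boundS n :
  (time_bound n + decide_time d n (trunc_log 2 n.+1) + update_time d (trunc_log 2 n.+1)
   + 2 * d.+1 <= time_bound n.+1)%N.
Proof.
rewrite /time_bound; set h := trunc_log 2 n.+1; rewrite /decide_time /update_time.
have N40 := nest_time_le h 40 d; have N80 := nest_time_le h 80 d.
set h0 := trunc_log 2 n; have hh : (h0 <= h)%N by apply: leq_trunc_log.
have XX : (h0.+1 ^ d <= h.+1 ^ d)%N by rewrite leq_exp2r.
have X1 : (0 < h.+1 ^ d)%N by rewrite expn_gt0.
(* When n + 1 = 2^h with n > 0, the rebuilding charges n, while the advance grows from 2^(h0+1) <=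
   2^h to 2^(h+1), that is, by at least n + 1. *)
have step : (n + 2 * 2 ^ h0 + (if n.+1 == 2 ^ h then n else 0) <= n + 2 * 2 ^ h)%N.
  case: eqP => e; last by rewrite addn0 leq_add2l leq_mul2l /= leq_exp2l.
  (* In the first round n + 1 = 2^0 although nothing is rebuilt; the charge is then 0. *)
  have [n0|n0] := posnP n; first by rewrite /h0 n0 addn0 trunc_log0 leq_add2l leq_mul2l /= expn_gt0.
  have h0h : (h0 < h)%N.
    by rewrite -(ltn_exp2l _ _ (isT : 1 < 2)%N) -e ltnS; apply: trunc_logP.
  have : (2 * 2 ^ h0 <= 2 ^ h)%N by rewrite -expnS leq_exp2l.
  move: e; clear; lia.
have -> : (if n.+1 == 2 ^ h then n * (40 + nest_time h 40 d) else 0)%N =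
          ((if n.+1 == 2 ^ h then n else 0) * (40 + nest_time h 40 d))%N.
  by case: ifP.
move: N40 N80 XX X1 step; move: (nest_time h 40 d) (nest_time h 80 d) (if _ then _ else _).
move: (h0.+1 ^ d)%N (h.+1 ^ d)%N (2 ^ h0)%N (2 ^ h)%N => X0 X P0 P t4 t8 g.
clear -d0 => N40 N80 XX X1 step.
have K40 : (40 + t4 <= rate * X)%N.
  apply: leq_trans (leq_add (leq_pmulr 40 X1) N40) _.
  by rewrite [(40 * X)%N]mulnC -mulnDr mulnC leq_mul2r /rate; apply/orP; right; clear; lia.
have K : (500 + 50 * d + t8 + (100 + 30 * d + t4) + 2 * d.+1 <= rate * X)%N.
  apply: (@leq_trans ((600 + 80 * d + 2 * d.+1) * X + X * (40 + 10 + 300 * d) + X * (80 + 10 + 300 * d))%N).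
    have : (600 + 80 * d + 2 * d.+1 <= (600 + 80 * d + 2 * d.+1) * X)%N by rewrite leq_pmulr.
    move: N40 N80; move: (_ * X)%N (X * _)%N (X * _)%N => a b c; clear; lia.
  rewrite [(_ * X)%N]mulnC -!mulnDr mulnC leq_mul2r /rate; apply/orP; right; clear; lia.
apply: (@leq_trans (rate * (n + 2 * P0) * X + g * (rate * X) + rate * X)%N).
  have := leq_mul (leqnn g) K40; have : (rate * (n + 2 * P0) * X0 <= rate * (n + 2 * P0) * X)%N.
    by rewrite leq_mul2l XX orbT.
  move: K; move: (rate * _)%N (rate * _ * X)%N (rate * _ * X0)%N (g * _)%N (g * _)%N => a b c e f.
  clear; lia.
have -> : (rate * (n + 2 * P0) * X + g * (rate * X) + rate * X =
           rate * ((n + 2 * P0 + g).+1) * X)%N.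
  by rewrite mulnS [RHS]mulnDl [(rate * (_ + g))%N]mulnDr mulnDl addnC mulnCA mulnA.
rewrite leq_mul2r leq_mul2l; apply/orP; right; apply/orP; right.
by rewrite addSn ltnS.
Qed.

End Costs.

Lemma oversee_haar {R : realType} (d : nat) (z0 : d.-tuple R) (beta : R) x u n :
  (0 < d)%N -> (forall m, in_cube (x m)) ->
  exists m t s, [/\ oversee (Overseer (haar_decide d) (haar_update d)) beta x u n
      (decisions (haar_strategy beta) x u n) m t s,
    (exists off, state beta z0 (samples (haar_strategy beta) x u n) n
       (samples (haar_strategy beta) x u n) (trunc_log 2 n) off m /\
       (off <= region d (trunc_log 2 n))%N),
    (t <= time_bound d n)%N & (s <= space_bound d n)%N].
Proof.
move=> d0 cube; elim: n => [|n [m [t [s [ov [off [sm offh]] tn sn]]]]].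
  exists (initial_memory beta), 0%N, (point_cell + d)%N; split=> //.
  - exact: oversee_start.
  - exists 0%N; split=> //; split=> //.
    by move=> A; rewrite [RHS]big_nil /initial_memory; case: eqP.
  - by rewrite /space_bound /table /point_cell; clear; lia.
set chi := decisions (haar_strategy beta) x u n in ov *.
set zs := samples (haar_strategy beta) x u n in sm *.
have sz : size zs = n by rewrite size_selected size_decisions.
set y := x (n + count id chi)%N.
set mi := set_cell (set_point m y) u_cell (u n).
have point_frame (m' : @memory R) (w : d.-tuple R) j :
    [|| j == 0%N, (3 + d <= j < 7 + d)%N | (table d <= j)%N] -> set_point m' w j = m' j.
  rewrite /set_point /point_cell /table => hj; case: ifP => // hj'.
  by exfalso; move: hj hj'; clear; lia.
have point_coord (m' : @memory R) (w : d.-tuple R) i : (i < d)%N ->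
    set_point m' w (3 + i)%N = coord w i.
  by move=> id; rewrite /set_point /point_cell leq_addr ltn_add2l id addKn.
have smi : state beta z0 zs n zs (trunc_log 2 n) off mi.
  apply: state_frame sm => j hj; rewrite /mi set_other ?point_frame //.
  by apply/eqP => jE; move: hj; rewrite jE /u_cell /table; clear; lia.
have cube_r w : in_cube w -> forall z, z \in rcons zs w -> in_cube z.
  move=> hw z; rewrite mem_rcons inE => /orP[/eqP -> //|]; exact: selected_cube.
have := @decide_spec R d beta z0 d0 (space_bound d n.+1) zs y (u n) mi off.
rewrite sz => /(_ (cube_r _ (cube _)) (space_bound_enough d n) offh smi).
case=> [||m1 [t1 [s1 [e1 t1n s1n [off1 [sm1 off1h c1]]]]]].
- by rewrite /mi /set_cell eqxx.
- by move=> i id; rewrite /mi set_other ?point_coord.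
pose c : bool := m1 decision_cell != 0.
have chiS : decisions (haar_strategy beta) x u n.+1 = rcons chi c by rewrite /c c1.
set w := x (n + count id chi + c)%N.
have zsS : samples (haar_strategy beta) x u n.+1 = rcons zs w.
  by rewrite /samples chiS selected_rcons size_decisions.
have smw : state beta z0 zs n zs (trunc_log 2 n.+1) off1 (set_point m1 w).
  by apply: state_frame sm1 => j hj; apply: point_frame.
have := @update_spec R d beta z0 d0 (space_bound d n.+1) zs w (set_point m1 w) off1.
rewrite sz => /(_ (cube_r _ (cube _)) (space_bound_enough d n) off1h smw).
case=> [|m2 [t2 [s2 [e2 t2n s2n sm2]]]].
  by move=> i id; rewrite point_coord.
exists m2, (t + t1 + t2 + 2 * d.+1)%N, (maxn s (maxn s1 s2)); split.
- by rewrite chiS; apply: oversee_round ov e1 e2.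
- by exists off1; rewrite zsS.
- apply: leq_trans (time_boundS d0 n); rewrite leq_add2r.
  by apply: leq_add t2n; apply: leq_add tn t1n.
- by rewrite !geq_max s1n s2n (leq_trans sn (space_boundS d0 n)).
Qed.

Lemma trunc_log_bounds {R : realType} n : (2 <= n)%N ->
  [/\ 1 <= log2 (n%:R : R), (trunc_log 2 n).+1%:R <= 2 * log2 (n%:R : R)
    & (2 ^ trunc_log 2 n <= n)%N].
Proof.
move=> n2; have n0 : (0 < n)%N by apply: leq_trans n2.
have h1 : (1 <= trunc_log 2 n)%N by apply: (leq_trunc_log 2 n2).
have hL := log2_ge_trunc R n0.
have L1 : 1 <= log2 (n%:R : R) by apply: le_trans hL; rewrite ler1n.
split=> //; last exact: trunc_logP.
by rewrite -natr1 -[2]/(1 + 1) mulrDl mul1r lerD.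
Qed.

(** As 2^h <= n, the sum n + 2^(h+1) is at most 3n; and h + 1 <= 2 log n yields the factor 2^d. *)
Lemma time_bound_le {R : realType} d n : (2 <= n)%N ->
  (time_bound d n)%:R <= (3 * rate d * 2 ^ d)%N%:R * n%:R * log2 (n%:R : R) ^+ d.
Proof.
move=> /(@trunc_log_bounds R)[L1 hL nh].
set L := log2 _ in L1 hL *.
have -> : (3 * rate d * 2 ^ d)%N%:R * n%:R * L ^+ d =
          (rate d * (3 * n))%N%:R * (2 * L) ^+ d.
  rewrite [(2 * L) ^+ d]exprMn -natrX mulrA -!natrM; congr (_ * _); congr (_%:R).
  by move: (rate d) (2 ^ d)%N => a b; ring.
rewrite /time_bound natrM natrX; apply: ler_pM => //.
  by rewrite ler_nat leq_mul2l; apply/orP; right; move: nh; clear; lia.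
by rewrite lerXn2r // nnegrE // (le_trans _ hL).
Qed.

Lemma space_bound_le {R : realType} d n : (2 <= n)%N ->
  (space_bound d n)%:R <= (100 + 100 * d + 4 * 2 ^ d)%N%:R * n%:R * log2 (n%:R : R) ^+ d.
Proof.
move=> n2; have [L1 hL nh] := @trunc_log_bounds R _ n2.
set L := log2 _ in L1 hL *.
have Ld : 1 <= L ^+ d by apply: exprn_ege1.
have L0 : 0 <= L by apply: le_trans L1.
have -> : (100 + 100 * d + 4 * 2 ^ d)%N%:R * n%:R * L ^+ d =
   ((100 + 100 * d) * n)%N%:R * L ^+ d + (4 * n)%N%:R * (2 * L) ^+ d.
  rewrite [(2 * L) ^+ d]exprMn -natrX [X in _ + X]mulrA -!natrM -mulrDl -natrD; congr (_%:R * _).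
  by move: (2 ^ d)%N => b; ring.
rewrite /space_bound natrD; apply: lerD.
  apply: le_trans (_ : ((100 + 100 * d) * n)%N%:R <= _); last by rewrite ler_peMr.
  rewrite ler_nat /table; move: n2; clear => n2.
  have h : (100 + 100 * d <= (100 + 100 * d) * n)%N by rewrite leq_pmulr // ltnW.
  have -> : ((100 + 100 * d) * n = 100 * n + 100 * (d * n))%N by ring.
  have : (d <= d * n)%N by rewrite leq_pmulr // ltnW.
  move: (d * n)%N n2 => dn; clear; lia.
have -> : (4 * region d (trunc_log 2 n))%N = (4 * 2 ^ trunc_log 2 n * (trunc_log 2 n).+1 ^ d)%N.
  by rewrite /region; ring.
rewrite natrM [X in _ * X]natrX; apply: ler_pM => //.
  by rewrite ler_nat leq_mul2l nh orbT.
by rewrite lerXn2r // nnegrE // (le_trans _ hL).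
Qed.

Theorem theorem2 (R : realType) (d : nat) (hd : (1 <= d)%N) :
  (forall (beta : R), 0 < beta <= 1 ->
   forall (disp : measure_display) (T : measurableType disp)
     (P : probability T R)
     (X : nat -> {RV P >-> d.-tuple R}) (U : nat -> {RV P >-> R}),
     thinning_randomness X U ->
   forall (n : nat) (Delta : R), (2 <= n)%N -> 0 < Delta ->
   let Z := fun w =>
     samples (haar_strategy beta) (fun m => X m w) (fun m => U m w) n in
   let E := [set w | beta^-1 * log2 n%:R ^+ (2 * d)
                       * (Delta + 1000 + 100 * d%:R ^+ 2 * log2 n%:R)
                     <= discrepancy (Z w)] in
   measurable E /\ (P E <= (beta ^- 2 * expR (- Delta / 50))%:E)%E)
  /\
  (exists (p : overseer) (C : R),
   forall (beta : R), 0 < beta <= 1 ->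
   forall (x : nat -> d.-tuple R) (u : nat -> R),
     (forall m, in_cube (x m)) -> (forall m, 0 <= u m <= 1) ->
   forall n : nat, (2 <= n)%N ->
   exists (m : memory) (t s : nat),
     [/\ oversee p beta x u n (decisions (haar_strategy beta) x u n) m t s,
         t%:R <= C * n%:R * log2 n%:R ^+ d &
         s%:R <= C * n%:R * log2 n%:R ^+ d]).
Proof.
split.
  by move=> beta beta01 disp T P X U XU n Delta n2 Delta0; apply: haar_thinning_tail.
exists (Overseer (haar_decide d) (haar_update d)).
exists ((3 * rate d * 2 ^ d)%N%:R + (100 + 100 * d + 4 * 2 ^ d)%N%:R).
move=> beta _ x u cube _ n n2.
have [m [t [s [ov _ tn sn]]]] := oversee_haar [tuple 0 | i < d] beta u n hd cube.
have L0 : 0 <= log2 (n%:R : R) ^+ d.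
  by have [L1 _ _] := @trunc_log_bounds R _ n2; rewrite exprn_ge0 // (le_trans _ L1).
exists m, t, s; split=> //.
  apply: le_trans (_ : (time_bound d n)%:R <= _); first by rewrite ler_nat.
  apply: le_trans (time_bound_le d n2) _.
  by apply: ler_wpM2r => //; apply: ler_wpM2r => //; rewrite lerDl.
apply: le_trans (_ : (space_bound d n)%:R <= _); first by rewrite ler_nat.
apply: le_trans (space_bound_le d n2) _.
by apply: ler_wpM2r => //; apply: ler_wpM2r => //; rewrite lerDr.
Qed.
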